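(* Let $W$ be an ordinary holomorphic $d$-web of codimension one on a complex manifold $M$ of dimension $n\ge2$, with $d>n$, and assume that for every $h\ge h_0-2$ the space $R_h$ is a holomorphic vector bundle of (constant) rank $\rho_h$ on $M$. Let $h\ge h_0-2$ be such that $\rho_h=\rho_{h+1}$, so that $\pi_{h+1}:R_{h+1}\to R_h$ is an isomorphism of vector bundles, and let $\nabla^h$ be the associated tautological connection on $R_h$. Then: (i) A holomorphic section $s$ of $A\,(=R_0)$ is an abelian relation if and only if $j^hs$ is a section of $R_h$ and $\nabla^h(j^hs)\equiv0$. (ii) The rank $\rho(W)$ of the web is at most equal to the rank $\rho_h$ of the bundle $R_h$. Moreover: (iii) There exists an integer $h_1\ge h_0-2$ such that - either $\rho_{h_1}=0$, and then $\rho(W)=0$, - or $\rho_{h_1}=\rho_{h_1+1}\ (\ne0)$, the curvature $K^{h_1}$ of $\nabla^{h_1}$ vanishes, and then $\rho(W)=\rho_{h_1}$.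
   Context: **Webs.** A (totally decomposable) holomorphic $d$-web $W$ of codimension one, without singularity, on a complex $n$-dimensional manifold $M$ is the data of $d$ holomorphic regular foliations $\mathcal F_1,\dots,\mathcal F_d$ of codimension one on $M$, any two of them being transverse to each other at every point. It is assumed to be at least in weak general position: at every point there are at least $n$ of the $d$ foliations whose tangent spaces there are in general position. Locally $\mathcal F_i$ is defined by a first integral $u_i$ with $du_i$ nowhere zero. **Abelian relations and rank.** $A_i\subset T^*M$ is the line bundle of 1-forms vanishing on $T\mathcal F_i$. $A$ is the kernel of $Tr:\bigoplus_{i=1}^d A_i\to T^*M$, $(\omega_i)_i\mapsto\sum_i\omega_i$, a holomorphic vector bundle of rank $d-n$. An abelian relation (on a connected, simply connected open set) is a holomorphic section $s=(\omega_i)_i$ of $A$ such that $d\omega_i=0$ for all $i$. The rank of $W$ at a point is the dimension of the vector space of germs of abelian relations there; the rank $\rho(W)$ is the highest of the ranks at the points of $M$. **Formal abelian relations.** Let $B=(\wedge^2T^*M)^{\oplus d}$ and let $D$ be the first order differential operator $(\omega_i)_i\mapsto(d\omega_i)_i$ from sections of $A$ to sections of $B$. For $h\ge1$, $D_h:J^hA\to J^{h-1}B$ is the prolongation $j^hs\mapsto j^{h-1}(Ds)$, and $R_h=\ker D_h\subset J^hA$; $R_0=A$. The map $\pi_{h+1}:R_{h+1}\to R_h$ is truncation of jets. **Ordinary webs.** $c(n,h)=\frac{(n-1+h)!}{(n-1)!\,h!}$, and $h_0$ is the integer with $c(n,h_0-1)<d\le c(n,h_0)$. In local coordinates $(x_1,\dots,x_n)$,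 for $j\ge1$ let $P_j$ be the $c(n,j)\times d$ matrix with rows indexed by the multi-indices $L=(\ell_1,\dots,\ell_n)$ of degree $\sum_\lambda\ell_\lambda=j$, columns by $i\in\{1,\dots,d\}$, and entries $\prod_{\lambda=1}^n(\partial u_i/\partial x_\lambda)^{\ell_\lambda}$. $W$ is ordinary if for every $j\ge1$ the matrix $P_j$ has maximal rank $\inf(d,c(n,j))$ at every point. For an ordinary web and $h\ge h_0-2$, the map $\pi_{h+1}$ is injective, hence an isomorphism as soon as $\rho_h=\rho_{h+1}$. **Tautological connection.** Let $h\ge h_0-2$ with $\rho_h=\rho_{h+1}$. The canonical inclusion $J^{h+1}A\subset J^1(J^hA)$ induces a natural inclusion $\epsilon_h:R_{h+1}\hookrightarrow J^1R_h$. Let $v_h:R_h\to R_{h+1}$ be the inverse of the isomorphism $\pi_{h+1}$. Then $\xi_h=\epsilon_h\circ v_h$ is a splitting of the exact sequence $0\to T^*M\otimes R_h\to J^1R_h\to R_h\to0$, and defines the holomorphic connection $\nabla^h$ on $R_h$ with covariant derivative $\nabla^h\sigma=j^1\sigma-\xi_h(\sigma)\in T^*M\otimes R_h$. $K^h$ denotes the curvature of $\nabla^h$. *)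

(* Defs.v *)
From HB Require Import structures.
From mathcomp Require Import all_boot all_order all_algebra.
From mathcomp Require Import complex.
From mathcomp Require Import all_classical all_reals all_analysis.

Set Implicit Arguments.
Unset Strict Implicit.
Unset Printing Implicit Defensive.

Import Order.TTheory GRing.Theory Num.Theory numFieldNormedType.Exports.

Local Open Scope classical_set_scope.
Local Open Scope ring_scope.

(* Kept folded (never unfolded to R[i]) so that the topology and the norm that
   MathComp-Analysis puts on every numFieldType are found by inference. *)
Definition C (R : realType) : numFieldType := R[i].

(* S modulo Z has (e 0, ..., e (r-1)) as a basis, for subspaces Z <= S of V. *)
Definition basis_mod (K : numFieldType) (V : lmodType K) (S Z : set V)
    (r : nat) (e : 'I_r -> V) : Prop :=
  [/\ forall k, S (e k),
      forall a : 'I_r -> K, Z (\sum_k a k *: e k) -> forall k, a k = 0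
    & forall s, S s -> exists a : 'I_r -> K, Z (s - \sum_k a k *: e k)].

Section Holomorphic.
Variables (R : realType) (n : nat).

Definition partial (l : 'I_n) (f : 'rV[C R]_n -> C R) : 'rV[C R]_n -> C R :=
  fun x => 'D_(delta_mx 0 l) f x.

(* Continuously complex-differentiable, i.e. C^1 with the Cauchy-Riemann
   equations; U is meant to be open. *)
Definition holomorphic (U : set 'rV[C R]_n) (f : 'rV[C R]_n -> C R) : Prop :=
  forall x, U x ->
    differentiable f x /\ forall l : 'I_n, {for x, continuous (partial l f)}.

Definition mindex := {ffun 'I_n -> nat}.
Definition mdeg (L : mindex) : nat := (\sum_k L k)%N.
Definition mincr (L : mindex) (l : 'I_n) : mindex :=
  [ffun k => (L k + (k == l))%N].

Definition pderiv (L : mindex) (f : 'rV[C R]_n -> C R) : 'rV[C R]_n -> C R :=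
  foldr (fun l g => iter (L l) (partial l) g) f (enum 'I_n).

End Holomorphic.

Section Manifold.
Variables (R : realType) (n : nat).

Record chart (T : topologicalType) := Chart {
  cdom : set T;
  cmap :> T -> 'rV[C R]_n;
  cinv : 'rV[C R]_n -> T;
  chart_open : open cdom;
  chart_open_image : open (cmap @` cdom);
  chart_cancel : forall p, cdom p -> cinv (cmap p) = p;
  chart_continuous : forall p, cdom p -> {for p, continuous cmap};
  chart_inv_continuous :
    forall x, (cmap @` cdom) x -> {for x, continuous cinv} }.

Record complexManifold := ComplexManifold {
  carrier :> topologicalType;
  base_point : carrier;
  manifold_hausdorff : hausdorff_space carrier;
  manifold_second_countable : @second_countable carrier;
  atlas : set (chart carrier);
  atlas_cover : forall p, exists2 c, atlas c & cdom c p;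
  atlas_compatible : forall c c', atlas c -> atlas c' -> forall k : 'I_n,
    holomorphic (c @` (cdom c `&` cdom c')) (fun x => c' (cinv c x) 0 k) }.

Variable M : complexManifold.

Definition holomorphicM (U : set M) (u : M -> C R) : Prop :=
  forall c, atlas c ->
    holomorphic (c @` (U `&` cdom c)) (fun x => u (cinv c x)).

(* The components of du at p in the coordinates of the chart c. *)
Definition dcoord (c : chart M) (u : M -> C R) (p : M) : 'rV[C R]_n :=
  \row_l partial l (fun x => u (cinv c x)) (c p).

(* The jacobian matrix at c p of the change of coordinates c' o c^-1. *)
Definition jacobian (c c' : chart M) (p : M) : 'M[C R]_n :=
  \matrix_(k, l) partial l (fun x => c' (cinv c x) 0 k) (c p).

(* Regular holomorphic foliation of codimension one, given by local first
   integrals whose differentials have the same kernel on overlaps. *)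
Record foliation := Foliation {
  first_integral : set M -> (M -> C R) -> Prop;
  fol_cover : forall p, exists U u, first_integral U u /\ U p;
  fol_holomorphic : forall U u, first_integral U u -> open U /\ holomorphicM U u;
  fol_regular : forall U u, first_integral U u ->
    forall c p, atlas c -> cdom c p -> U p -> dcoord c u p != 0;
  fol_compatible : forall U u U' u',
    first_integral U u -> first_integral U' u' ->
    forall c p, atlas c -> cdom c p -> U p -> U' p ->
    forall v : 'cV[C R]_n, dcoord c u p *m v = 0 <-> dcoord c u' p *m v = 0 }.

(* T_pF, in the coordinates of c. *)
Definition tangent (F : foliation) (c : chart M) (p : M) : set 'cV[C R]_n :=
  [set v | exists U u, [/\ first_integral F U u, U p & dcoord c u p *m v = 0]].

(* The fiber at p of the line bundle of 1-forms vanishing on TF. *)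
Definition conormal (F : foliation) (c : chart M) (p : M) : set 'rV[C R]_n :=
  [set w | forall v, tangent F c p v -> w *m v = 0].

Definition transverse_at (F G : foliation) (p : M) : Prop :=
  forall c, atlas c -> cdom c p -> forall v : 'cV[C R]_n,
  exists v1 v2, [/\ tangent F c p v1, tangent G c p v2 & v = v1 + v2].

Variable d : nat.

(* Weak general position: n hyperplanes of an n-dimensional space are in
   general position iff they meet only at 0. *)
Record web := Web {
  fol :> 'I_d -> foliation;
  web_transverse : forall i j, i != j -> forall p, transverse_at (fol i) (fol j) p;
  web_weak_general_position : forall p, exists f : 'I_n -> 'I_d,
    injective f /\ forall c, atlas c -> cdom c p -> forall v : 'cV[C R]_n,
      (forall k, tangent (fol (f k)) c p v) -> v = 0 }.

(* A d-tuple of 1-forms on an open subset of M, given by its components in each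
   chart: row i of w c x holds the components of the i-th form at the point of
   coordinates x.  Only the charts of the atlas matter, and only the values at
   the points of the open set. *)
Definition forms := chart M -> 'rV[C R]_n -> 'M[C R]_(d, n).

Variable W : web.

(* Holomorphic section over the open set Om of A = ker Tr. *)
Definition sectionA (Om : set M) (s : forms) : Prop :=
  [/\ forall c, atlas c -> forall i l,
        holomorphic (c @` (Om `&` cdom c)) (fun x => s c x i l),
      forall c c' p, atlas c -> atlas c' -> Om p -> cdom c p -> cdom c' p ->
        s c (c p) = s c' (c' p) *m jacobian c c' p,
      forall c p, atlas c -> Om p -> cdom c p ->
        forall i, conormal (W i) c p (row i (s c (c p)))
    & forall c p, atlas c -> Om p -> cdom c p ->
        \sum_i row i (s c (c p)) = 0].

(* The (l, m) component of the exterior derivative of the i-th form. *)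
Definition dform (w : 'rV[C R]_n -> 'M[C R]_(d, n)) (i : 'I_d) (l m : 'I_n) :
    'rV[C R]_n -> C R :=
  fun x => partial l (fun y => w y i m) x - partial m (fun y => w y i l) x.

Definition abelian_relation (Om : set M) (s : forms) : Prop :=
  sectionA Om s /\
  forall c p, atlas c -> Om p -> cdom c p ->
    forall i l m, dform (s c) i l m (c p) = 0.

Definition abelian_relations_near (p : M) : set forms :=
  [set s | exists Om, [/\ open Om, Om p & abelian_relation Om s]].

Definition zero_germ (p : M) : set forms :=
  [set s | exists Om, [/\ open Om, Om p &
    forall c q, atlas c -> Om q -> cdom c q -> s c (c q) = 0]].

Definition rank_at (p : M) (r : nat) : Prop :=
  exists e : 'I_r -> forms, basis_mod (abelian_relations_near p) (zero_germ p) e.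

(* r is the highest of the ranks at the points of M. *)
Definition web_rank (r : nat) : Prop :=
  (forall p, exists2 r', rank_at p r' & (r' <= r)%N) /\ exists p, rank_at p r.

(* Jets are written in coordinates: an h-jet of d-tuples of 1-forms at a point
   is the array of its partial derivatives of order at most h, extended by 0 to
   the multi-indices of degree > h. *)
Definition jetT := mindex n -> 'M[C R]_(d, n).

Definition jet (h : nat) (w : 'rV[C R]_n -> 'M[C R]_(d, n))
    (x : 'rV[C R]_n) : jetT :=
  fun L => if (mdeg L <= h)%N
           then \matrix_(i, l) pderiv L (fun y => w y i l) x else 0.

(* For J' = jet h.+1 s, [trunc h J'] is jet h s, and [shift h l J'] is the
   partial derivative of jet h s in the direction l. *)
Definition trunc (h : nat) (J : jetT) : jetT :=
  fun L => if (mdeg L <= h)%N then J L else 0.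
Definition shift (h : nat) (l : 'I_n) (J : jetT) : jetT :=
  fun L => if (mdeg L <= h)%N then J (mincr L l) else 0.

(* The fiber of R_h at the point of coordinates x in the chart c: the jets
   j^h s of local sections s of A such that j^(h-1)(Ds) vanishes at that point
   (no condition when h = 0, so that R_0 = A). *)
Definition Rfiber (h : nat) (c : chart M) (x : 'rV[C R]_n) : set jetT :=
  [set J | exists Om s, [/\ open Om, Om (cinv c x), sectionA Om s,
    J = jet h (s c) x
  & forall L, (mdeg L < h)%N -> forall i l m, pderiv L (dform (s c) i l m) x = 0]].

Definition holomorphic_jets (V : set 'rV[C R]_n) (sg : 'rV[C R]_n -> jetT) : Prop :=
  forall L i l, holomorphic V (fun x => sg x L i l).

(* R_h is a holomorphic vector bundle of rank r: it has holomorphic frames of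
   r elements near every point. *)
Definition R_bundle (h r : nat) : Prop :=
  forall c p, atlas c -> cdom c p -> exists V, [/\ open V, V (c p),
    V `<=` c @` cdom c
  & exists e : 'I_r -> 'rV[C R]_n -> jetT,
      (forall k, holomorphic_jets V (e k)) /\
      forall x, V x -> basis_mod (Rfiber h c x) [set 0] (e ^~ x)].

(* The inverse of the truncation R_(h+1) -> R_h, where this is bijective. *)
Definition vlift (h : nat) (c : chart M) (x : 'rV[C R]_n) (J : jetT) : jetT :=
  xget 0 [set J' | Rfiber h.+1 c x J' /\ trunc h J' = J].

(* The component along dx_l of the tautological covariant derivative
   j^1 sg - xi_h(sg) of a section sg of R_h: the terms of order 0 of j^1 sg and
   of xi_h(sg) are both equal to sg, and those of order 1 are subtracted. *)
Definition nabla (h : nat) (c : chart M) (l : 'I_n)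
    (sg : 'rV[C R]_n -> jetT) : 'rV[C R]_n -> jetT :=
  fun x => (fun L => \matrix_(i, k) partial l (fun y => sg y L i k) x)
           - shift h l (vlift h c x (sg x)).

(* The (l, m) component of K^h applied to sg; there is no bracket term because
   coordinate vector fields commute. *)
Definition curvature (h : nat) (c : chart M) (l m : 'I_n)
    (sg : 'rV[C R]_n -> jetT) : 'rV[C R]_n -> jetT :=
  fun x => nabla h c l (nabla h c m sg) x - nabla h c m (nabla h c l sg) x.

(* K^h is a tensor and R_h has local sections through each of its points, so
   K^h = 0 is tested on local holomorphic sections. *)
Definition curvature_vanishes (h : nat) : Prop :=
  forall c, atlas c -> forall V sg, open V -> V `<=` c @` cdom c ->
    holomorphic_jets V sg -> (forall x, V x -> Rfiber h c x (sg x)) ->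
    forall l m x, V x -> curvature h c l m sg x = 0.

Definition section_of_R (h : nat) (Om : set M) (s : forms) : Prop :=
  forall c p, atlas c -> Om p -> cdom c p ->
    Rfiber h c (c p) (jet h (s c) (c p)).

Definition parallel_jet (h : nat) (Om : set M) (s : forms) : Prop :=
  forall c p, atlas c -> Om p -> cdom c p ->
    forall l, nabla h c l (jet h (s c)) (c p) = 0.

(* (n-1+h)! / ((n-1)! h!) *)
Definition cnum (h : nat) : nat := 'C(n.-1 + h, h).

Definition hindex (j : nat) :=
  {L : {ffun 'I_n -> 'I_j.+1} | (\sum_k (L k : nat))%N == j}.

Definition Pmatrix (j : nat) (c : chart M) (u : 'I_d -> M -> C R) (p : M) :
    'M[C R]_(#|{: hindex j}|, d) :=
  \matrix_(a, i) \prod_l dcoord c (u i) p 0 l ^+ val (enum_val a : hindex j) l.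

(* Whatever the local coordinates and the local first integrals u_i. *)
Definition ordinary : Prop :=
  forall j, (1 <= j)%N -> forall c p, atlas c -> cdom c p ->
  forall (U : 'I_d -> set M) (u : 'I_d -> M -> C R),
    (forall i, first_integral (W i) (U i) (u i) /\ U i p) ->
    \rank (Pmatrix j c u p) = minn d (cnum j).

End Manifold.

(* Main.v *)
Require Import Defs.
From HB Require Import structures.
From mathcomp Require Import all_boot all_order all_algebra.
From mathcomp Require Import complex.
From mathcomp Require Import all_classical all_reals all_analysis.
From mathcomp Require Import ring.
Set Implicit Arguments.
Unset Strict Implicit.
Unset Printing Implicit Defensive.
Import Order.TTheory GRing.Theory Num.Theory numFieldNormedType.Exports.
Local Open Scope classical_set_scope.
Local Open Scope ring_scope.

(** Near a point, take first integrals u_i of the foliations in a chart. A jet of order h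
   lies in the fiber of R_h exactly when it solves linear equations with holomorphic
   coefficients: the forms are proportional to the du_i, their sum is zero, and their
   derivatives have the symmetry of those of closed forms (eqR, jet_eqR, realize,
   Rfiber_eqR). A solution of order h + 1 with zero truncation is, up to a scalar a_i for
   each i, the tuple of the powers of degree h + 2 of the du_i, and these have zero sum; for
   an ordinary web and h + 2 >= h_0 they are independent, so the solution is zero
   (symbol_inj). Hence pi_(h+1) is injective for h >= h_0 - 2, the ranks rho_h decrease
   (rank_anti), and they are constant from some h_1 on.

   The point is that R_h1 then consists of the jets of actual abelian relations. Each
   element of R_h1 lifts uniquely to every R_k, hence to a formal solution (formal_lift).
   Let E_a be the lifts of a holomorphic frame of R_h1. The derivative of E_a minus its
   shift is again a formal solution, so it is a combination of the E_b with holomorphic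
   coefficients (connection): the entries of degree k + 1 of the E_a are first derivatives
   of those of degree k, corrected by terms of order 0. Cauchy estimates on shrinking balls
   bound the entries of degree N by C D^N N! (nagumo, lift_growth). So the Taylor series
   with these coefficients converge, and their sums are closed sections of A
   (realize_closed). No nonzero germ of abelian relation has zero h_1-jet
   (relation_jet_inj), so the web has rank rho_h1 at every point (rank_stable), and rho_h1
   is at most rho_h for all h >= h_0 - 2.

   The jet of a closed section has the jet of next order as its lift, so it is parallel, and
   the connection differentiates the coefficients of a combination of such jets
   (lnabla_comb). On R_h1, where they form local frames, the curvature vanishes by the
   symmetry of second derivatives (flat_curvature). Conversely a section of A whose jet is
   in R_h and parallel is closed, since its first derivatives are entries of an element of
   R_(h+1) (lnabla_closed).

   A holomorphic function is here a C^1 solution of the Cauchy-Riemann equations. That its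
   derivatives are again holomorphic and commute, the Cauchy estimates and the identity
   theorem all come from Cauchy's formula for a first derivative (cauchy1). It is proved by
   differentiating, in the radius and along the circle, the mean of f against the inverse of
   the parameter of the circle, where the mean over the circle is the limit along an
   ultrafilter of the averages over the roots of unity. *)

(** * Differentiability by estimates *)
Section Epsilon.
Variables (K : numFieldType).

Lemma near_normP (V : normedModType K) (x : V) (P : set V) :
  nbhs x P <-> exists2 e : K, 0 < e & forall y, `|y - x| < e -> P y.
Proof.
apply: iff_trans (nbhs_normP x P) _; split.
- move=> [e /= e0 eP]; exists e => // y yx; apply: eP.
  by rewrite /ball_ /= distrC.
- move=> [e e0 eP]; exists e => //= y; rewrite /ball_ /= distrC => yx.
  exact: eP.
Qed.

Lemma cont_normP (V W : normedModType K) (f : V -> W) (x : V) :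
  {for x, continuous f} <->
  forall e : K, 0 < e -> exists2 d : K, 0 < d &
    forall y, `|y - x| < d -> `|f y - f x| < e.
Proof.
split=> [fx e e0 | fx].
  apply/(near_normP x (fun y => `|f y - f x| < e)).
  by apply: (fx [set z | `|z - f x| < e]); apply/near_normP; exists e.
move=> A /near_normP [e e0 eA]; have [d d0 dA] := fx e e0.
by apply/near_normP; exists d => // y /dA /eA.
Qed.

Lemma open_normP (V : normedModType K) (U : set V) :
  open U <->
  forall x, U x -> exists2 e : K, 0 < e & forall y, `|y - x| < e -> U y.
Proof.
rewrite openE; split=> [oU x /oU /near_normP //|oU x Ux].
exact/near_normP/oU.
Qed.

Lemma lt_minP (a b : K) : 0 < a -> 0 < b ->
  exists2 c, 0 < c & forall z : K, z < c -> z < a /\ z < b.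
Proof.
move=> a0 b0; have ab : a >=< b by apply: real_comparable; exact: gtr0_real.
case/comparable_leP: ab => h; [exists a|exists b] => // z zc; split=> //.
  exact: lt_le_trans h.
exact: lt_trans h.
Qed.

Lemma half_lt (d : K) : 0 < d -> d / 2 < d.
Proof. by move=> d0; rewrite ltr_pdivrMr // mulrDr mulr1 ltrDl. Qed.

(** A finite number of conditions that hold near x hold on a common ball. *)
Lemma norm_near_fin (V : normedModType K) (x : V) (I : finType) (Q : I -> V -> Prop) :
  (forall i, exists2 d : K, 0 < d & forall y, `|y - x| < d -> Q i y) ->
  exists2 d : K, 0 < d & forall y, `|y - x| < d -> forall i, Q i y.
Proof.
move=> HQ; suff [d d0 dP] : exists2 d : K, 0 < d &
    forall y, `|y - x| < d -> forall i, i \in enum I -> Q i y.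
  by exists d => // y yd i; apply: (dP y yd); rewrite mem_enum.
elim: (enum I) => [|i s [d d0 dP]]; first by exists 1.
have [d' d'0 d'P] := HQ i.
have [c c0 cP] := lt_minP d0 d'0; exists c => // y /cP [yd yd'] j.
by rewrite inE => /orP[/eqP ->|]; [exact: d'P|exact: dP].
Qed.

Lemma coord_norm n (w : 'rV[K]_n) i : `|w 0 i| <= `|w|.
Proof.
rewrite {2}/Num.norm /= mx_normE.
set F := fun ij : 'I_1 * 'I_n => (`|w ij.1 ij.2|)%:nng.
rewrite -[leLHS]/((F (0, i))%:num) num_le.
exact: (le_bigmax _ F (0, i)).
Qed.

Lemma rV_norm_le n (w : 'rV[K]_n) (B : K) : 0 <= B ->
  (forall i, `|w 0 i| <= B) -> `|w| <= B.
Proof.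
move=> B0 wB; have [->|/eqP w0] := eqVneq w 0; first by rewrite normr0.
have [|[i j] /= e] := @mx_norm_neq0 _ _ _ w.
  by apply/eqP => /mx_norm_eq0; exact: w0.
by rewrite /Num.norm /= e ord1; exact: wB.
Qed.

Lemma norm_delta n (k : 'I_n) : `|delta_mx 0 k : 'rV[K]_n| = 1.
Proof.
apply/eqP; rewrite eq_le; apply/andP; split.
  apply: rV_norm_le => // i; rewrite mxE eqxx /=.
  by case: (i == k); rewrite ?normr1 ?normr0.
by apply: le_trans (coord_norm _ k); rewrite mxE !eqxx normr1.
Qed.

End Epsilon.

Section HasGrad.
Variables (K : numFieldType) (n : nat).
Local Notation partial l f x := ('D_(delta_mx 0 l) f x).
Implicit Types (f g : 'rV[K]_n -> K) (x : 'rV[K]_n).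

(** Differentiability with gradient c, in the form that the estimates below produce directly. *)
Definition hasgrad f x (c : 'I_n -> K) := forall e : K, 0 < e ->
  exists2 d : K, 0 < d & forall w, `|w| < d ->
    `|f (x + w) - f x - \sum_m c m * w 0 m| <= e * `|w|.

Lemma rV_sum (w : 'rV[K]_n) : w = \sum_m w 0 m *: delta_mx 0 m.
Proof. exact: row_sum_delta. Qed.

Lemma hasgrad_diff f x c : hasgrad f x c ->
  differentiable f x /\ forall m, partial m f x = c m.
Proof.
move=> fx.
pose L := (fun w : 'rV[K]_n => \sum_m c m * w 0 m : K).
have linL : linear L.
  move=> a u v; rewrite /L scaler_sumr -big_split /=; apply: eq_bigr => i _.
  by rewrite !mxE mulrDr; congr (_ + _); rewrite /GRing.scale /= mulrCA.
pose L' : {linear 'rV[K]_n -> K} := HB.pack L (GRing.isLinear.Build _ _ _ _ L linL).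
have cL : continuous L'.
  have -> : L' = \sum_m (fun w : 'rV[K]_n => c m * w 0 m : K) :> (_ -> _).
    by apply/funext => w; rewrite fct_sumE.
  apply: (big_ind (fun g : 'rV[K]_n -> K => continuous g)).
  - exact: cst_continuous.
  - by move=> g h cg ch w; apply: continuousD; [exact: cg|exact: ch].
  - move=> i _ w; apply: (@continuousM K _ (fun=> c i) (fun w : 'rV[K]_n => w 0 i)).
      exact: cst_continuous.
    exact: (@coord_continuous K 1 n 0 i).
have fL : f \o shift x = cst (f x) + L' +o_ (0 : 'rV[K]_n) id.
  apply/eqaddoP => e e0; have [d d0 dP] := fx e e0; apply/near_normP.
  exists d => // w; rewrite subr0 => wd; have := dP _ wd.
  by rewrite opprD addrA [x + w]addrC.
have df : differentiable f x.
  apply/diffP.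
  apply: (@getPex _ (fun df : {linear 'rV[K]_n -> K} => continuous df /\
    forall y, f y = f (lim (nbhs x)) + df (y - lim (nbhs x))
                    +o_(y \near x) (y - lim (nbhs x)))).
  exists L'; split => //.
  suff H : f = cst (f (lim (nbhs x))) + (fun y => L' (y - lim (nbhs x)))
     +o_ (nbhs x) (fun y => y - lim (nbhs x)) by move=> y; move: H; rewrite funeqE => /(_ y).
  apply/eqaddoP => e e0; rewrite lim_id //.
  have [d d0 dP] := fx e e0; apply/near_normP; exists d => // y yx.
  by have := dP _ yx; rewrite subrKC opprD addrA.
split=> // m; rewrite deriveE // (diff_unique cL fL) /= /L.
rewrite (bigD1 m) //= big1 ?addr0 => [|j jm]; rewrite mxE eqxx ?eqxx ?mulr1 //=.
by rewrite (negPf jm) mulr0.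
Qed.

Lemma diff_hasgrad f x : differentiable f x -> hasgrad f x (fun m => partial m f x).
Proof.
move=> fx e e0.
have [_ /eqaddoP /(_ e e0) /near_normP [d d0 dP]] := (diff_locallyP _ _).1 fx.
exists d => // w wd; have := dP w; rewrite subr0 => /(_ wd) /=.
suff -> : (f \o shift x - (cst (f x) + 'd f x)) w =
  f (x + w) - f x - \sum_(m < n) partial m f x * w 0 m by [].
rewrite /= opprD addrA [x + w]addrC; congr (_ - _).
rewrite {1}[w]rV_sum linear_sum; apply: eq_bigr => i _.
by rewrite linearZ /= deriveE // mulrC.
Qed.

Lemma eq_hasgrad f x c c' : c =1 c' -> hasgrad f x c -> hasgrad f x c'.
Proof.
move=> cc' fx e e0; have [d d0 dP] := fx e e0; exists d => // w /dP.
by under eq_bigr => i _ do rewrite cc'.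
Qed.

Lemma partialD l f g x : differentiable f x -> differentiable g x ->
  partial l (fun y => f y + g y) x = partial l f x + partial l g x.
Proof. by move=> df dg; rewrite deriveD//; exact: diff_derivable. Qed.

Lemma partialN l f x : differentiable f x ->
  partial l (fun y => - f y) x = - partial l f x.
Proof. by move=> df; rewrite deriveN//; exact: diff_derivable. Qed.

Lemma partialM l f g x : differentiable f x -> differentiable g x ->
  partial l (fun y => f y * g y) x = partial l f x * g x + f x * partial l g x.
Proof.
move=> df dg.
have := @deriveM K _ f g x (delta_mx 0 l) (diff_derivable df) (diff_derivable dg).
by rewrite addrC /GRing.scale /= [g x * _]mulrC => <-.
Qed.

Lemma partialV l f x : f x != 0 -> differentiable f x ->
  partial l (fun y => (f y)^-1) x = - (f x)^-2 * partial l f x.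
Proof.
by move=> f0 df; apply: (@deriveV K _ f x (delta_mx 0 l) f0 (diff_derivable df)).
Qed.

Lemma partial_cst l (a : K) x : partial l (fun=> a) x = 0.
Proof. exact: derive_cst. Qed.

Lemma hasgrad_coord (k : 'I_n) x :
  hasgrad (fun y : 'rV[K]_n => y 0 k) x (fun m => (m == k)%:R).
Proof.
move=> e e0; exists 1 => // w _.
rewrite mxE addrAC addrAC (addrC (x 0 k)) addrK (bigD1 k) //= eqxx mul1r big1 => [|i ik].
  by rewrite addr0 subrr normr0 mulr_ge0 // ltW.
by rewrite (negPf ik) mul0r.
Qed.

Lemma diff_coord (k : 'I_n) x : differentiable (fun y : 'rV[K]_n => y 0 k : K) x.
Proof. exact: (hasgrad_diff (hasgrad_coord k x)).1. Qed.

Lemma partial_coord l (k : 'I_n) x :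
  partial l (fun y : 'rV[K]_n => y 0 k : K) x = (l == k)%:R.
Proof. exact: (hasgrad_diff (hasgrad_coord k x)).2. Qed.

(** The chain rule, with the inner map given by its coordinates. *)
Lemma hasgrad_comp (p : nat) (phi : 'rV[K]_p -> 'rV[K]_n) f (y : 'rV[K]_p)
    c (c' : 'I_n -> 'I_p -> K) :
  hasgrad f (phi y) c ->
  (forall k, differentiable (fun z => phi z 0 k) y) ->
  (forall k l, 'D_(delta_mx 0 l) (fun z => phi z 0 k) y = c' k l) ->
  differentiable (f \o phi) y /\
  forall l, 'D_(delta_mx 0 l) (f \o phi) y = \sum_k c k * c' k l.
Proof.
move=> fy dphi pphi.
have [df pf] := hasgrad_diff fy.
have phiE : phi = (fun z => \sum_k (phi z 0 k : K) *: (delta_mx 0 k : 'rV[K]_n)).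
  by apply/funext => z; rewrite -row_sum_delta.
have phiE' : phi = \sum_k (fun z => (phi z 0 k : K) *: (delta_mx 0 k : 'rV[K]_n)).
  by rewrite {1}phiE; apply/funext => z; rewrite fct_sumE.
have dphi' : differentiable phi y.
  rewrite phiE'; apply: differentiable_sum => k.
  exact: (differentiableZl (k := fun z => phi z 0 k)).
split; first exact: differentiable_comp.
move=> l; have dfp : differentiable (f \o phi) y by exact: differentiable_comp.
rewrite deriveE // diff_comp //=.
have -> : 'd phi y (delta_mx 0 l) = \sum_k c' k l *: delta_mx 0 k.
  rewrite -deriveE // {1}phiE' derive_sum; last first.
    move=> k; apply: diff_derivable.
    exact: (differentiableZl (k := fun z => phi z 0 k)).
  apply: eq_bigr => k _.
  rewrite deriveE; last exact: (differentiableZl (k := fun z => phi z 0 k)).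
  rewrite (diffZl (k := fun z => phi z 0 k)) //=.
  by rewrite -pphi deriveE.
rewrite linear_sum; apply: eq_bigr => k _.
by rewrite linearZ /= -deriveE // pf mulrC.
Qed.

End HasGrad.

(** * Complex numbers and the mean value inequality *)
Section ComplexNumbers.
Variable R : realType.
Notation K := (C R).

Definition toC (a : R) : K := (a%:C)%C.
Definition reC (z : K) : R := complex.Re z.
Definition imC (z : K) : R := complex.Im z.
Definition mkC (a b : R) : K := (a +i* b)%C.

Lemma toCD : {morph toC : x y / x + y}. Proof. exact: rmorphD. Qed.
Lemma toCM : {morph toC : x y / x * y}. Proof. exact: rmorphM. Qed.
Lemma toCX n : {morph toC : x / x ^+ n}. Proof. exact: rmorphXn. Qed.
Lemma toCB : {morph toC : x y / x - y}. Proof. exact: rmorphB. Qed.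
Lemma toCV : {morph toC : x / x^-1}. Proof. exact: fmorphV. Qed.
Lemma toC_nat n : toC n%:R = n%:R. Proof. exact: rmorph_nat. Qed.
Lemma toC0 : toC 0 = 0. Proof. exact: rmorph0. Qed.
Lemma toC1 : toC 1 = 1. Proof. exact: rmorph1. Qed.
Lemma toC_le a b : (toC a <= toC b) = (a <= b).
Proof. exact: lecR. Qed.
Lemma toC_lt a b : (toC a < toC b) = (a < b).
Proof. exact: ltcR. Qed.
Lemma toC_norm a : `|toC a| = toC `|a|.
Proof.
by rewrite /toC normc_def /= expr0n addr0 sqrtr_sqr.
Qed.
Lemma toC_ge0 a : (0 <= toC a) = (0 <= a). Proof. exact: ler0c. Qed.
Lemma toC_gt0 a : (0 < toC a) = (0 < a). Proof. by rewrite -toC0 toC_lt. Qed.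

Lemma ge0_toC (e : K) : 0 <= e -> e = toC (reC e).
Proof. by move=> e0; exact/esym/RRe_real/ger0_real. Qed.

Lemma reCB : {morph reC : x y / x - y}. Proof. exact: raddfB. Qed.
Lemma reC_toCM a z : reC (toC a * z) = a * reC z.
Proof. by case: z => x y /=; rewrite mul0r subr0. Qed.
Lemma reC_Mto a z : reC (z * toC a) = reC z * a.
Proof. by rewrite mulrC reC_toCM mulrC. Qed.
Lemma reC_le (z : K) (b : R) : `|z| <= toC b -> reC z <= b.
Proof.
move=> zb; rewrite -toC_le; apply: le_trans zb.
by apply: le_trans (normc_ge_Re z); rewrite lecR ler_norm.
Qed.
Lemma norm_reC (z : K) : toC `|reC z| <= `|z|.
Proof. exact: normc_ge_Re. Qed.
Lemma norm_mkC a b : `|mkC a b| <= toC (`|a| + `|b|).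
Proof.
have -> : mkC a b = toC a + mkC 0 b by rewrite /mkC /toC /=; simpc.
rewrite toCD; apply: le_trans (ler_normD _ _) _; rewrite toC_norm lerD2l.
by rewrite normc_def /= expr0n add0r sqrtr_sqr.
Qed.
Lemma mkC_reim (z : K) : z = mkC (reC z) (imC z).
Proof. by case: z. Qed.
Lemma norm_imC (z : K) : toC `|imC z| <= `|z|.
Proof.
rewrite normc_def lecR -sqrtr_sqr ler_wsqrtr// lerDr sqr_ge0 //.
Qed.
Lemma mkCB a b a' b' : mkC a b - mkC a' b' = mkC (a - a') (b - b').
Proof. by []. Qed.

Definition hasder (K' : numFieldType) (f : K' -> K') (z c : K') := forall e : K', 0 < e ->
  exists2 d : K', 0 < d & forall s, `|s| < d -> `|f (z + s) - f z - c * s| <= e * `|s|.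

Lemma hasder_is_derive (K' : numFieldType) (f : K' -> K') z c :
  hasder f z c -> is_derive z 1 f c.
Proof.
move=> fz.
have H : h^-1 *: (f (h *: 1 + z) - f z) @[h --> 0^'] --> c.
  move=> A /near_normP [e e0 eA].
  have e2 : 0 < e / 2 by rewrite divr_gt0.
  have [d d0 dP] := fz _ e2.
  change (nbhs (0 : K') [set h | h != 0 -> A (h^-1 *: (f (h *: 1 + z) - f z))]).
  apply/near_normP; exists d => // h; rewrite subr0 => hd h0.
  apply: eA; have /= := dP _ hd.
  have -> : h^-1 *: (f (h *: 1 + z) - f z) - c = h^-1 * (f (z + h) - f z - c * h).
    rewrite mulrBr [X in _ = _ - X]mulrCA mulVf // mulr1; congr (_ - _).
    by rewrite /GRing.scale /= mulr1 addrC (addrC h) (addrC _ (f _)).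
  rewrite normrM normfV => H.
  rewrite mulrC ltr_pdivrMr ?normr_gt0 //.
  by apply: le_lt_trans H _; rewrite ltr_pM2r ?normr_gt0 // ltr_pdivrMr // mulrDr mulr1 ltrDl.
by split; [apply/cvg_ex; exists c | apply/cvg_lim].
Qed.

Lemma hasderZ (K' : numFieldType) (u : K') f z c : hasder f z c -> hasder (fun y => u * f y) z (u * c).
Proof.
move=> fz e e0.
have u0 : 0 < e / (`|u| + 1) by rewrite divr_gt0 // ltr_wpDl.
have [d d0 dP] := fz _ u0; exists d => // s /dP H.
rewrite -mulrBr -mulrA -mulrBr normrM.
apply: le_trans (ler_wpM2l (normr_ge0 _) H) _.
rewrite mulrA ler_wpM2r // mulrCA -ler_pdivlMl // mulVf ?lt0r_neq0 //.
by rewrite ler_pdivrMr ?ltr_wpDl // mul1r lerDl.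
Qed.

Lemma hasder_re f (t : R) (c : K) : hasder f (toC t) c ->
  hasder (fun s : R => reC (f (toC s))) t (reC c).
Proof.
move=> ft e e0; have [|d d0 dP] := ft (toC e); first by rewrite toC_gt0.
exists (reC d); first by rewrite -toC_gt0 -ge0_toC // ltW.
move=> s sd; have /dP : `|toC s| < d.
  by rewrite (ge0_toC (ltW d0)) toC_norm toC_lt.
rewrite -toCD toC_norm -toCM -reC_Mto -!reCB => H.
by rewrite -toC_le; apply: le_trans H; exact: norm_reC.
Qed.

(** Mean value inequality, weighted by a power so that it can be iterated
   into Taylor's estimate without losing the factorial. *)
Lemma mean_value (phi dphi : K -> K) (B : K) (j : nat) : 0 <= B ->
  (forall t : R, 0 <= t <= 1 -> hasder phi (toC t) (dphi (toC t))) ->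
  (forall t : R, 0 <= t <= 1 -> `|dphi (toC t)| <= B * toC t ^+ j) ->
  `|phi 1 - phi 0| <= B / j.+1%:R.
Proof.
move=> B0 dphiP phiB.
set z := phi 1 - phi 0.
have [->|z0] := eqVneq z 0; first by rewrite normr0 divr_ge0.
(* Multiplying by u makes the increment real; its real part is compared with
   b t^(j + 1) / (j + 1). *)
pose u := `|z| / z.
have u1 : `|u| = 1 by rewrite normrM normfV normr_id divff // normr_eq0.
pose b := reC B.
have BE : B = toC b by exact: ge0_toC.
pose g (t : R) := reC (u * phi (toC t)) - b / j.+1%:R * t ^+ j.+1.
pose dg (t : R) := reC (u * dphi (toC t)) - b * t ^+ j.
have dgP (t : R) : 0 <= t <= 1 -> is_derive t 1 g (dg t).
  move=> t01; apply: is_deriveB.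
    apply: hasder_is_derive; apply: (@hasder_re (fun y => u * phi y)).
    by apply: hasderZ; exact: dphiP.
  have := @is_deriveZ R R R (fun x => x ^+ j.+1) (b / j.+1%:R) t 1 _
    (DeriveDef (@exprn_derivable _ j.+1 t 1) (@exp_derive _ j.+1 t 1)).
  by rewrite /GRing.scale /= mulr1 mulrA divfK.
have dg_le (t : R) : 0 <= t <= 1 -> dg t <= 0.
  move=> t01; rewrite subr_le0; apply: reC_le.
  by rewrite normrM u1 mul1r toCM toCX -BE; exact: phiB.
have [||c c01 gE] := @MVT R g dg 0 1 ltr01.
- by move=> t; rewrite in_itv /= => /andP[t0 t1]; apply: dgP; rewrite !ltW.
- apply: derivable_within_continuous => t; rewrite in_itv /= => /dgP [] //.
have : g 1 - g 0 <= 0.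
  rewrite gE subr0 mulr1; apply: dg_le; move: c01.
  by rewrite in_itv /= => /andP[t0 t1]; rewrite !ltW.
rewrite /g expr1n expr0n mulr0 subr0 mulr1 addrAC subr_le0 -reCB toC0 toC1 -mulrBr -/z.
rewrite /u divfK // => h.
by rewrite (@ge0_toC `|z|) // BE -toC_nat -toCV -toCM toC_le.
Qed.

(** The previous inequality on the segment from x to x + v. *)
Lemma mean_value_rV n (f : 'rV[K]_n -> K) (x v : 'rV[K]_n) (c : 'rV[K]_n -> 'I_n -> K)
    (B : K) (j : nat) : 0 <= B ->
  (forall t : R, 0 <= t <= 1 -> hasgrad f (x + toC t *: v) (c (x + toC t *: v))) ->
  (forall t : R, 0 <= t <= 1 ->
     `|\sum_m c (x + toC t *: v) m * v 0 m| <= B * toC t ^+ j) ->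
  `|f (x + v) - f x| <= B / j.+1%:R.
Proof.
move=> B0 fc cB.
have := @mean_value (fun z => f (x + z *: v)) (fun z => \sum_m c (x + z *: v) m * v 0 m) B j B0.
rewrite scale1r scale0r addr0; apply => // t t01 e e0.
have v0 : 0 < e / (`|v| + 1) by rewrite divr_gt0 // ltr_wpDl.
have [d d0 dP] := fc t t01 _ v0.
exists (d / (`|v| + 1)); first by rewrite divr_gt0 // ltr_wpDl.
move=> s; rewrite ltr_pdivlMr ?ltr_wpDl // => sd.
have /dP : `|s *: v| < d.
  by rewrite normrZ; apply: le_lt_trans sd; rewrite ler_wpM2l // lerDl.
rewrite scalerDl addrA.
under [in X in X -> _]eq_bigr => i _ do rewrite mxE mulrCA.
rewrite -mulr_sumr [s * _]mulrC normrZ => H; apply: le_trans H _.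
have v1 : `|v| + 1 != 0 by rewrite lt0r_neq0 // ltr_wpDl.
have -> : e * `|s| = e / (`|v| + 1) * (`|s| * (`|v| + 1)).
  by rewrite mulrCA divfK // mulrC.
by rewrite ler_wpM2l ?(ltW v0) // ler_wpM2l // lerDl.
Qed.

End ComplexNumbers.

(** * Limits along an ultrafilter *)
Section UltraLimit.
Variable R : realType.
Notation K := (C R).

Lemma toC_continuous : continuous (@toC R).
Proof.
move=> a A /near_normP [e e0 eA]; apply/near_normP; exists (reC e).
  by rewrite -toC_gt0 -ge0_toC // ltW.
move=> b ab; apply: eA; rewrite -toCB toC_norm.
by rewrite (ge0_toC (ltW e0)) toC_lt.
Qed.

Lemma compact_box (B : R) :
  compact [set z : K | exists a b, [/\ z = mkC a b, - B <= a <= B & - B <= b <= B]].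
Proof.
pose f (p : R * R) : K := toC p.1 + mkC 0 1 * toC p.2.
have fE p : f p = mkC p.1 p.2.
  by rewrite /f /mkC /toC /=; simpc.
have cf : continuous f.
  move=> p; apply: cvgD; first by apply: continuous_comp; [exact: cvg_fst|exact: toC_continuous].
  apply: cvgM; first exact: cvg_cst.
  by apply: continuous_comp; [exact: cvg_snd|exact: toC_continuous].
have -> : [set z : K | exists a b, [/\ z = mkC a b, - B <= a <= B & - B <= b <= B]] =
   f @` ([set` `[- B, B]] `*` [set` `[- B, B]]).
  apply/seteqP; split=> z /=.
    by move=> [a [b [-> aB bB]]]; exists (a, b); rewrite ?fE //= !in_itv /= aB bB.
  move=> [[a b]] /=; rewrite !in_itv /= => -[aB bB] <-.
  by exists a, b; rewrite fE.
apply: continuous_compact; first exact: continuous_subspaceT.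
by apply: compact_setX; exact: segment_compact.
Qed.

(** An ultrafilter that converges to infinity: along it every bounded sequence has a
   limit, and this limit is linear, so that means and sums can be formed without first
   proving convergence. *)
Definition ultra : set_system nat := sval (cid (ultraFilterLemma (@eventually_filter))).

Lemma ultraP : UltraFilter ultra /\ \oo `<=` ultra.
Proof. exact: svalP (cid (ultraFilterLemma _)). Qed.

#[local] Instance ultra_proper_filter : ProperFilter ultra.
Proof. by have [u _] := ultraP; exact: ultra_proper. Qed.

Definition ulim (u : nat -> K) : K := lim (u n @[n --> ultra]).

(** The values lie in a compact box, where the ultrafilter has a cluster point, and a
   cluster point of an ultrafilter is its limit. *)
Lemma ulim_cvg (u : nat -> K) (B : K) : (forall n, `|u n| <= B) -> u n @[n --> ultra] --> ulim u.
Proof.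
move=> uB; have B0 : 0 <= B by exact: le_trans (normr_ge0 _) (uB 0%N).
have [|p [_ clp]] := @compact_box (reC B) (u n @[n --> ultra]) _.
  change (ultra [set n | exists a b : R, [/\ u n = mkC a b, - reC B <= a <= reC B & - reC B <= b <= reC B]]).
  apply: filterE => n /=; exists (reC (u n)), (imC (u n)).
  split; first exact: mkC_reim.
    by rewrite -ler_norml -toC_le -ge0_toC //; apply: le_trans (uB n); exact: norm_reC.
  by rewrite -ler_norml -toC_le -ge0_toC //; apply: le_trans (uB n); exact: norm_imC.
suff up : u n @[n --> ultra] --> p by rewrite /ulim (cvg_lim _ up).
move=> V Vp; have [uf _] := ultraP.
case: (in_ultra_setVsetC [set n | V (u n)] uf) => // nV.
have [z [/= nz Vz]] := clp (~` V) V nV Vp.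
by [].
Qed.

Definition bounded (u : nat -> K) := exists B, forall n, `|u n| <= B.

Lemma ulimD u v : bounded u -> bounded v -> ulim (fun n => u n + v n) = ulim u + ulim v.
Proof.
move=> [B uB] [B' vB]; apply/cvg_lim => //.
by apply: cvgD; [exact: (ulim_cvg uB)|exact: (ulim_cvg vB)].
Qed.

Lemma ulimM a u : bounded u -> ulim (fun n => a * u n) = a * ulim u.
Proof.
by move=> [B uB]; apply/cvg_lim => //; apply: cvgMr; exact: (ulim_cvg uB).
Qed.

Lemma ulim_cst a : ulim (fun n => a) = a.
Proof. by apply/cvg_lim => //; exact: cvg_cst. Qed.

Lemma boundedB (u v : nat -> K) : bounded u -> bounded v -> bounded (fun n => u n - v n).
Proof.
move=> [b ub] [c vc]; exists (b + c) => N.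
by apply: le_trans (ler_normB _ _) _; exact: lerD.
Qed.

Lemma ulimB (u v : nat -> K) : bounded u -> bounded v -> ulim (fun n => u n - v n) = ulim u - ulim v.
Proof.
move=> bu bv; rewrite -mulN1r -ulimM // -ulimD //.
  by congr ulim; apply/funext => N; rewrite mulN1r.
by have [b bP] := bv; exists b => N; rewrite mulN1r normrN.
Qed.

Lemma ulim_sum_bounded n (u : 'I_n -> nat -> K) (a : 'I_n -> K) :
  (forall i, bounded (u i)) -> bounded (fun N => \sum_i u i N * a i).
Proof.
move=> bu; have [b bP] := choice bu; exists (\sum_i b i * `|a i|) => N.
apply: le_trans (ler_norm_sum _ _ _) _; apply: ler_sum => i _.
by rewrite normrM ler_wpM2r.
Qed.

Lemma ulim_sum n (u : 'I_n -> nat -> K) (a : 'I_n -> K) : (forall i, bounded (u i)) ->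
  \sum_i ulim (u i) * a i = ulim (fun N => \sum_i u i N * a i).
Proof.
move=> bu; have [b bP] := choice bu.
suff H (s : seq 'I_n) : bounded (fun N => \sum_(i <- s) u i N * a i) /\
    \sum_(i <- s) ulim (u i) * a i = ulim (fun N => \sum_(i <- s) u i N * a i).
  exact: (H _).2.
elim: s => [|i s [[c cP] IH]].
  split; first by exists 0 => N; rewrite big_nil normr0.
  by rewrite big_nil -[LHS]ulim_cst; congr ulim; apply/funext => N; rewrite big_nil.
split.
  exists (b i * `|a i| + c) => N; rewrite big_cons; apply: le_trans (ler_normD _ _) _.
  by rewrite lerD // normrM ler_wpM2r.
rewrite big_cons IH mulrC -ulimM //.
have -> : (fun N => \sum_(j <- i :: s) u j N * a j) =
    (fun N => a i * u i N + \sum_(j <- s) u j N * a j).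
  by apply/funext => N; rewrite big_cons mulrC.
rewrite ulimD //; last by exists c.
exists (`|a i| * b i) => N; by rewrite normrM ler_wpM2l.
Qed.

Lemma ulim0 (u : nat -> K) : (forall e : K, 0 < e -> \forall n \near \oo, `|u n| <= e) -> ulim u = 0.
Proof.
move=> u0; apply/cvg_lim => // V /near_normP [e e0 eV].
have e2 : 0 < e / 2 by rewrite divr_gt0.
apply: ultraP.2; apply: filterS (u0 _ e2) => n un; apply: eV.
by rewrite subr0; apply: le_lt_trans un _; rewrite ltr_pdivrMr // mulrDr mulr1 ltrDl.
Qed.

Lemma ulim_ext (u v : nat -> K) : (\forall n \near \oo, u n = v n) -> ulim u = ulim v.
Proof.
move=> uv; have nuv : ultra [set n | u n = v n] by exact: ultraP.2.
have h (u' v' : nat -> K) : ultra [set n | u' n = v' n] ->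
    u' n @[n --> ultra] `<=` v' n @[n --> ultra].
  move=> e A uA; have uA' : ultra (u' @^-1` A) by exact: uA.
  apply: (filterS (P := [set n | u' n = v' n] `&` u' @^-1` A)); last exact: filterI.
  by move=> n /= [<-].
rewrite /ulim; congr (lim _); apply/seteqP; split; apply: h => //.
by apply: filterS nuv => n /= ->.
Qed.

Lemma ulim_le (u : nat -> K) (B : K) : (forall n, `|u n| <= B) -> `|ulim u| <= B.
Proof.
move=> uB; have B0 : 0 <= B by exact: le_trans (normr_ge0 _) (uB 0%N).
apply/ler_addgt0Pl => e e0.
have H : ultra [set n | `|u n - ulim u| < e].
  change ((u n @[n --> ultra]) [set z | `|z - ulim u| < e]).
  by apply: (ulim_cvg uB); apply/near_normP; exists e.
have [n /= un] := filter_ex H.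
rewrite -[ulim u](subrK (u n)); apply: le_trans (ler_normD _ _) _.
by rewrite lerD // distrC ltW.
Qed.

End UltraLimit.

(** * Means over the unit circle *)
Section CircleMean.
Variable R : realType.
Notation K := (C R).

Definition cis (t : R) : K := mkC (cos t) (sin t).

Lemma cisD a b : cis (a + b) = cis a * cis b.
Proof. by rewrite /cis cosD sinD /mkC; simpc; congr (Complex _ _); rewrite addrC. Qed.

Lemma cis0 : cis 0 = 1. Proof. by rewrite /cis cos0 sin0. Qed.

Lemma cisX t k : cis t ^+ k = cis (k%:R * t).
Proof.
elim: k => [|k IH]; first by rewrite expr0 mul0r cis0.
by rewrite exprS IH -cisD -natr1 mulrDl mul1r addrC.
Qed.

Lemma norm_cis t : `|cis t| = 1.
Proof.
by rewrite normc_def /= cos2Dsin2 sqrtr1.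
Qed.

Definition root N : K := cis (pi *+ 2 / N.+1%:R).

Lemma root_unity N : root N ^+ N.+1 = 1.
Proof.
rewrite cisX mulrC divfK ?pnatr_eq0 //.
by rewrite -[pi *+ 2]add0r /cis cosD2pi sinD2pi cos0 sin0.
Qed.

Lemma root_neq1 N : (0 < N)%N -> root N != 1.
Proof.
move=> N0; apply/eqP => /(congr1 (@reC R)) /=; rewrite -[RHS](@cos0 R) => /eqP.
have t0 : 0 < (pi *+ 2 / N.+1%:R : R).
  by apply: divr_gt0; [apply: mulrn_wgt0; exact: pi_gt0|exact: ltr0Sn].
have tpi : (pi *+ 2 / N.+1%:R : R) <= pi.
  move: (pi_ge0 R); generalize (pi : R) => p p0.
  by rewrite ler_pdivrMr ?ltr0Sn // mulr_natr ler_wpMn2l.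
suff H : cos (pi *+ 2 / N.+1%:R : R) < cos 0 by rewrite lt_eqF.
by rewrite ltr_cos // in_itv /= ?lexx ?pi_ge0 // (ltW t0) tpi.
Qed.

Lemma root_near1 (e : K) : 0 < e -> \forall N \near \oo, `|root N - 1| < e.
Proof.
move=> e0.
have e2 : 0 < reC e / 2 by rewrite divr_gt0 // -toC_gt0 -ge0_toC // ltW.
have t0 : (pi *+ 2 / N.+1%:R : R) @[N --> \oo] --> (0 : R).
  rewrite -(mulr0 (pi *+ 2)); apply: cvgMr.
  exact: cvg_harmonic.
have c1 : cos (pi *+ 2 / N.+1%:R : R) @[N --> \oo] --> (1 : R).
  rewrite -[X in _ --> X](@cos0 R); exact: (continuous_cvg _ (@continuous_cos R 0) t0).
have s1 : sin (pi *+ 2 / N.+1%:R : R) @[N --> \oo] --> (0 : R).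
  rewrite -[X in _ --> X](@sin0 R); exact: (continuous_cvg _ (@continuous_sin R 0) t0).
near=> N.
have cN : `|1 - cos (pi *+ 2 / N.+1%:R)| < reC e / 2.
  by near: N; move/cvgrPdist_lt : c1; exact.
have sN : `|0 - sin (pi *+ 2 / N.+1%:R)| < reC e / 2.
  by near: N; move/cvgrPdist_lt : s1; exact.
rewrite distrC /root -[1]cis0 /cis mkCB cos0 sin0; apply: le_lt_trans (norm_mkC _ _) _.
by rewrite (ge0_toC (ltW e0)) toC_lt (splitr (reC e)) ltrD.
Unshelve. all: by end_near. Qed.

Definition avg (g : K -> K) N : K := N.+1%:R^-1 * \sum_(k < N.+1) g (root N ^+ k).

(** The mean of g over the unit circle, as the limit of its averages over roots of unity. *)
Definition cmean (g : K -> K) : K := ulim (avg g).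

Definition bcirc (g : K -> K) (B : K) := forall z, `|z| = 1 -> `|g z| <= B.

Lemma norm_rootX N k : `|root N ^+ k| = 1.
Proof. by rewrite normrX norm_cis expr1n. Qed.

Lemma avg_le g B N : bcirc g B -> `|avg g N| <= B.
Proof.
move=> gB; rewrite normrM normfV normr_nat mulrC ler_pdivrMr ?ltr0Sn //.
apply: le_trans (ler_norm_sum _ _ _) _.
apply: le_trans (ler_sum _ (_ : forall k, _ -> _ <= B)) _.
  by move=> k _; apply: gB; exact: norm_rootX.
by rewrite sumr_const card_ord mulr_natr.
Qed.

Lemma bcirc_bounded g B : bcirc g B -> bounded (avg g).
Proof. by move=> gB; exists B => N; exact: avg_le. Qed.

Lemma cmean_le g B : bcirc g B -> `|cmean g| <= B.
Proof. by move=> gB; apply: ulim_le => N; exact: avg_le. Qed.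

Lemma eq_cmean g h : (forall z, `|z| = 1 -> g z = h z) -> cmean g = cmean h.
Proof.
move=> gh; rewrite /cmean; congr ulim; apply/funext => N; congr (_ * _).
by apply: eq_bigr => k _; apply: gh; exact: norm_rootX.
Qed.

Lemma cmeanD g h B B' : bcirc g B -> bcirc h B' ->
  cmean (fun z => g z + h z) = cmean g + cmean h.
Proof.
move=> gB hB; rewrite /cmean -ulimD; [|exact: bcirc_bounded gB|exact: bcirc_bounded hB].
by congr ulim; apply/funext => N; rewrite /avg big_split mulrDr.
Qed.

Lemma cmeanM a g B : bcirc g B -> cmean (fun z => a * g z) = a * cmean g.
Proof.
move=> gB; rewrite /cmean -ulimM; last exact: bcirc_bounded gB.
by congr ulim; apply/funext => N; rewrite /avg -mulr_sumr mulrCA.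
Qed.

Lemma cmeanB g h B B' : bcirc g B -> bcirc h B' ->
  cmean (fun z => g z - h z) = cmean g - cmean h.
Proof.
move=> gB hB; rewrite (@cmeanD g (fun z => - h z) B B') //; last first.
  by move=> z z1; rewrite normrN; exact: hB.
congr (_ + _); rewrite -mulN1r -(cmeanM _ hB); apply: eq_cmean => z _.
by rewrite mulN1r.
Qed.

Lemma cmean_cst a : cmean (fun=> a) = a.
Proof.
rewrite /cmean -[RHS](@ulim_cst R); congr ulim; apply/funext => N.
by rewrite /avg sumr_const card_ord -(mulr_natl a) mulKf // pnatr_eq0.
Qed.

Lemma cmean_sum n (g : 'I_n -> K -> K) (a : 'I_n -> K) B : (forall m, bcirc (g m) B) ->
  cmean (fun z => \sum_m a m * g m z) = \sum_m a m * cmean (g m).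
Proof.
move=> gB.
have bP (P : seq 'I_n) : exists B', bcirc (fun z => \sum_(m <- P) a m * g m z) B' .
  exists (\sum_(m <- P) `|a m| * B) => z z1.
  apply: le_trans (ler_norm_sum _ _ _) _; apply: ler_sum => m _.
  by rewrite normrM ler_wpM2l // gB.
suff H (P : seq 'I_n) : cmean (fun z => \sum_(m <- P) a m * g m z) =
    \sum_(m <- P) a m * cmean (g m) by exact: H.
elim: P => [|m P IH].
  rewrite big_nil -[RHS]cmean_cst; apply: eq_cmean => z _; by rewrite big_nil.
rewrite big_cons -IH -(cmeanM _ (gB m)); have [B' B'P] := bP P.
rewrite -(@cmeanD _ _ (`|a m| * B) B') //; last first.
  by move=> z z1; rewrite normrM ler_wpM2l // gB.
by apply: eq_cmean => z _; rewrite big_cons.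
Qed.

(** The derivative of G along the circle has mean zero: over the roots of unity the
   increments of G telescope, and each is (h - 1) g up to the factor h and an error
   o(h - 1). *)
Lemma cmean_tele (G g : K -> K) :
  (forall e : K, 0 < e -> exists2 d : K, 0 < d & forall z h : K, `|z| = 1 -> `|h| = 1 ->
     `|h - 1| < d -> `|h * (G (h * z) - G z) - (h - 1) * g z| <= e * `|h - 1|) ->
  cmean g = 0.
Proof.
move=> Gg; apply: ulim0 => e e0; have [d d0 dP] := Gg e e0.
near=> N.
have w1 : root N != 1 by apply: root_neq1; near: N; exact: nbhs_infty_gt.
have wd : `|root N - 1| < d by near: N; exact: root_near1.
move: w1 wd; set w := root N => w1 wd.
have w10 : 0 < `|w - 1| by rewrite normr_gt0 subr_eq0.
rewrite -(ler_pM2l w10) -normrM /avg mulrCA normrM normfV normr_nat mulrC.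
rewrite ler_pdivrMr ?ltr0Sn // mulr_sumr.
have tele : \sum_(k < N.+1) w * (G (w * w ^+ k) - G (w ^+ k)) = 0.
  rewrite -mulr_sumr; under eq_bigr => k _ do rewrite -exprS.
  rewrite -(big_mkord xpredT (fun k => G (w ^+ k.+1) - G (w ^+ k))).
  by rewrite telescope_sumr // root_unity expr0 subrr mulr0.
have -> : \sum_(k < N.+1) (w - 1) * g (w ^+ k) =
    - \sum_(k < N.+1) (w * (G (w * w ^+ k) - G (w ^+ k)) - (w - 1) * g (w ^+ k)).
  by rewrite sumrB tele sub0r opprK.
rewrite normrN.
apply: le_trans (ler_norm_sum _ _ _) _.
apply: le_trans (ler_sum _ (_ : forall k, _ -> _ <= e * `|w - 1|)) _.
  move=> k _; apply: dP => //; [exact: norm_rootX|exact: norm_cis].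
by rewrite sumr_const card_ord mulr_natr [e * _]mulrC.
Unshelve. all: by end_near. Qed.

End CircleMean.

(** * Uniform Taylor estimates on compact sets *)
(* Keeps unification from unfolding complex numbers to pairs of reals. *)
#[local] Opaque C.

Section CauchyFormula.
Variables (R : realType) (n : nat).
Notation K := (C R).
Implicit Types (f : 'rV[K]_n -> K) (x y w : 'rV[K]_n).

Lemma hasgrad_sub f x c (a : 'I_n -> K) : hasgrad f x c ->
  hasgrad (fun y => f y - \sum_m a m * y 0 m) x (fun m => c m - a m).
Proof.
move=> fx e e0; have [d d0 dP] := fx e e0; exists d => // w /dP H.
apply: le_trans H; rewrite le_eqVlt; apply/orP; left; apply/eqP; congr (`|_|).
under [in LHS]eq_bigr => i _ do rewrite mxE mulrDr.
under [in X in _ - X = _]eq_bigr => i _ do rewrite mulrBl.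
rewrite big_split sumrB /=.
by set A := \sum_(i < n) _; set B := \sum_(i < n) _; set D := \sum_(i < n) _; ring.
Qed.

Lemma sum_coord_le (c : 'I_n -> K) w (B : K) : (forall m, `|c m| <= B) ->
  `|\sum_m c m * w 0 m| <= n%:R * B * `|w|.
Proof.
move=> cB; apply: le_trans (ler_norm_sum _ _ _) _.
apply: le_trans (ler_sum _ (_ : forall k, _ -> _ <= B * `|w|)) _.
  by move=> k _; rewrite normrM; apply: ler_pM => //; exact: coord_norm.
by rewrite sumr_const card_ord -(mulr_natl (B * _)) mulrA.
Qed.

Lemma hol_hasgrad U f x : holomorphic U f -> U x -> hasgrad f x (fun m => partial m f x).
Proof. by move=> hf Ux; exact: diff_hasgrad (hf x Ux).1. Qed.

Lemma taylor1 U f y (d e : K) : holomorphic U f -> 0 <= e ->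
  (forall z, `|z - y| < d -> U z /\ forall m, `|partial m f z - partial m f y| <= e) ->
  forall w, `|w| < d ->
    `|f (y + w) - f y - \sum_m partial m f y * w 0 m| <= n%:R * e * `|w|.
Proof.
move=> hf e0 dP w wd.
pose g z := f z - \sum_m partial m f y * z 0 m.
have seg (t : R) : 0 <= t <= 1 -> `|y + toC t *: w - y| < d.
  move=> /andP[t0 t1]; rewrite addrAC subrr add0r normrZ toC_norm ger0_norm //.
  by apply: le_lt_trans wd; rewrite ler_piMl // -toC1 toC_le.
have -> : f (y + w) - f y - \sum_m partial m f y * w 0 m = g (y + w) - g y.
  rewrite /g; under [in X in _ = _ - X - _]eq_bigr => i _ do rewrite mxE mulrDr.
  rewrite big_split /=.
  by set A := \sum_(i < n) _; set B := \sum_(i < n) _; ring.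
rewrite -[leRHS]divr1.
apply: (@mean_value_rV R n g y w (fun z m => partial m f z - partial m f y) _ 0).
- by rewrite !mulr_ge0.
- by move=> t t01; apply: hasgrad_sub; apply: (hol_hasgrad hf); case: (dP _ (seg t t01)).
- move=> t t01; rewrite expr0 mulr1; apply: sum_coord_le => m.
  by case: (dP _ (seg t t01)) => _; apply.
Qed.

(** Compactness turns a property that holds locally near P into a uniform one. *)
Lemma compact_near0 (P : set 'rV[K]_n) (Q : 'rV[K]_n -> 'rV[K]_n -> Prop) :
  compact P ->
  (forall x, P x -> exists2 d : K, 0 < d &
     forall y w, `|y - x| < d -> `|w| < d -> Q y w) ->
  exists2 d : K, 0 < d & forall y w, P y -> `|w| < d -> Q y w.
Proof.
move=> cP PQ.
have H := (compact_near_coveringP _).1 cP _ (nbhs (0 : 'rV[K]_n)) (fun w y => Q y w) _.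
suff /H /near_normP [d d0 dP] : forall x, P x -> \forall x' \near x & i \near nbhs (0 : 'rV[K]_n), Q x' i.
  by exists d => // y w Py wd; apply: dP => //; rewrite subr0.
move=> x /PQ [d d0 dP].
exists ([set y | `|y - x| < d], [set w | `|w| < d]) => /=.
  split; first by apply/near_normP; exists d.
  by apply/near_normP; exists d => // w; rewrite subr0.
by move=> [y w] /= [yx wd]; apply: dP.
Qed.

Lemma compact_unif (P : set 'rV[K]_n) (k : 'rV[K]_n -> K) : compact P ->
  (forall y, P y -> {for y, continuous k}) -> forall e : K, 0 < e ->
  exists2 d : K, 0 < d & forall y w, P y -> `|w| < d -> `|k (y + w) - k y| < e.
Proof.
move=> cP ck e e0; apply: compact_near0 => // x Px.
have e2 : 0 < e / 2 by rewrite divr_gt0.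
have [d d0 dP] := (cont_normP _ _).1 (ck x Px) _ e2.
have d2 : 0 < d / 2 by rewrite divr_gt0.
exists (d / 2) => // y w yx wd.
have -> : k (y + w) - k y = (k (y + w) - k x) - (k y - k x) by ring.
apply: le_lt_trans (ler_normB _ _) _; rewrite [e]splitr ltrD //; apply: dP.
  rewrite addrAC [d]splitr; apply: le_lt_trans (ler_normD _ _) _; exact: ltrD.
by apply: lt_trans yx _; exact: half_lt.
Qed.

Lemma compact_bound (P : set 'rV[K]_n) (k : 'rV[K]_n -> K) : compact P ->
  (forall y, P y -> {for y, continuous k}) ->
  exists B : K, forall y, P y -> `|k y| <= B.
Proof.
move=> cP ck.
have := (compact_near_coveringP _).1 cP _ \oo (fun (N : nat) y => `|k y| <= N%:R) _.
move=> H; have [|N _ NP] := H; last by exists N%:R; exact: (NP N (leqnn N)).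
move=> x Px; have [d d0 dP] := (cont_normP _ _).1 (ck x Px) 1 ltr01.
have [N NP] : exists N : nat, `|k x| + 1 <= N%:R.
  have h : 0 <= `|k x| + 1 by rewrite addr_ge0.
  exists (Num.bound (reC (`|k x| + 1))); rewrite (ge0_toC h) -toC_nat toC_le ltW //.
  by apply: archi_boundP; rewrite -toC_ge0 -ge0_toC.
exists ([set y | `|y - x| < d], [set m | (N <= m)%N]) => /=.
  split; first by apply/near_normP; exists d.
  by exists N.
move=> [y m] /= [/dP yx Nm]; apply: le_trans (_ : N%:R <= _); last by rewrite ler_nat.
apply: le_trans NP; rewrite -[k y](subrK (k x)) addrC.
by apply: le_trans (ler_normD _ _) _; rewrite lerD2l ltW.
Qed.

Lemma open_tube (U P : set 'rV[K]_n) : open U -> compact P -> P `<=` U ->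
  exists2 d : K, 0 < d & forall y w, P y -> `|w| < d -> U (y + w).
Proof.
move=> /open_normP oU cP PU; apply: compact_near0 => // x Px.
have [d d0 dP] := oU x (PU x Px).
have d2 : 0 < d / 2 by rewrite divr_gt0.
exists (d / 2) => // y w yx wd; apply: dP; rewrite addrAC [d]splitr.
by apply: le_lt_trans (ler_normD _ _) _; exact: ltrD.
Qed.

Lemma compact_unif_fam (P : set 'rV[K]_n) (k : 'I_n -> 'rV[K]_n -> K) : compact P ->
  (forall m y, P y -> {for y, continuous (k m)}) -> forall e : K, 0 < e ->
  exists2 d : K, 0 < d & forall m y w, P y -> `|w| < d -> `|k m (y + w) - k m y| < e.
Proof.
move=> cP ck e e0.
suff [d d0 dP] : exists2 d : K, 0 < d & forall m, m \in enum 'I_n -> forall y w, P y -> `|w| < d ->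
    `|k m (y + w) - k m y| < e.
  by exists d => // m; apply: dP; rewrite mem_enum.
elim: (enum _) => [|m s [d d0 dP]]; first by exists 1.
have [d' d'0 d'P] := compact_unif cP (ck m) e0.
have [c c0 cP'] := lt_minP d0 d'0; exists c => // i; rewrite inE => /orP[/eqP ->|iis] y w Py /cP' [wd wd'].
  exact: d'P.
exact: dP.
Qed.

(** Uniform continuity of the partial derivatives near P makes the remainder uniform. *)
Lemma compact_taylor1 U (P : set 'rV[K]_n) f : open U -> compact P -> P `<=` U ->
  holomorphic U f -> forall e : K, 0 < e -> exists2 d : K, 0 < d &
  forall y w, P y -> `|w| < d ->
    `|f (y + w) - f y - \sum_m partial m f y * w 0 m| <= e * `|w|.
Proof.
move=> oU cP PU hf e e0.
have e1 : 0 < e / n.+1%:R by rewrite divr_gt0 ?ltr0Sn.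
have [d d0 dP] := @compact_unif_fam P (fun m => partial m f) cP
  (fun m y Py => (hf y (PU y Py)).2 m) _ e1.
have [d' d'0 d'P] := open_tube oU cP PU.
have [c c0 cP'] := lt_minP d0 d'0; exists c => // y w Py wc.
apply: le_trans (@taylor1 U f y c (e / n.+1%:R) hf (ltW e1) _ w wc) _.
  move=> z /cP' [zd zd']; rewrite -(subrKC y z); split; first exact: d'P.
  by move=> m; rewrite ltW // dP.
rewrite ler_wpM2r // mulrCA ger_pMr // ler_pdivrMr ?ltr0Sn // mul1r ler_nat.
exact: leqnSn.
Qed.

End CauchyFormula.

(** * Cauchy's formula for first derivatives *)
Section EulerEquation.
Variables (R : realType) (I D : C R -> C R).
Notation K := (C R).
Hypotheses (euler : forall z : K, `|z| <= 1 -> z * D z = I z)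
  (derI : forall z : K, `|z| <= 1 -> hasder I z (D z)).

(** The ratio I z / z has derivative zero on the segment from a to 1. *)
Lemma euler_ratio (a : R) : 0 < a <= 1 -> I (toC a) / toC a = I 1.
Proof.
move=> /andP[a0 a1].
pose c (z : K) := toC a + (1 - toC a) * z.
have c0 : c 0 = toC a by rewrite /c mulr0 addr0.
have c1 : c 1 = 1 by rewrite /c mulr1 subrKC.
have cR (t : R) : 0 <= t <= 1 -> exists2 b : R, c (toC t) = toC b & a <= b <= 1.
  move=> /andP[t0 t1]; exists (a + (1 - a) * t); first by rewrite toCD toCM toCB toC1.
  rewrite lerDl mulr_ge0 ?subr_ge0 //= -lerBrDl -[leRHS]mulr1 ler_wpM2l ?subr_ge0 //.
have cE z s : c (z + s) = c z + (1 - toC a) * s by rewrite /c mulrDr addrA.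
clearbody c.
suff hd (t : R) : 0 <= t <= 1 -> hasder (fun z => I (c z) / c z) (toC t) 0.
  have e1 : I (c 1) / c 1 = I 1 by rewrite c1 divr1.
  have e0 : I (c 0) / c 0 = I (toC a) / toC a by rewrite c0.
  apply/eqP; rewrite eq_sym -subr_eq0 -normr_le0 -e1 -e0.
  have := @mean_value R (fun z => I (c z) / c z) (fun=> 0) 0 0 (lexx 0) hd.
  rewrite (mul0r (1%:R^-1 : K)); apply => t' _; rewrite normr0 mul0r //.
move=> t01.
have [b cb /andP[ab b1]] := cR t t01; have b0 : 0 < b by exact: lt_le_trans ab.
have nb : `|toC b| <= 1 by rewrite toC_norm (ger0_norm (ltW b0)) -toC1 toC_le.
have bK : 0 < toC b by rewrite toC_gt0.
move=> e e0.
have e2 : 0 < e * (toC b / 2) by rewrite mulr_gt0 // divr_gt0.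
have [d d0 dP] := derI nb e2.
have b20 : 0 < toC b / 2 by rewrite divr_gt0.
have [d2 d20 d2P] := lt_minP d0 b20; exists d2 => // s sd2.
set s' := (1 - toC a) * s.
have ss : `|s'| <= `|s|.
  rewrite /s' normrM ler_piMl // -toC1 -toCB toC_norm toC_le ger0_norm ?subr_ge0 //.
  by rewrite gerBl ltW.
have [/dP sd sb] := d2P _ (le_lt_trans ss sd2).
have -> : c (toC t + s) = toC b + s' by rewrite -cb cE.
rewrite cb mul0r subr0.
have bs : toC b <= `|toC b + s'| + `|s'|.
  by rewrite -{1}(ger0_norm (ltW bK)) -{1}[toC b](addrK s'); exact: ler_normB.
have bs2 : toC b / 2 <= `|toC b + s'|.
  rewrite -(lerD2r `|s'|); apply: le_trans bs.
  by rewrite {2}[toC b]splitr lerD2l ltW.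
have bs0 : toC b + s' != 0 by rewrite -normr_gt0; exact: lt_le_trans bs2.
have tJ := euler nb.
have -> : I (toC b + s') / (toC b + s') - I (toC b) / toC b =
   (I (toC b + s') - I (toC b) - D (toC b) * s') / (toC b + s').
  rewrite -tJ; field; by rewrite bs0 lt0r_neq0.
rewrite normrM normfV ler_pdivrMr ?normr_gt0 //; apply: le_trans sd _.
rewrite mulrAC -!mulrA ler_wpM2l ?(ltW e0) //.
by apply: ler_pM; rewrite ?(ltW b20).
Qed.

(** The ratio I z / z is constant on the positive axis, and it tends to the derivative at 0. *)
Lemma euler_linear : I 1 = D 0.
Proof.
have I0 : I 0 = 0 by rewrite -euler ?normr0 // mul0r.
apply/eqP; rewrite -subr_eq0 -normr_le0.
apply/ler_addgt0Pl => e e0; rewrite addr0.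
have [|d d0 dP] := @derI 0 _ e e0; first by rewrite normr0.
have [d2 d20 d2P] := lt_minP d0 ltr01.
pose a := reC d2 / 2.
have a0 : 0 < a by rewrite divr_gt0 // -toC_gt0 -ge0_toC // ltW.
have ad : toC a < d2.
  by rewrite [d2]ge0_toC ?ltW // toC_lt; apply: half_lt; rewrite -toC_gt0 -ge0_toC // ltW.
have [ad' a1] := d2P _ ad.
rewrite -(@euler_ratio a) ?a0 /=; last by rewrite -toC_le toC1 ltW.
have aK : 0 < toC a by rewrite toC_gt0.
have := dP (toC a); rewrite (ger0_norm (ltW aK)) => /(_ ad').
rewrite add0r I0 subr0 => H.
have -> : I (toC a) / toC a - D 0 = (I (toC a) - D 0 * toC a) / toC a.
  by rewrite mulrBl mulfK // lt0r_neq0.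
by rewrite normrM normfV (ger0_norm (ltW aK)) ler_pdivrMr.
Qed.

End EulerEquation.

Section CauchyFormula2.
Variables (R : realType) (n : nat).
Notation K := (C R).
Implicit Types (f : 'rV[K]_n -> K) (x y w : 'rV[K]_n).
Notation ev l := (delta_mx 0 l : 'rV[K]_n).

Lemma hol_cont U f x : holomorphic U f -> U x -> {for x, continuous f}.
Proof. by move=> hf /hf [/differentiable_continuous]. Qed.

(** The image of a square containing the unit disc: compactness of the square is that of a
   product of segments. *)
Definition disc l x (r : K) : set 'rV[K]_n :=
  (fun z : K => x + (z * r) *: ev l) @` [set z : K | exists a b, [/\ z = mkC a b, - 1 <= a <= 1 & - 1 <= b <= 1]].

Lemma compact_disc l x r : compact (disc l x r).
Proof.
apply: continuous_compact; last exact: compact_box.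
apply: continuous_subspaceT => z.
apply/cont_normP => e e0; exists (e / (`|r| + 1)); first by rewrite divr_gt0 // ltr_wpDl.
move=> z' ; rewrite ltr_pdivlMr ?ltr_wpDl // => zz'.
rewrite opprD addrACA subrr add0r -scalerBl -mulrBl normrZ norm_delta mulr1 normrM.
by apply: le_lt_trans zz'; rewrite ler_wpM2l // lerDl.
Qed.

Lemma in_disc l x r z : `|z| <= 1 -> disc l x r (x + (z * r) *: ev l).
Proof.
move=> z1; exists z => //; exists (reC z), (imC z); split; first exact: mkC_reim.
  by rewrite -ler_norml -toC_le toC1; apply: le_trans z1; exact: norm_reC.
by rewrite -ler_norml -toC_le toC1; apply: le_trans z1; exact: norm_imC.
Qed.

Lemma disc_sub l x r (U : set 'rV[K]_n) :
  (forall z : K, `|z| <= 2%:R -> U (x + (z * r) *: ev l)) -> disc l x r `<=` U.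
Proof.
move=> zU _ [z [a [b [-> aB bB]]] <-]; apply: zU.
apply: le_trans (norm_mkC _ _) _; rewrite -toC_nat toC_le (natrD _ 1 1).
by rewrite lerD // ler_norml.
Qed.

Section Formula.
Variables (U : set 'rV[K]_n) (f : 'rV[K]_n -> K) (x : 'rV[K]_n) (l : 'I_n) (r : K).
Hypotheses (oU : open U) (hf : holomorphic U f)
  (zU : forall z : K, `|z| <= 2%:R -> U (x + (z * r) *: ev l)).

Let I z := cmean (fun h => h^-1 * f (x + (z * h * r) *: ev l)).
Let J z := cmean (fun h => partial l f (x + (z * h * r) *: ev l)).
Let cP : compact (disc l x r) := @compact_disc l x r.
Let PU := disc_sub zU.

Let step (e : K) : 0 < e -> exists2 d : K, 0 < d & forall y s, disc l x r y -> `|s| < d ->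
  `|f (y + s *: ev l) - f y - s * partial l f y| <= e * `|s|.
Proof.
move=> e0; have [d d0 dP] := compact_taylor1 oU cP PU hf e0; exists d => // y s Py sd.
have /dP : `|s *: ev l| < d by rewrite normrZ norm_delta mulr1.
move=> /(_ y Py); rewrite normrZ norm_delta mulr1 (bigD1 l) //= big1 => [|m ml].
  by rewrite addr0 !mxE !eqxx mulr1 mulrC.
by rewrite !mxE (negPf ml) andbF !mulr0.
Qed.

Let inP z h : `|z| <= 1 -> `|h| = 1 -> disc l x r (x + (z * h * r) *: ev l).
Proof. by move=> z1 h1; apply: in_disc; rewrite normrM h1 mulr1. Qed.

Let bndf : exists B : K, forall y, disc l x r y -> `|f y| <= B.
Proof. by apply: compact_bound => // y Py; apply: (hol_cont hf); exact: PU. Qed.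

Let bnddf : exists B : K, forall y, disc l x r y -> `|partial l f y| <= B.
Proof. by apply: compact_bound => // y Py; have [_] := hf (PU Py); exact. Qed.

Let normV1 (h : K) : `|h| = 1 -> `|h^-1| = 1.
Proof. by move=> h1; rewrite normfV h1 invr1. Qed.

Let neq0 (h : K) : `|h| = 1 -> h != 0.
Proof. by move=> h1; rewrite -normr_gt0 h1. Qed.

(* The mean of the derivative along the circle of f / h vanishes. *)
Let teleI z : `|z| <= 1 -> z * r * J z = I z.
Proof.
move=> z1; have [B fB] := bndf; have [B' dfB] := bnddf.
have b1 : bcirc (fun h => partial l f (x + (z * h * r) *: ev l)) B'.
  by move=> h h1; apply: dfB; exact: inP.
have b2 : bcirc (fun h => h^-1 * f (x + (z * h * r) *: ev l)) B.
  by move=> h h1; rewrite normrM normV1 // mul1r; apply: fB; exact: inP.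
apply/eqP; rewrite -subr_eq0 /I /J -(cmeanM _ b1) -(@cmeanB _ _ _ (`|z * r| * B') B) //; last first.
  by move=> h h1; rewrite normrM ler_wpM2l // b1.
apply/eqP/(@cmean_tele _ (fun h => h^-1 * f (x + (z * h * r) *: ev l))) => e e0.
have a0 : 0 < `|z * r| + 1 by rewrite ltr_wpDl.
have e1 : 0 < e / (`|z * r| + 1) by rewrite divr_gt0.
have [d d0 dP] := step e1; exists (d / (`|z * r| + 1)); first by rewrite divr_gt0.
move=> h k h1 k1; rewrite ltr_pdivlMr // => kd.
pose y := x + (z * h * r) *: ev l; pose s := z * r * h * (k - 1).
have sE : `|s| = `|z * r| * `|k - 1| by rewrite /s !normrM h1 mulr1.
have sd : `|s| < d.
  by rewrite sE mulrC; apply: le_lt_trans kd; rewrite ler_wpM2l // lerDl.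
have -> : k * ((k * h)^-1 * f (x + (z * (k * h) * r) *: ev l) - h^-1 * f (x + (z * h * r) *: ev l)) -
    (k - 1) * (z * r * partial l f (x + (z * h * r) *: ev l) - h^-1 * f (x + (z * h * r) *: ev l))
  = h^-1 * (f (y + s *: ev l) - f y - s * partial l f y).
  have -> : y + s *: ev l = x + (z * (k * h) * r) *: ev l.
    by rewrite /y /s -addrA -scalerDl; congr (_ + _ *: _); ring.
  rewrite -/y /s; field.
  by rewrite !neq0.
rewrite normrM normV1 // mul1r; apply: le_trans (dP _ _ (inP z1 h1) sd) _.
rewrite sE mulrA ler_wpM2r // mulrAC ler_pdivrMr // ler_wpM2l ?ltW //.
by rewrite ltrDl.
Qed.

(* Differentiation in the radius under the mean sign. *)
Let derI z : `|z| <= 1 -> hasder I z (r * J z).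
Proof.
move=> z1 e e0; have [B fB] := bndf; have [B' dfB] := bnddf.
have a0 : 0 < `|r| + 1 by rewrite ltr_wpDl.
have e1 : 0 < e / (`|r| + 1) by rewrite divr_gt0.
have [d d0 dP] := step e1.
have [d' d'0 d'P] := compact_unif cP (fun y Py => hol_cont hf (PU Py)) ltr01.
have [d2 d20 d2P] := lt_minP d0 d'0.
exists (d2 / (`|r| + 1)); first by rewrite divr_gt0.
move=> s; rewrite ltr_pdivlMr // => sd.
have shd h : `|h| = 1 -> `|s * h * r| < d2.
  move=> h1; rewrite !normrM h1 mulr1; apply: le_lt_trans sd.
  by rewrite ler_wpM2l // lerDl.
have yE h : x + ((z + s) * h * r) *: ev l = x + (z * h * r) *: ev l + (s * h * r) *: ev l.
  by rewrite -addrA -scalerDl !mulrDl.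
have b1 : bcirc (fun h => h^-1 * f (x + ((z + s) * h * r) *: ev l)) (1 + B).
  move=> h h1; rewrite normrM normV1 // mul1r yE.
  set y := x + (z * h * r) *: ev l; rewrite -[f _](subrK (f y)).
  apply: le_trans (ler_normD _ _) _; rewrite lerD //; last by apply: fB; exact: inP.
  apply/ltW/d'P; first exact: inP.
  by rewrite normrZ norm_delta mulr1; have [] := d2P _ (shd h h1).
have b2 : bcirc (fun h => h^-1 * f (x + (z * h * r) *: ev l)) B.
  by move=> h h1; rewrite normrM normV1 // mul1r; apply: fB; exact: inP.
have b3 : bcirc (fun h => partial l f (x + (z * h * r) *: ev l)) B'.
  by move=> h h1; apply: dfB; exact: inP.
have -> : r * J z * s = cmean (fun h => s * r * partial l f (x + (z * h * r) *: ev l)).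
  by rewrite (cmeanM _ b3) mulrC mulrA.
rewrite -(cmeanB b1 b2).
rewrite -(@cmeanB _ _ _ (1 + B + B) (`|J z| * 0 + `|s * r| * B')) //; last 2 first.
- by move=> h h1; apply: le_trans (ler_normB _ _) _; rewrite lerD ?b1 ?b2.
- by move=> h h1; rewrite mulr0 add0r normrM ler_wpM2l // b3.
apply: cmean_le => h h1.
set y := x + (z * h * r) *: ev l.
have -> : h^-1 * f (x + ((z + s) * h * r) *: ev l) - h^-1 * f y - s * r * partial l f y =
  h^-1 * (f (y + (s * h * r) *: ev l) - f y - (s * h * r) * partial l f y).
  by rewrite yE; field; exact: neq0.
rewrite normrM normV1 // mul1r; apply: le_trans (dP _ _ (inP z1 h1) _) _.
  by have [] := d2P _ (shd h h1).
rewrite !normrM h1 mulr1 mulrCA mulrC ler_wpM2r // mulrAC ler_pdivrMr // ler_wpM2l ?ltW //.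
by rewrite ltrDl.
Qed.

Let J0 : J 0 = partial l f x.
Proof.
rewrite /J -[RHS](@cmean_cst R); apply: eq_cmean => h _.
by rewrite !mul0r scale0r addr0.
Qed.

(** Cauchy's formula for a first derivative: the mean of f against the inverse
   of the parameter of the circle is homogeneous of degree one in the radius. *)
Lemma cauchy1 : r * partial l f x = cmean (fun h => h^-1 * f (x + (h * r) *: ev l)).
Proof.
have -> : cmean (fun h => h^-1 * f (x + (h * r) *: ev l)) = I 1.
  by apply: eq_cmean => h _; rewrite mul1r.
rewrite -J0; symmetry; apply: (@euler_linear _ I (fun z => r * J z)) => z z1.
  by rewrite mulrA teleI.
exact: derI.
Qed.

End Formula.
End CauchyFormula2.

(** * Derivatives of holomorphic functions *)
Section Smooth.
Variables (R : realType) (n : nat).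
Notation K := (C R).
Implicit Types (f g : 'rV[K]_n -> K) (x y w : 'rV[K]_n) (U : set 'rV[K]_n).
Notation ev l := (delta_mx 0 l : 'rV[K]_n).

(** The square in the formula at x lies in the disc of radius 2 r, and the formula is used
   at all x within r of x0: the radius 5 r leaves room for both. *)
Lemma ball_disc U x0 x r l : 0 < r -> (forall y, `|y - x0| < 5%:R * r -> U y) ->
  `|x - x0| < r -> forall z : K, `|z| <= 2%:R -> U (x + (z * r) *: ev l).
Proof.
move=> r0 rU xx0 z z2; apply: rU; rewrite addrAC.
apply: le_lt_trans (ler_normD _ _) _; rewrite normrZ norm_delta mulr1 normrM (gtr0_norm r0).
have -> : 5%:R * r = r + 4%:R * r by ring.
apply: ltr_leD => //; rewrite ler_wpM2r ?(ltW r0) //; apply: le_trans z2 _.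
by rewrite ler_nat.
Qed.

Lemma open_ball5 U x0 : open U -> U x0 ->
  exists2 r : K, 0 < r & forall y, `|y - x0| < 5%:R * r -> U y.
Proof.
move=> /open_normP oU /oU [e e0 eP]; exists (e / 5%:R); first by rewrite divr_gt0.
by move=> y; rewrite mulrC divfK ?pnatr_eq0 //; exact: eP.
Qed.

(** Differentiating Cauchy's formula under the mean sign. *)
Lemma hasgrad_partial U f x l r : open U -> holomorphic U f -> 0 < r ->
  (forall y, `|y - x| < 5%:R * r -> U y) ->
  hasgrad (partial l f) x
    (fun m => r^-1 * cmean (fun h => h^-1 * partial m f (x + (h * r) *: ev l))).
Proof.
move=> oU hf r0 rU e e0.
have zU := @ball_disc U x x r l r0 rU.
have xx : `|x - x| < r by rewrite subrr normr0.
have PU := disc_sub (zU xx); have cP := @compact_disc R n l x r.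
have er : 0 < e * r by rewrite mulr_gt0.
have [d d0 dP] := compact_taylor1 oU cP PU hf er.
have [d' d'0 d'P] := lt_minP d0 r0.
have [B fB] : exists B : K, forall y, disc l x r y -> `|f y| <= B.
  by apply: compact_bound => // y Py; exact: hol_cont hf (PU _ Py).
have [D d'' dfB] : exists2 D : K, 0 < D & forall m y, disc l x r y -> `|partial m f y| <= D.
  have H m : exists B : K, forall y, disc l x r y -> `|partial m f y| <= B.
    by apply: compact_bound => // y Py; have [_] := hf _ (PU _ Py); exact.
  have [B' HB'] := choice H.
  exists (1 + \sum_m `|B' m|); first by rewrite ltr_wpDr // sumr_ge0.
  move=> m y Py; apply: le_trans (HB' m y Py) _.
  have h0 : 0 <= B' m by apply: le_trans (HB' m y Py).
  rewrite (bigD1 m) //= (ger0_norm h0) addrCA lerDl addr_ge0 // sumr_ge0 //.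
exists d' => // w /d'P [wd wr].
have inP h : `|h| = 1 -> disc l x r (x + (h * r) *: ev l).
  by move=> h1; apply: in_disc; rewrite h1.
have normV1 (h : K) : `|h| = 1 -> `|h^-1| = 1 by move=> h1; rewrite normfV h1 invr1.
have c1 : partial l f (x + w) = r^-1 * cmean (fun h => h^-1 * f (x + w + (h * r) *: ev l)).
  rewrite -(cauchy1 oU hf) ?mulKf ?lt0r_neq0 //.
  by apply: (ball_disc _ r0 rU); rewrite addrAC subrr add0r.
have c0 : partial l f x = r^-1 * cmean (fun h => h^-1 * f (x + (h * r) *: ev l)).
  by rewrite -(cauchy1 oU hf) ?mulKf ?lt0r_neq0 //; exact: zU.
have wE h : x + w + (h * r) *: ev l = x + (h * r) *: ev l + w by rewrite addrAC.
have b1 : bcirc (fun h => h^-1 * f (x + (h * r) *: ev l)) B.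
  by move=> h h1; rewrite normrM normV1 // mul1r fB //; exact: inP.
have bm m : bcirc (fun h => h^-1 * partial m f (x + (h * r) *: ev l)) D.
  by move=> h h1; rewrite normrM normV1 // mul1r dfB //; exact: inP.
pose S h := \sum_m w 0 m * (h^-1 * partial m f (x + (h * r) *: ev l)).
have SE h : S h = h^-1 * \sum_m partial m f (x + (h * r) *: ev l) * w 0 m.
  by rewrite mulr_sumr; apply: eq_bigr => m _; ring.
have bS : bcirc S (n%:R * D * `|w|).
  move=> h h1; rewrite SE normrM normV1 // mul1r; apply: sum_coord_le => m.
  by apply: dfB; exact: inP.
have est h : `|h| = 1 -> `|h^-1 * f (x + w + (h * r) *: ev l) -
    h^-1 * f (x + (h * r) *: ev l) - S h| <= e * r * `|w|.
  move=> h1; rewrite SE wE -!mulrBr normrM normV1 // mul1r; apply: dP => //; exact: inP.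
have b2 : bcirc (fun h => h^-1 * f (x + w + (h * r) *: ev l)) (e * r * `|w| + (n%:R * D * `|w| + B)).
  move=> h h1; set F := h^-1 * f (x + w + _); set G := h^-1 * f (x + (h * r) *: ev l).
  have -> : F = (F - G - S h) + (S h + G) by ring.
  apply: le_trans (ler_normD _ _) _; apply: lerD; first exact: est.
  by apply: le_trans (ler_normD _ _) _; apply: lerD; [exact: bS|exact: b1].
have -> : \sum_m r^-1 * cmean (fun h => h^-1 * partial m f (x + (h * r) *: ev l)) * w 0 m =
    r^-1 * cmean S.
  rewrite /S (cmean_sum _ bm) mulr_sumr; apply: eq_bigr => m _; ring.
rewrite c1 c0 -!mulrBr -(cmeanB b2 b1).
rewrite -(@cmeanB _ _ _ (e * r * `|w| + (n%:R * D * `|w| + B) + B) (n%:R * D * `|w|)) //; last first.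
  by move=> h h1; apply: le_trans (ler_normB _ _) _; apply: lerD; [exact: b2|exact: b1].
rewrite normrM normfV (gtr0_norm r0) mulrC ler_pdivrMr // mulrAC.
exact: cmean_le.
Qed.

Lemma cauchy_comm U f x l m r : open U -> holomorphic U f -> 0 < r ->
  (forall y, `|y - x| < 5%:R * r -> U y) ->
  partial m (partial l f) x =
    r^-1 * cmean (fun h => h^-1 * partial m f (x + (h * r) *: ev l)).
Proof.
move=> oU hf r0 rU; exact: (hasgrad_diff (hasgrad_partial l oU hf r0 rU)).2.
Qed.

(** By Cauchy's formula each first derivative of f is differentiable, and its own
   derivatives are means of those of f, hence continuous. *)
Lemma hol_partial U f l : open U -> holomorphic U f -> holomorphic U (partial l f).
Proof.
move=> oU hf x Ux; have [r r0 rU] := open_ball5 oU Ux.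
split; first exact: (hasgrad_diff (hasgrad_partial l oU hf r0 rU)).1.
move=> m; apply/cont_normP => e e0.
pose r2 := r / 2.
have r20 : 0 < r2 by rewrite divr_gt0.
have r2U y : `|y - x| < r2 -> forall z, `|z - y| < 5%:R * r2 -> U z.
  move=> yx z zy; apply: rU; rewrite -(subrKA y); apply: le_lt_trans (ler_normD _ _) _.
  have -> : 5%:R * r = 5%:R * r2 + 5%:R * r2 by rewrite -mulrDr /r2 -splitr.
  apply: ltrD => //; apply: lt_le_trans yx _; rewrite ler_peMl ?(ltW r20) //.
  by rewrite ler1n.
have xx : `|x - x| < r2 by rewrite subrr normr0.
have zU := @ball_disc U x x r2 l r20 (r2U x xx) xx.
have PU := disc_sub zU; have cP := @compact_disc R n l x r2.
have er : 0 < e * r2 / 2 by rewrite divr_gt0 // mulr_gt0.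
have cm y : disc l x r2 y -> {for y, continuous (partial m f)}.
  by move=> Py; have [_] := hf _ (PU _ Py); exact.
have [d d0 dP] := compact_unif cP cm er.
have [B fB] := compact_bound cP cm.
have [d' d'0 d'P] := lt_minP d0 r20.
exists d' => // y /d'P [yd yr].
rewrite (cauchy_comm l m oU hf r20 (r2U y yr)) (cauchy_comm l m oU hf r20 (r2U x xx)).
have inP h : `|h| = 1 -> disc l x r2 (x + (h * r2) *: ev l).
  by move=> h1; apply: in_disc; rewrite h1.
have normV1 (h : K) : `|h| = 1 -> `|h^-1| = 1 by move=> h1; rewrite normfV h1 invr1.
have yE h : y + (h * r2) *: ev l = x + (h * r2) *: ev l + (y - x).
  by rewrite [RHS]addrAC subrKC.
have est h : `|h| = 1 -> `|partial m f (y + (h * r2) *: ev l) - partial m f (x + (h * r2) *: ev l)| <= e * r2 / 2.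
  by move=> h1; rewrite yE ltW // dP //; exact: inP.
have b1 : bcirc (fun h => h^-1 * partial m f (x + (h * r2) *: ev l)) B.
  by move=> h h1; rewrite normrM normV1 // mul1r fB //; exact: inP.
have b2 : bcirc (fun h => h^-1 * partial m f (y + (h * r2) *: ev l)) (e * r2 / 2 + B).
  move=> h h1; rewrite normrM normV1 // mul1r.
  rewrite -[partial m f (y + _)](subrK (partial m f (x + (h * r2) *: ev l))).
  apply: le_trans (ler_normD _ _) _; apply: lerD; [exact: est | apply: fB; exact: inP].
rewrite -mulrBr -(cmeanB b2 b1) normrM normfV (gtr0_norm r20) mulrC ltr_pdivrMr //.
apply: le_lt_trans (half_lt _); last by rewrite mulr_gt0.
by apply: cmean_le => h h1; rewrite -mulrBr normrM normV1 // mul1r est.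
Qed.

(** Schwarz: both mixed derivatives are the same Cauchy mean. *)
Lemma partial_comm U f x l m : open U -> holomorphic U f -> U x ->
  partial m (partial l f) x = partial l (partial m f) x.
Proof.
move=> oU hf Ux; have [r r0 rU] := open_ball5 oU Ux.
rewrite (cauchy_comm l m oU hf r0 rU).
rewrite -(cauchy1 oU (hol_partial m oU hf)) ?mulKf ?lt0r_neq0 //.
by apply: ball_disc rU _ => //; rewrite subrr normr0.
Qed.

(** Cauchy's estimate, read on Cauchy's formula. *)
Lemma cauchy_bound U f x l r B : open U -> holomorphic U f -> 0 < r ->
  (forall z : K, `|z| <= 2%:R -> U (x + (z * r) *: ev l)) ->
  (forall y, `|y - x| <= r -> `|f y| <= B) -> `|partial l f x| <= B / r.
Proof.
move=> oU hf r0 zU fB.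
rewrite -[partial l f x](mulKf (lt0r_neq0 r0)) (cauchy1 oU hf zU).
rewrite normrM normfV (gtr0_norm r0) mulrC ler_wpM2r ?invr_ge0 ?(ltW r0) //.
apply: cmean_le => h h1; rewrite normrM normfV h1 invr1 mul1r; apply: fB.
by rewrite addrAC subrr add0r normrZ norm_delta mulr1 normrM h1 mul1r gtr0_norm.
Qed.

End Smooth.

(** * Calculus of holomorphic functions *)
(** The predicate and the operator are sealed: unification would otherwise unfold
   them, down to limits of difference quotients, whenever two functions differ. *)
Fact hol_seal : {h : forall R n, set 'rV[C R]_n -> ('rV[C R]_n -> C R) -> Prop |
  h = @holomorphic}.
Proof. by exists (@holomorphic). Qed.
Definition hol {R n} := sval hol_seal R n.

Fact pd_seal : {p : forall R n, 'I_n -> ('rV[C R]_n -> C R) -> 'rV[C R]_n -> C R |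
  p = @partial}.
Proof. by exists (@partial). Qed.
Definition pd {R n} := sval pd_seal R n.

Lemma holE R n : @hol R n = @holomorphic R n.
Proof. by rewrite /hol (svalP hol_seal). Qed.

Lemma pdE R n : @pd R n = @partial R n.
Proof. by rewrite /pd (svalP pd_seal). Qed.

Section Calculus.
Variables (R : realType) (n : nat).
Notation K := (C R).
Implicit Types (f g : 'rV[K]_n -> K) (x y w : 'rV[K]_n) (U V : set 'rV[K]_n).

Lemma holP U f : hol U f <-> forall x, U x ->
  differentiable f x /\ forall l : 'I_n, {for x, continuous (pd l f)}.
Proof. by rewrite holE pdE. Qed.

Lemma hol_diff U f x : hol U f -> U x -> differentiable f x.
Proof. by move=> /holP hf /hf []. Qed.

Lemma hol_pcont l U f x : hol U f -> U x -> {for x, continuous (pd l f)}.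
Proof. by move=> /holP hf /hf [_]; exact. Qed.

Lemma hol_continuous U f x : hol U f -> U x -> {for x, continuous f}.
Proof. by rewrite holE; exact: hol_cont. Qed.

Lemma hol_grad U f x : hol U f -> U x -> hasgrad f x (fun m => pd m f x).
Proof. by rewrite holE pdE; exact: hol_hasgrad. Qed.

Lemma hol_pd U f l : open U -> hol U f -> hol U (pd l f).
Proof. by rewrite holE pdE; exact: hol_partial. Qed.

Lemma pd_comm U f x l m : open U -> hol U f -> U x ->
  pd m (pd l f) x = pd l (pd m f) x.
Proof. by rewrite holE pdE; exact: partial_comm. Qed.

Lemma pd_bound U f x l r B : open U -> hol U f -> 0 < r ->
  (forall z : K, `|z| <= 2%:R -> U (x + (z * r) *: (delta_mx 0 l : 'rV[K]_n))) ->
  (forall y, `|y - x| <= r -> `|f y| <= B) -> `|pd l f x| <= B / r.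
Proof. by rewrite holE pdE; exact: cauchy_bound. Qed.

Lemma pD l f g x : differentiable f x -> differentiable g x ->
  pd l (fun y => f y + g y) x = pd l f x + pd l g x.
Proof. by rewrite pdE; exact: partialD. Qed.

Lemma pN l f x : differentiable f x -> pd l (fun y => - f y) x = - pd l f x.
Proof. by rewrite pdE; exact: partialN. Qed.

Lemma pM l f g x : differentiable f x -> differentiable g x ->
  pd l (fun y => f y * g y) x = pd l f x * g x + f x * pd l g x.
Proof. by rewrite pdE; exact: partialM. Qed.

Lemma pV l f x : f x != 0 -> differentiable f x ->
  pd l (fun y => (f y)^-1) x = - (f x)^-2 * pd l f x.
Proof. by rewrite pdE; exact: partialV. Qed.

Lemma p_cst l (a : K) x : pd l (fun=> a) x = 0.
Proof. by rewrite pdE; exact: partial_cst. Qed.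

Lemma p_coord l (k : 'I_n) x : pd l (fun y : 'rV[K]_n => y 0 k : K) x = (l == k)%:R.
Proof. by rewrite pdE; exact: partial_coord. Qed.

Lemma open_near U x : open U -> U x -> \forall y \near x, U y.
Proof. by move=> oU Ux; apply: open_nbhs_nbhs. Qed.

Lemma pd_ext U f g l x : open U -> (forall y, U y -> f y = g y) -> U x ->
  pd l f x = pd l g x.
Proof.
move=> oU fg Ux; rewrite pdE; apply: near_eq_derive.
apply: filterS (open_near oU Ux); exact: fg.
Qed.

Lemma cvg_ext U f g x (c : K) : open U -> U x -> (forall y, U y -> f y = g y) ->
  f y @[y --> x] --> c -> g y @[y --> x] --> c.
Proof.
move=> oU Ux fg fc A Ac; have h1 : nbhs x U by exact: open_near.
have h2 : nbhs x (f @^-1` A) by exact: fc.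
apply: (filterS (P := U `&` f @^-1` A)); last exact: filterI.
by move=> y [Uy /=]; rewrite fg.
Qed.

Lemma hol_ext U f g : open U -> (forall y, U y -> f y = g y) -> hol U f -> hol U g.
Proof.
move=> oU fg hf; apply/holP => x Ux.
have gx : hasgrad g x (fun m => pd m f x).
  move=> e e0; have [d d0 dP] := hol_grad hf Ux e0.
  have [d' d'0 d'P] := (open_normP _).1 oU x Ux.
  have [c c0 cP] := lt_minP d0 d'0; exists c => // w /cP [wd wd'].
  rewrite -!fg //; first exact: dP.
  by apply: d'P; rewrite addrAC subrr add0r.
split; first exact: (hasgrad_diff gx).1.
move=> l; have H : pd l g y @[y --> x] --> pd l f x.
  apply: (@cvg_ext U (pd l f) (pd l g) x _ oU Ux); last exact: hol_pcont hf Ux.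
  by move=> y Uy; exact: pd_ext Uy.
by rewrite /prop_for /continuous_at -(pd_ext l oU fg Ux).
Qed.

Lemma hol_sub U V f : V `<=` U -> hol U f -> hol V f.
Proof. by move=> VU /holP hf; apply/holP => x /VU; exact: hf. Qed.

(** To prove f holomorphic it is enough to exhibit continuous functions that agree on U
   with its partial derivatives. *)
Lemma hol_mk U f (D : 'I_n -> 'rV[K]_n -> K) : open U ->
  (forall x, U x -> differentiable f x) ->
  (forall x l, U x -> pd l f x = D l x) ->
  (forall x l, U x -> {for x, continuous (D l)}) -> hol U f.
Proof.
move=> oU df pf cD; apply/holP => x Ux; split; first exact: df.
move=> l; have H : pd l f y @[y --> x] --> D l x.
  by apply: (cvg_ext oU Ux _ (cD x l Ux)) => y Uy; rewrite pf.
by rewrite /prop_for /continuous_at pf.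
Qed.

Lemma hol_cst U (a : K) : hol U (fun=> a).
Proof.
apply/holP => x Ux; split; first exact: differentiable_cst.
move=> l; have -> : pd l (fun=> a) = fun=> 0 by apply/funext => y; exact: p_cst.
exact: cst_continuous.
Qed.

Lemma hol_coord U (k : 'I_n) : hol U (fun y => y 0 k).
Proof.
apply/holP => x Ux; split; first exact: diff_coord.
move=> l; have -> : pd l (fun y : 'rV[K]_n => y 0 k) = fun=> (l == k)%:R.
  by apply/funext => y; exact: p_coord.
exact: cst_continuous.
Qed.

Lemma holD U f g : open U -> hol U f -> hol U g ->
  hol U (fun y => f y + g y).
Proof.
move=> oU hf hg; apply: (@hol_mk _ _ (fun l y => pd l f y + pd l g y) oU) => x.
- by move=> Ux; apply: differentiableD; [exact: (hol_diff (hf) Ux)|exact: (hol_diff (hg) Ux)].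
- by move=> l Ux; rewrite pD //; [exact: (hol_diff (hf) Ux)|exact: (hol_diff (hg) Ux)].
- move=> l Ux; apply: continuousD; [exact: hol_pcont hf Ux|exact: hol_pcont hg Ux].
Qed.

Lemma holN U f : open U -> hol U f -> hol U (fun y => - f y).
Proof.
move=> oU hf; apply: (@hol_mk _ _ (fun l y => - pd l f y) oU) => x.
- by move=> Ux; apply: differentiableN; exact: (hol_diff (hf) Ux).
- by move=> l Ux; rewrite pN //; exact: (hol_diff (hf) Ux).
- move=> l Ux; apply: continuousN; exact: hol_pcont hf Ux.
Qed.

Lemma holB U f g : open U -> hol U f -> hol U g ->
  hol U (fun y => f y - g y).
Proof. by move=> oU hf hg; apply: (holD oU hf); exact: (holN oU hg). Qed.

Lemma holM U f g : open U -> hol U f -> hol U g ->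
  hol U (fun y => f y * g y).
Proof.
move=> oU hf hg.
apply: (@hol_mk _ _ (fun l y => pd l f y * g y + f y * pd l g y) oU) => x.
- by move=> Ux; apply: (@differentiableM K _ f g); [exact: (hol_diff (hf) Ux)|exact: (hol_diff (hg) Ux)].
- by move=> l Ux; rewrite pM //; [exact: (hol_diff (hf) Ux)|exact: (hol_diff (hg) Ux)].
- move=> l Ux; apply: (@continuousD K K); apply: continuousM.
  + exact: hol_pcont hf Ux. + exact: hol_continuous hg Ux.
  + exact: hol_continuous hf Ux. + exact: hol_pcont hg Ux.
Qed.

Lemma holV U f : open U -> (forall x, U x -> f x != 0) -> hol U f ->
  hol U (fun y => (f y)^-1).
Proof.
move=> oU f0 hf.
have cV x : U x -> {for x, continuous (fun y => (f y)^-1)}.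
  by move=> Ux; apply: continuousV; [exact: f0|exact: hol_continuous hf Ux].
apply: (@hol_mk _ _ (fun l y => - ((f y)^-1 * (f y)^-1) * pd l f y) oU) => x.
- by move=> Ux; apply: (@differentiableV K _ f); [exact: (hol_diff (hf) Ux)|exact: f0].
- move=> l Ux; rewrite pV //; [|exact: f0|exact: (hol_diff (hf) Ux)].
  by rewrite -exprVn expr2.
- move=> l Ux; apply: continuousM; last exact: hol_pcont hf Ux.
  by apply: (@continuousN K K); apply: continuousM; exact: cV.
Qed.

Lemma hol_sum U (I : Type) (r : seq I) (P : pred I) (F : I -> 'rV[K]_n -> K) :
  open U -> (forall i, P i -> hol U (F i)) ->
  hol U (fun y => \sum_(i <- r | P i) F i y).
Proof.
move=> oU hF; elim: r => [|i r IH].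
  apply: (hol_ext oU (f := fun=> 0)); last exact: hol_cst.
  by move=> y _; rewrite big_nil.
case Pi: (P i).
  apply: (hol_ext oU (f := fun y => F i y + \sum_(j <- r | P j) F j y)).
    by move=> y _; rewrite big_cons Pi.
  exact: (holD oU (hF i Pi) IH).
apply: (hol_ext oU _ IH) => y _; by rewrite big_cons Pi.
Qed.

Lemma hol_prod U (I : Type) (r : seq I) (P : pred I) (F : I -> 'rV[K]_n -> K) :
  open U -> (forall i, P i -> hol U (F i)) ->
  hol U (fun y => \prod_(i <- r | P i) F i y).
Proof.
move=> oU hF; elim: r => [|i r IH].
  apply: (hol_ext oU (f := fun=> 1)); last exact: hol_cst.
  by move=> y _; rewrite big_nil.
case Pi: (P i).
  apply: (hol_ext oU (f := fun y => F i y * \prod_(j <- r | P j) F j y)).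
    by move=> y _; rewrite big_cons Pi.
  exact: (holM oU (hF i Pi) IH).
apply: (hol_ext oU _ IH) => y _; by rewrite big_cons Pi.
Qed.

Lemma p_sum U (I : Type) (r : seq I) (P : pred I) (F : I -> 'rV[K]_n -> K) l x :
  open U -> (forall i, P i -> hol U (F i)) -> U x ->
  pd l (fun y => \sum_(i <- r | P i) F i y) x = \sum_(i <- r | P i) pd l (F i) x.
Proof.
move=> oU hF Ux; elim: r => [|i r IH].
  rewrite big_nil -[RHS](p_cst l 0 x); apply: (pd_ext l oU _ Ux) => y _.
  by rewrite big_nil.
rewrite big_cons; case Pi: (P i).
  rewrite -IH -pD; [|exact: (hol_diff (hF i Pi) Ux)|exact: (hol_diff (hol_sum _ oU hF) Ux)].
  by apply: (pd_ext l oU _ Ux) => y _; rewrite big_cons Pi.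
rewrite -IH; by apply: (pd_ext l oU _ Ux) => y _; rewrite big_cons Pi.
Qed.

Lemma p_scale U f (a : K) l x : hol U f -> U x ->
  pd l (fun y => a * f y) x = a * pd l f x.
Proof.
move=> hf Ux; rewrite pM; [|exact: (hol_diff (@hol_cst U a) Ux)|exact: (hol_diff (hf) Ux)].
by rewrite p_cst mul0r add0r.
Qed.

Lemma hol_comp U V (phi : 'rV[K]_n -> 'rV[K]_n) f :
  open U -> (forall y : 'rV[K]_n, U y -> V (phi y)) ->
  (forall k, hol U (fun z : 'rV[K]_n => phi z 0 k)) -> hol V f ->
  hol U (fun z : 'rV[K]_n => f (phi z)) /\
  forall l (y : 'rV[K]_n), U y -> pd l (fun z => f (phi z)) y =
    \sum_k pd k f (phi y) * pd l (fun z => phi z 0 k) y.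
Proof.
move=> oU UV hphi hf.
have H (y : 'rV[K]_n) : U y -> differentiable (f \o phi) y /\ forall l,
    pd l (f \o phi) y = \sum_k pd k f (phi y) * pd l (fun z => phi z 0 k) y.
  move=> Uy; have [||df pf] := @hasgrad_comp K n n phi f y _
    (fun k l => pd l (fun z => phi z 0 k) y) (hol_grad hf (UV y Uy)).
  - by move=> k; exact: hol_diff (hphi k) Uy.
  - by move=> k l; rewrite pdE.
  - by split=> // l; rewrite {1}pdE; exact: pf.
split; last by move=> l y Uy; exact: (H y Uy).2.
have cphi (y : 'rV[K]_n) : U y -> {for y, continuous phi}.
  move=> Uy; apply/cont_normP => e e0.
  have [|d d0 dP] := @norm_near_fin _ _ y 'I_n (fun k z => `|phi z 0 k - phi y 0 k| < e / 2).
    move=> k; have e2 : 0 < e / 2 by rewrite divr_gt0.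
    by have := (cont_normP _ _).1 (hol_continuous (hphi k) Uy) _ e2.
  exists d => // z /dP zP.
  apply: le_lt_trans (half_lt e0); apply: rV_norm_le; first by rewrite divr_ge0 // ltW.
  by move=> k; rewrite !mxE ltW.
apply: (@hol_mk _ _ (fun l (y : 'rV[K]_n) => \sum_k pd k f (phi y) * pd l (fun z : 'rV[K]_n => phi z 0 k) y) oU).
- by move=> x Ux; exact: (H x Ux).1.
- by move=> x l Ux; exact: (H x Ux).2.
move=> x l Ux.
have -> : (fun y : 'rV[K]_n => \sum_k pd k f (phi y) * pd l (fun z => phi z 0 k) y) =
   \sum_k (fun y : 'rV[K]_n => pd k f (phi y) * pd l (fun z => phi z 0 k) y : K).
  by apply/funext => y; rewrite fct_sumE.
apply: (big_ind (fun g : 'rV[K]_n -> K => {for x, continuous g})).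
- exact: cst_continuous.
- by move=> g h cg ch; apply: continuousD; [exact: cg|exact: ch].
- move=> k _; apply: continuousM.
    apply: continuous_comp; first exact: cphi.
    exact: hol_pcont hf (UV x Ux).
  exact: hol_pcont (hphi k) Ux.
Qed.

Lemma open_ballP x (c : K) : open [set y : 'rV[K]_n | `|y - x| < c].
Proof.
apply/open_normP => y /= yc; exists (c - `|y - x|); first by rewrite subr_gt0.
move=> z; rewrite ltrBrDr => zc; apply: le_lt_trans zc.
by rewrite -(subrKA y); exact: ler_normD.
Qed.

Lemma continuous_neq0 U f x : open U -> hol U f -> U x -> f x != 0 ->
  exists V, [/\ open V, V x, V `<=` U & forall y, V y -> f y != 0].
Proof.
move=> oU hf Ux fx0.
have fx : 0 < `|f x| by rewrite normr_gt0.
have [d d0 dP] := (cont_normP _ _).1 (hol_continuous hf Ux) _ fx.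
have [d' d'0 d'P] := (open_normP _).1 oU x Ux.
have [c c0 cP] := lt_minP d0 d'0.
exists [set y | `|y - x| < c]; split.
- exact: open_ballP.
- by rewrite /= subrr normr0.
- by move=> y /= /cP [_]; exact: d'P.
- move=> y /= /cP [/dP h _]; apply/eqP => fy0; move: h.
  by rewrite fy0 sub0r normrN ltxx.
Qed.

End Calculus.

(** * Iterated derivatives and the Leibniz rule on jets *)
Section Words.
Variables (R : realType) (n : nat).
Notation K := (C R).
Implicit Types (f g : 'rV[K]_n -> K) (x y : 'rV[K]_n) (U V : set 'rV[K]_n) (w : seq 'I_n).

(** Derivatives are taken along words, which suits induction; windex and wordof pass
   from words to multi-indices and back. *)
Definition wderiv w f : 'rV[K]_n -> K := foldr (@pd R n) f w.
Definition windex w : mindex n := [ffun k => count_mem k w].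
Definition wordof (L : mindex n) : seq 'I_n := flatten [seq nseq (L l) l | l <- enum 'I_n].

Lemma windex_cons l w : windex (l :: w) = mincr (windex w) l.
Proof. by apply/ffunP => k; rewrite !ffunE /= addnC eq_sym. Qed.

Lemma mdeg_windex w : mdeg (windex w) = size w.
Proof.
elim: w => [|l w IH].
  by rewrite /mdeg big1 // => k _; rewrite ffunE.
rewrite windex_cons -[size _]/(size w).+1 -IH /mdeg.
under eq_bigr => k _ do rewrite ffunE.
rewrite big_split /= -addn1; congr (_ + _)%N.
by rewrite (bigD1 l) //= eqxx big1 // => k /negPf ->.
Qed.

Lemma wordofK L : windex (wordof L) = L.
Proof.
apply/ffunP => k; rewrite ffunE /wordof count_flatten -map_comp sumnE big_map.
rewrite (bigD1_seq k) ?mem_enum ?enum_uniq //= count_nseq /= eqxx mul1n big1 ?addn0 //.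
by move=> l lk; rewrite count_nseq /= (negPf lk).
Qed.

Lemma size_wordof L : size (wordof L) = mdeg L.
Proof. by rewrite -{2}(wordofK L) mdeg_windex. Qed.

Lemma mdeg_mincr (L : mindex n) l : mdeg (mincr L l) = (mdeg L).+1.
Proof. by rewrite -(wordofK L) -windex_cons !mdeg_windex. Qed.

Lemma mincrC (L : mindex n) l m : mincr (mincr L l) m = mincr (mincr L m) l.
Proof. by apply/ffunP => k; rewrite !ffunE addnAC. Qed.

Lemma pderiv_wordof L f : pderiv L f = wderiv (wordof L) f.
Proof.
rewrite /pderiv /wderiv /wordof pdE; move: (@partial R n) => D.
elim: (enum 'I_n) => [|l s IH] //=; rewrite IH foldr_cat.
by elim: (L l) => [|k IHk] //=; rewrite IHk.
Qed.

Section OnOpen.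
Variable U : set 'rV[K]_n.
Hypothesis oU : open U.

Lemma hol_wderiv w f : hol U f -> hol U (wderiv w f).
Proof. by move=> hf; elim: w => [|l w IH] //=; exact: hol_pd. Qed.

Lemma wderiv_ext w f g : (forall y, U y -> f y = g y) -> forall y, U y -> wderiv w f y = wderiv w g y.
Proof. by move=> fg; elim: w => [|l w IH] //= y Uy; exact: (pd_ext l oU IH Uy). Qed.

Lemma wderiv_cat w w' f : wderiv (w ++ w') f = wderiv w (wderiv w' f).
Proof. exact: foldr_cat. Qed.

Lemma wderiv_partial w l f y : hol U f -> U y ->
  wderiv w (pd l f) y = pd l (wderiv w f) y.
Proof.
move=> hf; elim: w y => [|m w IH] //= y Uy.
rewrite (pd_ext m oU IH Uy); exact: (pd_comm _ _ oU (hol_wderiv w hf) Uy).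
Qed.

(** By the symmetry of second derivatives, only the multi-index of a word matters. *)
Lemma wderiv_perm w w' f y : hol U f -> perm_eq w w' -> U y ->
  wderiv w f y = wderiv w' f y.
Proof.
move=> hf; elim: w w' y => [|l w IH] w' y.
  by rewrite perm_sym => /perm_nilP ->.
move=> pw Uy; have lw' : l \in w' by rewrite -(perm_mem pw) mem_head.
case/splitPr: lw' pw => a b pw.
have pab : perm_eq w (a ++ b).
  by rewrite -(perm_cons l); apply: (perm_trans pw); rewrite perm_catC /= perm_cons perm_catC.
rewrite wderiv_cat -[wderiv (l :: b) f]/(pd l (wderiv b f)) wderiv_partial //; last exact: hol_wderiv.
rewrite -wderiv_cat /=; apply: (pd_ext l oU _ Uy) => z Uz; exact: IH.
Qed.

Lemma pderiv_windex w f y : hol U f -> U y -> pderiv (windex w) f y = wderiv w f y.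
Proof.
move=> hf Uy; rewrite pderiv_wordof; apply: wderiv_perm => //.
apply/allP => k _ /=; apply/eqP.
by have /ffunP /(_ k) := wordofK (windex w); rewrite !ffunE.
Qed.

Lemma hol_pderiv L f : hol U f -> hol U (pderiv L f).
Proof. by move=> hf; rewrite pderiv_wordof; exact: hol_wderiv. Qed.

Lemma pderiv_ext L f g : (forall y, U y -> f y = g y) -> forall y, U y -> pderiv L f y = pderiv L g y.
Proof. by move=> fg y Uy; rewrite !pderiv_wordof; exact: wderiv_ext. Qed.

Lemma pderiv_mincr L l f y : hol U f -> U y ->
  pderiv (mincr L l) f y = pd l (pderiv L f) y.
Proof.
move=> hf Uy; rewrite -{1}(wordofK L) -windex_cons pderiv_windex //=.
by rewrite pderiv_wordof.
Qed.

Lemma pderiv_partial L l f y : hol U f -> U y ->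
  pderiv L (pd l f) y = pderiv (mincr L l) f y.
Proof. by move=> hf Uy; rewrite pderiv_mincr // !pderiv_wordof wderiv_partial. Qed.

Lemma wderivD w f g y : hol U f -> hol U g -> U y ->
  wderiv w (fun z => f z + g z) y = wderiv w f y + wderiv w g y.
Proof.
move=> hf hg; elim: w y => [|l w IH] //= y Uy.
rewrite (pd_ext l oU IH Uy) pD //; first exact: (hol_diff (hol_wderiv w hf) Uy).
exact: (hol_diff (hol_wderiv w hg) Uy).
Qed.

Lemma wderiv_scale w (a : K) f y : hol U f -> U y ->
  wderiv w (fun z => a * f z) y = a * wderiv w f y.
Proof.
move=> hf; elim: w y => [|l w IH] //= y Uy.
rewrite (pd_ext l oU IH Uy); exact: (p_scale a l (hol_wderiv w hf) Uy).
Qed.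

Lemma wderivB w f g y : hol U f -> hol U g -> U y ->
  wderiv w (fun z => f z - g z) y = wderiv w f y - wderiv w g y.
Proof.
move=> hf hg Uy.
have e z : U z -> f z - g z = f z + (-1) * g z by rewrite mulN1r.
rewrite (wderiv_ext w e Uy) (wderivD _ hf) //; first by rewrite wderiv_scale // mulN1r.
by apply: holM => //; exact: hol_cst.
Qed.

Lemma wderiv_sum w (I : Type) (r : seq I) (P : pred I) (F : I -> 'rV[K]_n -> K) y :
  (forall i, P i -> hol U (F i)) -> U y ->
  wderiv w (fun z => \sum_(i <- r | P i) F i z) y = \sum_(i <- r | P i) wderiv w (F i) y.
Proof.
move=> hF; elim: w y => [|l w IH] //= y Uy.
rewrite (pd_ext l oU IH Uy); apply: (p_sum _ l oU) => // i Pi.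
exact: (hol_wderiv w (hF i Pi)).
Qed.

(** Formal Leibniz rule: the derivative along w of the product of g by a
   function of which only the jet J is known. *)
Fixpoint leib w g (J : mindex n -> K) x : K :=
  if w is l :: w' then leib w' (pd l g) J x + leib w' g (fun L => J (mincr L l)) x
  else g x * J [ffun=> 0%N].

Lemma leib_wderiv w g f x : hol U g -> hol U f -> U x ->
  leib w g (fun L => pderiv L f x) x = wderiv w (fun y => g y * f y) x.
Proof.
move=> hg hf Ux; elim: w g f hg hf => [|l w IH] g f hg hf /=.
  rewrite pderiv_wordof; congr (_ * _); have /size0nil -> // : size (wordof [ffun=> 0%N]) = 0%N.
  by rewrite size_wordof /mdeg big1 // => k _; rewrite ffunE.
rewrite -wderiv_partial //; last exact: holM.
have e y : U y -> pd l (fun z => g z * f z) y = pd l g y * f y + g y * pd l f y.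
  by move=> Uy; rewrite pM //; [exact: hol_diff hg Uy|exact: hol_diff hf Uy].
rewrite (wderiv_ext w e Ux) wderivD //; last 2 first.
- by apply: (holM oU _ hf); exact: hol_pd.
- by apply: (holM oU hg); exact: hol_pd.
rewrite -!IH //; try exact: hol_pd.
congr (_ + leib _ _ _ _); apply/funext => L; by rewrite pderiv_partial.
Qed.

Lemma leib_ext w g J J' x : (forall L, (mdeg L <= size w)%N -> J L = J' L) ->
  leib w g J x = leib w g J' x.
Proof.
elim: w g J J' => [|l w IH] g J J' JJ' /=.
  by rewrite JJ' // /mdeg big1 // => k _; rewrite ffunE.
congr (_ + _); first by apply: IH => L Lw; apply: JJ'; exact: leqW.
by apply: IH => L Lw; apply: JJ'; rewrite mdeg_mincr.
Qed.

Lemma leib_lin w g (I : finType) (a : I -> K) (J : I -> mindex n -> K) x :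
  leib w g (fun L => \sum_i a i * J i L) x = \sum_i a i * leib w g (J i) x.
Proof.
elim: w g J => [|l w IH] g J /=.
  by rewrite mulr_sumr; apply: eq_bigr => i _; rewrite mulrCA.
by rewrite !IH -big_split /=; apply: eq_bigr => i _; rewrite mulrDr.
Qed.

Lemma leibB w g (J J' : mindex n -> K) x :
  leib w g (fun L => J L - J' L) x = leib w g J x - leib w g J' x.
Proof.
elim: w g J J' => [|l w IH] g J J' /=; first by rewrite mulrBr.
by rewrite !IH; ring.
Qed.

(** On a jet without terms of degree below the length of w, all derivatives fall on it:
   the formal product is given by the symbol. *)
Lemma leib_top w g J x : (forall L, (mdeg L < size w)%N -> J L = 0) ->
  leib w g J x = g x * J (windex w).
Proof.
elim: w g J => [|l w IH] g J J0 /=.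
  by congr (_ * J _); apply/ffunP => k; rewrite !ffunE.
rewrite !IH; last 2 first.
- by move=> L Lw; apply: J0; rewrite mdeg_mincr.
- by move=> L Lw; apply: J0; exact: leqW.
by rewrite J0 ?mdeg_windex // mulr0 add0r windex_cons.
Qed.

Lemma hol_leib w g (J : 'rV[K]_n -> mindex n -> K) : hol U g ->
  (forall L, hol U (fun y => J y L)) -> hol U (fun y => leib w g (J y) y).
Proof.
elim: w g J => [|l w IH] g J hg hJ /=; first exact: holM.
apply: holD => //; first by apply: IH => //; exact: hol_pd.
exact: (IH g (fun y L => J y (mincr L l)) hg).
Qed.

(** Differentiating a formal product with variable jet: the derivative of the coefficients
   of the equations plus that of the jet. *)
Lemma partial_leib w g (J : 'rV[K]_n -> mindex n -> K) m x : hol U g ->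
  (forall L, hol U (fun y => J y L)) -> U x ->
  pd m (fun y => leib w g (J y) y) x =
  leib w (pd m g) (J x) x + leib w g (fun L => pd m (fun y => J y L) x) x.
Proof.
move=> hg hJ Ux; elim: w g J hg hJ => [|l w IH] g J hg hJ /=.
  by rewrite pM //; [exact: hol_diff hg Ux|exact: hol_diff (hJ _) Ux].
have hpg := hol_pd l oU hg.
have hJ' L : hol U (fun y => J y (mincr L l)) by [].
rewrite pD; [|exact: hol_diff (hol_leib w hpg hJ) Ux|exact: hol_diff (hol_leib w hg hJ') Ux].
rewrite IH // (IH g (fun y L => J y (mincr L l))) //.
have -> : leib w (pd m (pd l g)) (J x) x = leib w (pd l (pd m g)) (J x) x.
  have gext v (k k' : 'rV[K]_n -> K) (J0 : mindex n -> K) :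
      (forall y, U y -> k y = k' y) -> leib v k J0 x = leib v k' J0 x.
    elim: v k k' J0 => [|i v IHv] k k' J0 kk' /=; first by rewrite kk'.
    by congr (_ + _); apply: IHv => // y Uy; exact: pd_ext Uy.
  by apply: gext => y Uy; exact: (pd_comm _ _ oU hg Uy).
by ring.
Qed.

End OnOpen.
End Words.

(** * Cauchy estimates and the identity theorem *)
Section Estimates.
Variables (R : realType) (n : nat).
Notation K := (C R).
Notation V := 'rV[K]_n.
Implicit Types (f g : V -> K) (x y v : V) (U : set V) (w : seq 'I_n).

Lemma hol_mean U f x v (B : K) (j : nat) : hol U f -> 0 <= B ->
  (forall t : R, 0 <= t <= 1 -> U (x + toC t *: v)) ->
  (forall t : R, 0 <= t <= 1 ->
     `|\sum_m pd m f (x + toC t *: v) * v 0 m| <= B * toC t ^+ j) ->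
  `|f (x + v) - f x| <= B / j.+1%:R.
Proof.
move=> hf B0 sU; apply: (@mean_value_rV R n f x v (fun z m => pd m f z) B j B0).
by move=> t /sU; exact: hol_grad.
Qed.

Lemma seg_ball x0 v (d : K) (t : R) : 0 <= t <= 1 -> `|v| < d -> `|x0 + toC t *: v - x0| < d.
Proof.
move=> /andP[t0 t1]; apply: le_lt_trans.
rewrite addrAC subrr add0r normrZ toC_norm ger0_norm //.
by rewrite ler_piMl // -toC1 toC_le.
Qed.

(** Cauchy estimates for a system of functions related by a connection; a
   derivative costs 2/d on a ball smaller by d, because the estimate uses a circle of radius
   d/2 and the disc of radius d around it. *)
Lemma nagumo U x0 (rho : K) r (F : seq 'I_n -> 'I_r -> V -> K)
    (Gam : 'I_n -> 'I_r -> 'I_r -> V -> K) (G B : K) :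
  open U -> 0 <= G -> 0 <= B ->
  (forall y, `|y - x0| < rho -> U y) ->
  (forall w a, hol U (F w a)) ->
  (forall l w a y, `|y - x0| < rho ->
     F (l :: w) a y = pd l (F w a) y - \sum_b Gam l a b y * F w b y) ->
  (forall l a b y, `|y - x0| < rho -> `|Gam l a b y| <= G) ->
  (forall a y, `|y - x0| < rho -> `|F [::] a y| <= B) ->
  forall (d : K) w a y, 0 < d -> `|y - x0| + (size w)%:R * d < rho ->
    `|F w a y| <= B * (2%:R / d + r%:R * G) ^+ size w.
Proof.
move=> oU G0 B0 rU hF FE GG FB d w a y d0.
have d2 : 0 < d / 2%:R by rewrite divr_gt0.
set c := 2%:R / d + r%:R * G.
have c0 : 0 <= c by rewrite addr_ge0 ?divr_ge0 ?mulr_ge0 // ltW.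
elim: w a y => [|l w IH] a y /=.
  by rewrite mul0r addr0 expr0 mulr1; exact: FB.
rewrite -natr1 mulrDl mul1r addrA => yw.
have yw' : `|y - x0| + (size w)%:R * d < rho.
  by apply: le_lt_trans yw; rewrite lerDl ltW.
have yr : `|y - x0| < rho.
  by apply: le_lt_trans yw'; rewrite lerDl mulr_ge0 // ltW.
have near z : `|z - y| <= d -> `|z - x0| + (size w)%:R * d < rho.
  move=> zy; apply: le_lt_trans yw; rewrite [leRHS]addrAC lerD2r [leRHS]addrC -(subrKA y z).
  by apply: le_trans (ler_normD _ _) _; rewrite lerD2r.
rewrite FE //; apply: le_trans (ler_normB _ _) _.
rewrite exprS [c * _]mulrC mulrA {2}/c mulrDr; apply: lerD.
  have -> : B * c ^+ size w * (2%:R / d) = B * c ^+ size w / (d / 2%:R) by rewrite invf_div.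
  apply: (pd_bound oU (hF w a) d2).
    move=> z z2; apply: rU.
    have /near : `|y + (z * (d / 2%:R)) *: (delta_mx 0 l : V) - y| <= d.
      rewrite addrAC subrr add0r normrZ norm_delta mulr1 normrM (gtr0_norm d2).
      apply: le_trans (_ : 2%:R * (d / 2%:R) <= _); first by rewrite ler_wpM2r // ltW.
      by rewrite mulrC divfK ?pnatr_eq0.
    by apply: le_lt_trans; rewrite lerDl mulr_ge0 // ltW.
  by move=> z zy; apply: IH; apply: near; apply: le_trans zy _; exact: ltW (half_lt d0).
apply: le_trans (ler_norm_sum _ _ _) _.
apply: le_trans (ler_sum _ (_ : forall b, _ -> _ <= G * (B * c ^+ size w))) _.
  by move=> b _; rewrite normrM; apply: ler_pM => //; [exact: GG|exact: IH].
rewrite sumr_const card_ord -(mulr_natl (G * _)).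
by rewrite (_ : r%:R * (G * (B * c ^+ size w)) = B * c ^+ size w * (r%:R * G)) //; ring.
Qed.

(** A nonnegative number below a geometric sequence is zero; the field is complex, so the
   archimedean property is used on the real part. *)
Lemma geom_eq0 (a B : K) : 0 <= a -> (forall N, a <= B * 2%:R^-1 ^+ N) -> a = 0.
Proof.
move=> a0 aB; have B0 : 0 <= B by have := aB 0%N; rewrite expr0 mulr1; exact: le_trans.
apply/eqP; rewrite eq_le a0 andbT.
rewrite (ge0_toC a0) (ge0_toC B0) in aB *; rewrite -toC0 toC_le leNgt; apply/negP.
set u := reC a; set b := reC B => u0.
have ub N : u * 2 ^+ N <= b.
  have := aB N; rewrite exprVn ler_pdivlMr ?exprn_gt0 //.
  by rewrite -toC_nat -toCX -toCM toC_le.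
have b0 : 0 <= b / u by rewrite divr_ge0 ?(ltW u0) // -toC_ge0 -ge0_toC.
have := archi_boundP b0; set N := Num.bound _ => bN.
have := ub N; apply/negP; rewrite -ltNge -ltr_pdivrMl // mulrC; apply: lt_trans bN _.
by rewrite -natrX ltr_nat; exact: ltn_expl.
Qed.

(** A weak form of Stirling's bound, from (1 + 1/N)^N <= e. *)
Lemma expn_fact : exists2 E : K, 0 < E & forall N : nat, N.+1%:R ^+ N <= E ^+ N * N`!%:R.
Proof.
exists (toC (expR 1)); first by rewrite toC_gt0 expR_gt0.
move=> N; rewrite -!toC_nat -!toCX -toCM toC_le.
elim: N => [|N IH]; first by rewrite !expr0 fact0 mulr1.
have N0 : (0 : R) < N.+1%:R by rewrite ltr0Sn.
have step : N.+2%:R ^+ N.+1 <= expR 1 * (N.+1%:R ^+ N.+1) :> R.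
  have -> : expR 1 = expR (N.+1%:R^-1 : R) ^+ N.+1.
    by rewrite -expRM_natl mulfV ?lt0r_neq0.
  rewrite -exprMn; apply: lerXn2r.
  - by rewrite nnegrE.
  - by rewrite nnegrE mulr_ge0 // expR_ge0.
  apply: le_trans (_ : (1 + N.+1%:R^-1) * N.+1%:R <= _).
    by rewrite mulrDl mul1r mulVf ?lt0r_neq0 // natr1.
  by rewrite ler_wpM2r ?expR_ge1Dx.
apply: le_trans step _; rewrite [expR 1 ^+ _]exprS -mulrA ler_wpM2l ?expR_ge0 //.
rewrite exprS factS natrM mulrCA ler_wpM2l //.
Qed.

(** A holomorphic function whose derivatives all vanish at a point vanishes
   nearby: the Cauchy estimates bound the derivatives of order N by (c (N + 1))^N, and
   the iterated mean value inequality divides by N factorial. *)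
Lemma identity_theorem U f x0 : open U -> hol U f -> U x0 ->
  (forall w, wderiv w f x0 = 0) ->
  exists2 rho : K, 0 < rho & forall y, `|y - x0| < rho -> U y /\ f y = 0.
Proof.
move=> oU hf Ux0 f0.
have [d1 d10 d1P] := (open_normP _).1 oU x0 Ux0.
have [d2 d20 d2P] := (cont_normP _ _).1 (hol_continuous hf Ux0) 1 ltr01.
have [rho rho0 rP] := lt_minP d10 d20.
have rU y : `|y - x0| < rho -> U y by move=> /rP [/d1P].
have f1 y : `|y - x0| < rho -> `|f y| <= 1.
  by move=> /rP [_ /d2P]; rewrite (f0 [::] : f x0 = 0) subr0 => /ltW.
have [E E0 EP] := expn_fact.
have cauchy N w y : size w = N -> `|y - x0| < rho / 2 ->
    `|wderiv w f y| <= (4%:R * N.+1%:R / rho) ^+ N.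
  move=> sw yr; have dl0 : 0 < rho / (2%:R * N.+1%:R) by rewrite divr_gt0 // mulr_gt0 ?ltr0Sn.
  have := @nagumo U x0 rho 1 (fun w (_ : 'I_1) => wderiv w f) (fun _ _ _ _ => 0) 0 1 oU
    (lexx 0) ler01 rU (fun w _ => hol_wderiv oU w hf) _ _ _ _ w ord0 y dl0.
  rewrite mulr0 addr0 mul1r sw.
  have -> : 2%:R / (rho / (2%:R * N.+1%:R)) = 4%:R * N.+1%:R / rho.
    by field; rewrite lt0r_neq0 //= -natr1 addrC pnatr_eq0.
  apply.
  - by move=> l v _ z _; rewrite big1 ?subr0 // => b _; rewrite mul0r.
  - by move=> *; rewrite normr0.
  - by move=> _ z /f1.
  - rewrite [ltRHS]splitr; apply: ltr_leD => //.
    have -> : N%:R * (rho / (2%:R * N.+1%:R)) = rho / 2 * (N%:R / N.+1%:R).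
      by rewrite invfM; ring.
    rewrite ler_piMr ?divr_ge0 ?(ltW rho0) //.
    by rewrite ler_pdivrMr ?ltr0Sn // mul1r ler_nat.
have taylor N j w y : (size w + j)%N = N -> `|y - x0| < rho / 2 ->
   `|wderiv w f y| <= (4%:R * N.+1%:R / rho) ^+ N * (n%:R * `|y - x0|) ^+ j / j`!%:R.
  elim: j w y => [|j IH] w y sw yr.
    by rewrite expr0 mulr1 fact0 divr1; apply: cauchy => //; rewrite -sw addn0.
  set S := (_ ^+ N); have S0 : 0 <= S by rewrite exprn_ge0 // divr_ge0 ?mulr_ge0 // ltW.
  rewrite -(subr0 (wderiv w f y)) -{1}(f0 w) -{1}(subrKC x0 y).
  set v := y - x0.
  have segU (t : R) : 0 <= t <= 1 -> `|x0 + toC t *: v - x0| < rho / 2.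
    by move=> t01; exact: seg_ball.
  have -> : S * (n%:R * `|v|) ^+ j.+1 / j.+1`!%:R =
      (S * (n%:R * `|v|) ^+ j.+1 / j`!%:R) / j.+1%:R.
    by rewrite factS natrM invfM mulrCA [RHS]mulrC.
  apply: (@hol_mean U _ _ _ _ j (hol_wderiv oU w hf)).
  - by rewrite divr_ge0 // mulr_ge0 // exprn_ge0 // mulr_ge0.
  - move=> t /segU h; apply: rU; apply: lt_trans h _; exact: half_lt.
  - move=> t t01.
    have H m : `|pd m (wderiv w f) (x0 + toC t *: v)| <=
        S * (n%:R * `|v|) ^+ j / j`!%:R * toC t ^+ j.
      have := IH (m :: w) (x0 + toC t *: v); rewrite addSnnS => /(_ sw (segU t t01)) /=.
      have /andP[t0 _] := t01.
      rewrite addrAC subrr add0r normrZ toC_norm (ger0_norm t0).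
      move=> h; apply: le_trans h _; rewrite [toC t * _]mulrC mulrA -/S.
      rewrite [(_ * toC t) ^+ j]exprMn le_eqVlt; apply/orP; left; apply/eqP; ring.
    apply: le_trans (sum_coord_le _ H) _.
    rewrite le_eqVlt; apply/orP; left; apply/eqP; rewrite exprS; ring.
have n1 : 0 < n.+1%:R :> K by rewrite ltr0Sn.
exists (rho / (8%:R * E * n.+1%:R)).
  by rewrite divr_gt0 // !mulr_gt0.
have E1 : 1 <= E by have := EP 1%N; rewrite !expr1 (_ : 1`!%:R = 1 :> K) // mulr1; apply: le_trans; rewrite ler1n.
have den : 2%:R <= 8%:R * E * n.+1%:R.
  have e8 : 8%:R <= 8%:R * E * n.+1%:R :> K.
    rewrite -mulrA ler_peMr //; apply: le_trans E1 _.
    by rewrite ler_peMr ?ler1n ?(ltW E0).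
  by apply: le_trans e8; rewrite ler_nat.
have den0 : 0 < 8%:R * E * n.+1%:R by exact: lt_le_trans den.
move=> y yr.
have yr2 : `|y - x0| < rho / 2.
  apply: lt_le_trans yr _; rewrite ler_wpM2l ?(ltW rho0) // lef_pV2 ?posrE //.
split; first by apply: rU; apply: lt_trans yr2 _; exact: half_lt.
apply/eqP; rewrite -normr_eq0; apply/eqP; apply: (@geom_eq0 _ 1) => // N; rewrite mul1r.
have := taylor N N [::] y (add0n N) yr2; rewrite /=.
move=> h; apply: le_trans h _.
rewrite mulrAC -mulrA [X in X <= _]mulrA.
have fN : 0 < N`!%:R :> K by rewrite ltr0n fact_gt0.
apply: le_trans (_ : (4%:R * E * n%:R * `|y - x0| / rho) ^+ N <= _).
  have -> : (4%:R * N.+1%:R / rho) ^+ N / N`!%:R * (n%:R * `|y - x0|) ^+ N =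
     (4%:R * n%:R * `|y - x0| / rho) ^+ N * (N.+1%:R ^+ N / N`!%:R).
    rewrite !exprMn; ring.
  have -> : 4%:R * E * n%:R * `|y - x0| / rho = (4%:R * n%:R * `|y - x0| / rho) * E by ring.
  rewrite [leRHS]exprMn; apply: ler_wpM2l.
    by rewrite exprn_ge0 // divr_ge0 ?mulr_ge0 // ltW.
  by rewrite ler_pdivrMr.
apply: lerXn2r; rewrite ?nnegrE ?invr_ge0 //.
  by rewrite divr_ge0 ?mulr_ge0 // ltW.
rewrite ler_pdivrMr //.
apply: le_trans (_ : 4%:R * E * n.+1%:R * `|y - x0| <= _).
  rewrite ler_wpM2r // ler_wpM2l ?ler_nat // mulr_ge0 // ltW //.
move: yr; rewrite ltr_pdivlMr // => /ltW h.
rewrite [leRHS]mulrC ler_pdivlMr ?ltr0n //; apply: le_trans h.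
by rewrite le_eqVlt; apply/orP; left; apply/eqP; ring.
Qed.

End Estimates.

(** * Convergence of Taylor series *)
Section TaylorSeries.
Variables (R : realType) (n : nat).
Notation K := (C R).
Notation V := 'rV[K]_n.
Implicit Types (J : mindex n -> K) (x y v : V) (U : set V) (w : seq 'I_n).

Definition dshift (l : 'I_n) J : mindex n -> K := fun L => J (mincr L l).
Notation mi0 := ([ffun=> 0%N] : mindex n).

Lemma dshiftC l m J : dshift l (dshift m J) = dshift m (dshift l J).
Proof. by apply/funext => L; rewrite /dshift mincrC. Qed.

(** Homogeneous parts of the Taylor series at x of a function with jet J, in
   Euler's recursive form. *)
Fixpoint tpart (k : nat) J x y : K :=
  if k is k'.+1 then k'.+1%:R^-1 * \sum_l (y 0 l - x 0 l) * tpart k' (dshift l J) x y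
  else J mi0.

Lemma open_rV : open ([set: V]).
Proof. exact: openT. Qed.

Lemma hol_shift_coord x (l : 'I_n) : hol [set: V] (fun y => y 0 l - x 0 l).
Proof. exact: holB open_rV (@hol_coord _ _ _ l) (@hol_cst _ _ _ _). Qed.

Lemma hol_tpart k J x : hol [set: V] (tpart k J x).
Proof.
elim: k J => [|k IH] J; first exact: hol_cst.
apply: holM; [exact: open_rV|exact: hol_cst|].
apply: hol_sum; first exact: open_rV.
move=> l _; apply: holM; [exact: open_rV|exact: hol_shift_coord|exact: IH].
Qed.

Lemma pd_tpart0 m J x y : pd m (tpart 0 J x) y = 0.
Proof. exact: p_cst. Qed.

Lemma hol_tterm k J x (l : 'I_n) :
  hol [set: V] (fun y => (y 0 l - x 0 l) * tpart k (dshift l J) x y).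
Proof. exact: holM open_rV (hol_shift_coord x l) (hol_tpart _ _ x). Qed.

Lemma pd_tterm k J x y m (l : 'I_n) :
  pd m (fun y => (y 0 l - x 0 l) * tpart k (dshift l J) x y) y =
  (m == l)%:R * tpart k (dshift l J) x y + (y 0 l - x 0 l) * pd m (tpart k (dshift l J) x) y.
Proof.
have Ty : [set: V] y by [].
rewrite pM; [|exact: hol_diff (hol_shift_coord x l) Ty|exact: hol_diff (hol_tpart _ _ x) Ty].
rewrite pD; [|exact: hol_diff (@hol_coord _ _ _ l) Ty|exact: hol_diff (@hol_cst _ _ _ _) Ty].
by rewrite p_coord p_cst addr0.
Qed.

Lemma pd_tpartS k J x y m :
  pd m (tpart k.+1 J x) y = k.+1%:R^-1 * (tpart k (dshift m J) x y +
     \sum_l (y 0 l - x 0 l) * pd m (tpart k (dshift l J) x) y).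
Proof.
have Ty : [set: V] y by [].
have dsum : hol [set: V] (fun y => \sum_l (y 0 l - x 0 l) * tpart k (dshift l J) x y).
  by exact: hol_sum open_rV (fun l _ => hol_tterm k J x l).
rewrite -[tpart k.+1 J x]/(fun y => k.+1%:R^-1 * \sum_l (y 0 l - x 0 l) * tpart k (dshift l J) x y).
rewrite (p_scale _ _ dsum Ty) (p_sum _ _ open_rV (fun l _ => hol_tterm k J x l) Ty).
under eq_bigr => l _ do rewrite pd_tterm.
rewrite big_split /=; congr (_ * (_ + _)).
rewrite (bigD1 m) //= eqxx mul1r big1 ?addr0 // => l lm.
by rewrite eq_sym (negPf lm) mul0r.
Qed.

Lemma pd_tpart k m J x y : pd m (tpart k.+1 J x) y = tpart k (dshift m J) x y.
Proof.
elim: k J y => [|k IH] J y; rewrite pd_tpartS.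
  rewrite big1 => [|l _]; first by rewrite addr0 invr1 mul1r.
  by rewrite pd_tpart0 mulr0.
under eq_bigr => l _ do rewrite IH dshiftC.
have k0 : k.+1%:R != 0 :> K by rewrite pnatr_eq0.
have k20 : k.+2%:R != 0 :> K by rewrite pnatr_eq0.
apply: (mulfI k20); rewrite mulVKf //.
have -> : \sum_(l < n) (y 0 l - x 0 l) * tpart k (dshift l (dshift m J)) x y =
   k.+1%:R * tpart k.+1 (dshift m J) x y by rewrite /= mulVKf.
by rewrite -[k.+2%:R]natr1 mulrDl mul1r addrC.
Qed.

Lemma tpart_bound k J x y (A : K) : (forall L, mdeg L = k -> `|J L| <= A) ->
  `|tpart k J x y| <= A * (n%:R * `|y - x|) ^+ k / k`!%:R.
Proof.
elim: k J => [|k IH] J JA.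
  by rewrite expr0 mulr1 fact0 divr1; apply: JA; rewrite /mdeg big1 // => i _; rewrite ffunE.
rewrite /= normrM normfV normr_nat.
have H l : `|tpart k (dshift l J) x y| <= A * (n%:R * `|y - x|) ^+ k / k`!%:R.
  by apply: IH => L Lk; apply: JA; rewrite mdeg_mincr Lk.
have := sum_coord_le (y - x) H.
have -> : \sum_m tpart k (dshift m J) x y * (y - x) 0 m =
    \sum_m (y 0 m - x 0 m) * tpart k (dshift m J) x y.
  by apply: eq_bigr => m _; rewrite !mxE mulrC.
move=> h; rewrite mulrC ler_pdivrMr ?ltr0Sn //; apply: le_trans h _.
have fk : k`!%:R != 0 :> K by rewrite pnatr_eq0 -lt0n fact_gt0.
have k1 : k.+1%:R != 0 :> K by rewrite pnatr_eq0.
rewrite le_eqVlt; apply/orP; left; apply/eqP.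
rewrite exprS factS natrM invfM -[RHS]mulrA.
set a := (k`!%:R)^-1; set b := k.+1%:R^-1.
have -> : b * a * k.+1%:R = a by rewrite mulrAC mulVf // mul1r.
by ring.
Qed.

(** The growth condition under which the Taylor series converges. *)
Definition growth (B D : K) J :=
  [/\ 0 <= B, 0 < D & forall L, `|J L| <= B * D ^+ mdeg L * (mdeg L)`!%:R].

Lemma growth_dshift B D J l : growth B D J -> growth (B * D) (2%:R * D) (dshift l J).
Proof.
move=> [B0 D0 JB]; split; [by rewrite mulr_ge0 // ltW|by rewrite mulr_gt0|] => L.
apply: le_trans (JB _) _; rewrite mdeg_mincr exprS factS natrM.
set k := mdeg L.
have -> : B * D * (2%:R * D) ^+ k * k`!%:R = B * (D * D ^+ k) * (2%:R ^+ k * k`!%:R).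
  by rewrite exprMn; ring.
apply: ler_wpM2l; first by rewrite !mulr_ge0 ?exprn_ge0 // ltW.
by rewrite ler_wpM2r // -natrX ler_nat; exact: ltn_expl.
Qed.

Definition tsum J x N y : K := \sum_(k < N) tpart k J x y.

Lemma hol_tsum J x N : hol [set: V] (tsum J x N).
Proof. by apply: hol_sum open_rV _ => k _; exact: hol_tpart. Qed.

Lemma pd_tsum m J x N y : pd m (tsum J x N.+1) y = tsum (dshift m J) x N y.
Proof.
rewrite (p_sum _ _ open_rV (fun k _ => hol_tpart _ _ x) (I : [set: V] y)).
rewrite big_ord_recl pd_tpart0 add0r; apply: eq_bigr => k _; exact: pd_tpart.
Qed.

Lemma tpart_geom B D J x y k : growth B D J -> n%:R * D * `|y - x| <= 2%:R^-1 ->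
  `|tpart k J x y| <= B * 2%:R^-1 ^+ k.
Proof.
move=> [B0 D0 JB] yx.
have JA L : mdeg L = k -> `|J L| <= B * D ^+ k * k`!%:R by move=> <-.
apply: le_trans (tpart_bound x y JA) _.
have fk : k`!%:R != 0 :> K by rewrite pnatr_eq0 -lt0n fact_gt0.
rewrite mulrAC mulfK // -mulrA ler_wpM2l // -exprMn.
apply: lerXn2r; rewrite ?nnegrE ?invr_ge0 ?mulr_ge0 ?(ltW D0) //.
by rewrite mulrCA mulrA.
Qed.

Lemma tsum_bound B D J x y N : growth B D J -> n%:R * D * `|y - x| <= 2%:R^-1 ->
  `|tsum J x N y| <= B * 2%:R.
Proof.
move=> g yx; have [B0 _ _] := g.
apply: le_trans (ler_norm_sum _ _ _) _.
apply: le_trans (ler_sum _ (fun (k : 'I_N) _ => tpart_geom k g yx)) _.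
rewrite -mulr_sumr ler_wpM2l // -(lerD2r (2%:R * 2%:R^-1 ^+ N)).
have -> : \sum_(k < N) 2%:R^-1 ^+ k + 2%:R * 2%:R^-1 ^+ N = 2%:R :> K.
  elim: N => [|N IH]; first by rewrite big_ord0 add0r expr0 mulr1.
  rewrite big_ord_recr /= -[RHS]IH -addrA; congr (_ + _).
  by rewrite exprS mulrA divff ?pnatr_eq0 // mul1r (natrD _ 1 1) mulrDl !mul1r.
by rewrite lerDl mulr_ge0 // exprn_ge0 // invr_ge0.
Qed.

Definition tay J x y : K := ulim (fun N => tsum J x N y).

Lemma tsum_bounded B D J x y : growth B D J -> n%:R * D * `|y - x| <= 2%:R^-1 ->
  bounded (fun N => tsum J x N y).
Proof. by move=> g yx; exists (B * 2%:R) => N; exact: tsum_bound g yx. Qed.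

(** The terms of the series tend to 0, so the partial sums may be shifted by one; the
   derivative of a partial sum has one term less. *)
Lemma tay_shift B D J x y : growth B D J -> n%:R * D * `|y - x| <= 2%:R^-1 ->
  tay J x y = ulim (fun N => tsum J x N.+1 y).
Proof.
move=> g yx; have -> : (fun N => tsum J x N.+1 y) = (fun N => tsum J x N y + tpart N J x y).
  by apply/funext => N; rewrite /tsum big_ord_recr.
have [B0 D0 _] := g.
rewrite ulimD; [|exact: tsum_bounded g yx|]; last first.
  exists B => N; apply: le_trans (tpart_geom N g yx) _.
  by rewrite ler_piMr // exprn_ile1 ?invr_ge0 // invf_le1 // ler1n.
rewrite [X in _ + X]ulim0 ?addr0 // => e e0.
exists (Num.bound (reC (B / e))) => // N /= Ne.
apply: le_trans (tpart_geom N g yx) _.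
have b0 : 0 <= B / e by rewrite divr_ge0 // ltW.
rewrite exprVn ler_pdivrMr ?exprn_gt0 // mulrC -ler_pdivrMr //.
apply: le_trans (_ : N%:R <= _); last by rewrite -natrX ler_nat ltnW // ltn_expl.
apply: le_trans (_ : (Num.bound (reC (B / e)))%:R <= _); last by rewrite ler_nat.
rewrite (ge0_toC b0) -toC_nat toC_le ltW //; apply: archi_boundP.
by rewrite -toC_ge0 -ge0_toC.
Qed.

Lemma growth_second B D J l m : growth B D J ->
  growth (2%:R * B * D ^+ 2) (4%:R * D) (dshift l (dshift m J)).
Proof.
move=> g; have := growth_dshift l (growth_dshift m g).
by congr growth; rewrite ?expr2; ring.
Qed.

(** The quadratic remainder of the partial sums is bounded uniformly, so it
   passes to the limit and the sum can be differentiated term by term. *)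
Lemma tay_taylor1 B D J x y v : growth B D J ->
  n%:R * (4%:R * D) * `|y - x| <= 2%:R^-1 ->
  n%:R * (4%:R * D) * `|y + v - x| <= 2%:R^-1 ->
  `|tay J x (y + v) - tay J x y - \sum_m tay (dshift m J) x y * v 0 m| <=
    n%:R * (n%:R * (4%:R * B * D ^+ 2) * `|v|) * `|v|.
Proof.
move=> g yr yvr; have [B0 D0 _] := g.
have D4 : 0 <= n%:R * (4%:R * D) by rewrite !mulr_ge0 // ltW.
set E := 4%:R * B * D ^+ 2.
have E0 : 0 <= E by rewrite /E !mulr_ge0 // ltW.
have far z : n%:R * (4%:R * D) * `|z - x| <= 2%:R^-1 -> forall l m N,
    `|pd l (tsum (dshift m J) x N) z| <= E.
  move=> zr l m [|N].
    have -> : tsum (dshift m J) x 0 = fun=> 0 by apply/funext => u; rewrite /tsum big_ord0.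
    by rewrite p_cst normr0.
  rewrite pd_tsum; apply: le_trans (tsum_bound N (growth_second l m g) zr) _.
  by rewrite /E le_eqVlt; apply/orP; left; apply/eqP; ring.
clearbody E.
have seg (u : V) (t : R) : 0 <= t <= 1 -> n%:R * (4%:R * D) * `|y + u - x| <= 2%:R^-1 ->
    n%:R * (4%:R * D) * `|y + toC t *: u - x| <= 2%:R^-1.
  move=> /andP[t0 t1] ur.
  have -> : y + toC t *: u - x = (1 - toC t) *: (y - x) + toC t *: (y + u - x).
    by apply/rowP => i; rewrite !mxE; ring.
  have t1K : 0 <= 1 - toC t by rewrite -toC1 -toCB toC_ge0 subr_ge0.
  have t0K : 0 <= toC t by rewrite toC_ge0.
  apply: le_trans (ler_wpM2l D4 (ler_normD _ _)) _.
  rewrite !normrZ (ger0_norm t1K) (ger0_norm t0K) mulrDr mulrCA [X in _ + X]mulrCA.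
  have -> : 2%:R^-1 = (1 - toC t) * 2%:R^-1 + toC t * 2%:R^-1 :> K by ring.
  by apply: lerD; apply: ler_wpM2l.
have est N : `|tsum J x N.+1 (y + v) - tsum J x N.+1 y -
    \sum_m tsum (dshift m J) x N y * v 0 m| <= n%:R * (n%:R * E * `|v|) * `|v|.
  have step z : n%:R * (4%:R * D) * `|y + z - x| <= 2%:R^-1 -> forall m,
      `|tsum (dshift m J) x N (y + z) - tsum (dshift m J) x N y| <= n%:R * E * `|z|.
    move=> zr m; rewrite -[leRHS]divr1.
    apply: (@hol_mean R n [set: V] _ _ _ _ 0 (hol_tsum _ _ _)) => //.
      by rewrite !mulr_ge0.
    move=> t t01; rewrite expr0 mulr1; apply: sum_coord_le => l; apply: far.
    exact: seg.
  pose h z := tsum J x N.+1 z - \sum_m tsum (dshift m J) x N y * z 0 m.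
  have -> : tsum J x N.+1 (y + v) - tsum J x N.+1 y -
      \sum_m tsum (dshift m J) x N y * v 0 m = h (y + v) - h y.
    rewrite /h; have -> : \sum_m tsum (dshift m J) x N y * (y + v) 0 m =
      \sum_m tsum (dshift m J) x N y * y 0 m + \sum_m tsum (dshift m J) x N y * v 0 m.
      by rewrite -big_split; apply: eq_bigr => m _; rewrite mxE mulrDr.
    by set A1 := \sum_m _; set A2 := \sum_m _; ring.
  rewrite -[leRHS]divr1.
  apply: (@mean_value_rV R n h y v
    (fun z m => tsum (dshift m J) x N z - tsum (dshift m J) x N y) _ 0).
  - by rewrite !mulr_ge0.
  - move=> t t01; apply: hasgrad_sub; apply: (eq_hasgrad (c := fun m => pd m (tsum J x N.+1) (y + toC t *: v))).
      by move=> m; exact: pd_tsum.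
    exact: hol_grad (hol_tsum J x N.+1) (I : [set: V] _).
  - move=> t t01; rewrite expr0 mulr1; apply: sum_coord_le => m.
    apply: le_trans (step _ (seg _ _ t01 yvr) m) _.
    rewrite ler_wpM2l ?mulr_ge0 // normrZ toC_norm.
    by case/andP: t01 => t0 t1; rewrite ger0_norm // ler_piMl // -toC1 toC_le.
have r1 z : n%:R * (4%:R * D) * `|z - x| <= 2%:R^-1 -> n%:R * D * `|z - x| <= 2%:R^-1.
  apply: le_trans; rewrite ler_wpM2r // ler_wpM2l //.
  by rewrite -[leLHS]mul1r ler_wpM2r ?(ltW D0) // ler1n.
have r2 z : n%:R * (4%:R * D) * `|z - x| <= 2%:R^-1 -> n%:R * (2%:R * D) * `|z - x| <= 2%:R^-1.
  apply: le_trans; rewrite ler_wpM2r // ler_wpM2l //.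
  by rewrite ler_wpM2r ?(ltW D0) // ler_nat.
have bm m : bounded (fun N => tsum (dshift m J) x N y).
  exact: tsum_bounded (growth_dshift m g) (r2 y yr).
have bS z : n%:R * (4%:R * D) * `|z - x| <= 2%:R^-1 -> bounded (fun N => tsum J x N.+1 z).
  by move=> /r1 zr; have [b bP] := tsum_bounded g zr; exists b => N; exact: bP.
rewrite (tay_shift g (r1 _ yr)) (tay_shift g (r1 _ yvr)).
have -> : \sum_m tay (dshift m J) x y * v 0 m = ulim (fun N => \sum_m tsum (dshift m J) x N y * v 0 m).
  by rewrite -[RHS](@ulim_sum R n (fun m N => tsum (dshift m J) x N y) (fun m => v 0 m)).
rewrite -(ulimB (bS _ yvr) (bS _ yr)) -(ulimB (boundedB (bS _ yvr) (bS _ yr)) (ulim_sum_bounded _ bm)).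
apply: ulim_le => N; exact: est.
Qed.

Lemma tay_hasgrad B D J x y : growth B D J -> n%:R * (4%:R * D) * `|y - x| < 2%:R^-1 ->
  hasgrad (tay J x) y (fun m => tay (dshift m J) x y).
Proof.
move=> g yx; have [B0 D0 _] := g.
have D4 : 0 < 4%:R * D by rewrite mulr_gt0.
have nD : 0 <= n%:R * (4%:R * D) by rewrite mulr_ge0 // ltW.
have nD1 : 0 < n%:R * (4%:R * D) + 1 by rewrite ltr_wpDl.
move=> e e0; set c := n%:R * (n%:R * (4%:R * B * D ^+ 2)).
have c0 : 0 <= c by rewrite !mulr_ge0 // ltW.
have c1 : 0 < c + 1 by rewrite ltr_wpDl.
have s0 : 0 < 2%:R^-1 - n%:R * (4%:R * D) * `|y - x| by rewrite subr_gt0.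
have [d d0 dP] := lt_minP (divr_gt0 s0 nD1) (divr_gt0 e0 c1).
exists d => // v /dP [v1 v2].
apply: le_trans (tay_taylor1 g _ _) _.
- exact: ltW.
- rewrite addrAC; apply: le_trans (ler_wpM2l nD (ler_normD _ _)) _.
  rewrite mulrDr -lerBrDl; apply: ltW; apply: le_lt_trans _ (_ : `|v| * (n%:R * (4%:R * D) + 1) < _).
    by rewrite mulrC ler_wpM2l // lerDl.
  by rewrite -ltr_pdivlMr.
- rewrite mulrA -/c ler_wpM2r //.
  move: v2; rewrite ltr_pdivlMr // => /ltW; apply: le_trans.
  by rewrite mulrC ler_wpM2l // lerDl.
Qed.

(** The gradient of the sum is the sum of the series of the shifted jets. These have growth
   constant 2 D, so they are themselves differentiable on the ball where 4 (2 D) is allowed. *)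
Lemma tay_hol B D J x : growth B D J ->
  let U := [set y | `|y - x| < (2%:R * (n%:R * (8%:R * D) + 1))^-1] in
  hol U (tay J x) /\ forall m y, U y -> pd m (tay J x) y = tay (dshift m J) x y.
Proof.
move=> g U; have [B0 D0 _] := g.
have a1 : 0 < n%:R * (8%:R * D) + 1 by rewrite ltr_wpDl // !mulr_ge0 // ltW.
have UP y : U y -> n%:R * (8%:R * D) * `|y - x| < 2%:R^-1.
  rewrite /U /= invfM ltr_pdivlMr // mulrC; apply: le_lt_trans.
  by rewrite ler_wpM2r // lerDl.
have UP4 y : U y -> n%:R * (4%:R * D) * `|y - x| < 2%:R^-1.
  move/UP; apply: le_lt_trans; rewrite ler_wpM2r // ler_wpM2l //.
  by rewrite ler_wpM2r ?(ltW D0) // ler_nat.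
have pE m y : U y -> pd m (tay J x) y = tay (dshift m J) x y.
  by move=> Uy; rewrite pdE; exact: (hasgrad_diff (tay_hasgrad g (UP4 y Uy))).2.
split=> //; apply: (@hol_mk _ _ U _ (fun m => tay (dshift m J) x) (@open_ballP _ _ _ _)).
- by move=> y Uy; exact: (hasgrad_diff (tay_hasgrad g (UP4 y Uy))).1.
- by move=> y m Uy; exact: pE.
- move=> y m Uy; apply: differentiable_continuous.
  have g' := growth_dshift m g.
  have h : n%:R * (4%:R * (2%:R * D)) * `|y - x| < 2%:R^-1.
    by have := UP y Uy; rewrite (_ : 4%:R * (2%:R * D) = 8%:R * D) //; ring.
  exact: (hasgrad_diff (tay_hasgrad g' h)).1.
Qed.

Lemma tay_val J x : tay J x x = J mi0.
Proof.
have t0 k : tpart k.+1 J x x = 0.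
  by rewrite /= big1 ?mulr0 // => l _; rewrite subrr mul0r.
have s0 N : tsum J x N.+1 x = J mi0.
  by rewrite /tsum big_ord_recl /= big1 ?addr0 // => k _; exact: t0.
rewrite /tay -[RHS](@ulim_cst R); apply: ulim_ext.
by exists 1%N => // -[|N] // _; exact: s0.
Qed.

Lemma tay_jet B D J x w : growth B D J -> wderiv w (tay J x) x = J (windex w).
Proof.
elim: w B D J => [|l w IH] B D J g.
  by rewrite /= tay_val; congr J; apply/ffunP => k; rewrite !ffunE.
have [hU pU] := tay_hol x g; set U := [set y | _] in hU pU.
have oU : open U by exact: open_ballP.
have [B0 D0 _] := g.
have Ux : U x.
  by rewrite /U /= subrr normr0 invr_gt0 mulr_gt0 // ltr_wpDl // !mulr_ge0 // ltW.
rewrite /= -(wderiv_partial oU) // (wderiv_ext oU w (fun y Uy => pU l y Uy) Ux).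
by rewrite (IH _ _ _ (growth_dshift l g)) windex_cons.
Qed.

End TaylorSeries.

(** * Bases and holomorphic frames *)
Section LinearAlgebra.
Variables (K : numFieldType).

(** Row rank equals column rank: as long as m < r chosen columns leave a nonzero kernel
   vector, independence yields a column that this vector does not annihilate. *)
Lemma unit_minor (I : Type) r (g : 'I_r -> I -> K) :
  (forall a : 'I_r -> K, (forall i, \sum_b a b * g b i = 0) -> forall b, a b = 0) ->
  exists idx : 'I_r -> I, (\matrix_(b, j) g b (idx j)) \in unitmx.
Proof.
case: r g => [|r'] g ind.
  have f0 (j : 'I_0) : I by case: j.
  by exists f0; rewrite unitmxE det_mx00 unitr1.
set r := r'.+1 in g ind *.
have nz (u : 'I_r -> K) b : u b != 0 -> exists i, \sum_c u c * g c i != 0.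
  move=> ub; apply: contrapT => H; move/eqP: ub; apply; apply: ind => i.
  by apply: contrapT => /eqP Hi; apply: H; exists i.
have [i0 _] : exists i, \sum_c (c == ord0)%:R * g c i != 0.
  by apply: (nz (fun c => (c == ord0)%:R) ord0); rewrite eqxx oner_eq0.
have H m : (m <= r)%N -> exists idx : nat -> I,
    row_free (\matrix_(j < m, b < r) g b (idx j)).
  elim: m => [_|m IH mr].
    by exists (fun=> i0); rewrite /row_free -leqn0 rank_leq_row.
  have [idx fA] := IH (ltnW mr); set A := (\matrix_(j, b) _) in fA.
  have : kermx A^T != 0.
    by rewrite -mxrank_eq0 mxrank_ker mxrank_tr (eqP fA) subn_eq0 -ltnNge.
  move=> /rowV0Pn [u /sub_kermxP uA u0].
  have [b ub] : exists b, u 0 b != 0.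
    apply: contrapT => H; move/eqP: u0; apply; apply/rowP => b; rewrite mxE.
    by apply: contrapT => /eqP Hb; apply: H; exists b.
  have [i ui] := nz (u 0) b ub.
  exists (fun j => if (j < m)%N then idx j else i).
  apply: inj_row_free => t; set A' := (\matrix_(j, b) _) => tA.
  have tAb c : \sum_(j < m) t 0 (widen_ord (leqnSn m) j) * g c (idx j)
      + t 0 ord_max * g c i = 0.
    have := congr1 (fun M : 'M[K]_(1, r) => M 0 c) tA; rewrite !mxE big_ord_recr /= => H; rewrite -[RHS]H.
    congr (_ + _); last by rewrite mxE /= ltnn.
    by apply: eq_bigr => j _; rewrite mxE /= ltn_ord.
  have uAj (j : 'I_m) : \sum_c u 0 c * g c (idx j) = 0.
    have := congr1 (fun M : 'M[K]_(1, m) => M 0 j) uA; rewrite !mxE => {2}<-.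
    by apply: eq_bigr => c _; rewrite !mxE.
  have tm : t 0 ord_max = 0.
    apply: (mulIf ui); rewrite mul0r mulr_sumr.
    have : \sum_c u 0 c * (\sum_(j < m) t 0 (widen_ord (leqnSn m) j) * g c (idx j)
      + t 0 ord_max * g c i) = 0 by rewrite big1 // => c _; rewrite tAb mulr0.
    under eq_bigr => c _ do rewrite mulrDr mulr_sumr.
    rewrite big_split /= exchange_big /= big1 ?add0r => [|j _].
      by move=> {2}<-; apply: eq_bigr => c _; rewrite mulrCA.
    transitivity (t 0 (widen_ord (leqnSn m) j) * \sum_c u 0 c * g c (idx j)).
      by rewrite mulr_sumr; apply: eq_bigr => c _; rewrite mulrCA.
    by rewrite uAj mulr0.
  have t0 : (\row_(j < m) t 0 (widen_ord (leqnSn m) j)) = 0.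
    apply/eqP; rewrite -(mulmx_free_eq0 _ fA); apply/eqP/rowP => c; rewrite !mxE.
    rewrite -[RHS](tAb c) tm mul0r addr0; apply: eq_bigr => j _; by rewrite !mxE.
  apply/rowP => j; rewrite mxE; have [jm|] := ltnP j m.
    have := congr1 (fun M : 'M[K]_(1, m) => M 0 (Ordinal jm)) t0; rewrite !mxE => <-.
    by congr (t 0 _); exact: val_inj.
  move=> mj; rewrite -tm; congr (t 0 _); apply: val_inj => /=.
  by apply/eqP; rewrite eqn_leq mj -ltnS ltn_ord.
have [idx fA] := H r (leqnn r); exists (fun j => idx j).
by rewrite -unitmx_tr -row_free_unit; move: fA; congr row_free; apply/matrixP => i j; rewrite !mxE.
Qed.

Section Spans.
Variables (V : lmodType K) (S : set V).

Definition indep r (e : 'I_r -> V) :=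
  forall a : 'I_r -> K, \sum_k a k *: e k = 0 -> forall k, a k = 0.

Definition spans r (e : 'I_r -> V) :=
  forall s, S s -> exists a : 'I_r -> K, s = \sum_k a k *: e k.

Lemma basis_mod0P r (e : 'I_r -> V) :
  basis_mod S [set 0] e <-> [/\ forall k, S (e k), indep e & spans e].
Proof.
split=> -[eS ei es]; split=> //.
  by move=> s /es [a /= /eqP]; rewrite subr_eq0 => /eqP ->; exists a.
by move=> s /es [a ->]; exists a; rewrite subrr.
Qed.

Lemma spans_mx r m (e : 'I_r -> V) (f : 'I_m -> V) : spans e -> (forall k, S (f k)) ->
  exists A : 'M[K]_(m, r), forall k, f k = \sum_j A k j *: e j.
Proof.
move=> es fS; have /choice [A AP] : forall k, exists a : 'I_r -> K, f k = \sum_j a j *: e j.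
  by move=> k; exact: es.
exists (\matrix_(k, j) A k j) => k; rewrite AP; by apply: eq_bigr => j _; rewrite mxE.
Qed.

Lemma mx_comb r m (e : 'I_r -> V) (f : 'I_m -> V) (A : 'M[K]_(m, r)) (u : 'rV[K]_m) :
  (forall k, f k = \sum_j A k j *: e j) ->
  \sum_k u 0 k *: f k = \sum_j (u *m A) 0 j *: e j.
Proof.
move=> fA; under eq_bigr => k _ do rewrite fA scaler_sumr.
rewrite exchange_big /=; apply: eq_bigr => j _.
by rewrite mxE scaler_suml; apply: eq_bigr => k _; rewrite scalerA.
Qed.

Lemma indep_row_free r m (e : 'I_r -> V) (f : 'I_m -> V) (A : 'M[K]_(m, r)) :
  (forall k, f k = \sum_j A k j *: e j) -> indep f -> row_free A.
Proof.
move=> fA fi; apply: inj_row_free => u uA; apply/rowP => k; rewrite mxE.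
apply: (fi (u 0)); rewrite (mx_comb _ fA) uA big1 // => j _; by rewrite mxE scale0r.
Qed.

(** The matrix of independent vectors in a spanning family has free rows. *)
Lemma indep_card r m (e : 'I_r -> V) (f : 'I_m -> V) :
  spans e -> (forall k, S (f k)) -> indep f -> (m <= r)%N.
Proof.
move=> es fS fi; have [A fA] := spans_mx es fS.
by have /eqP <- := indep_row_free fA fi; exact: rank_leq_col.
Qed.

(** When the two families have the same size, that matrix is invertible. *)
Lemma indep_spans r (e f : 'I_r -> V) :
  spans e -> (forall k, S (f k)) -> indep f -> spans f.
Proof.
move=> es fS fi; have [A fA] := spans_mx es fS.
have Au : A \in unitmx by rewrite -row_free_unit; exact: indep_row_free fA fi.
move=> s /es [a ->]; exists (fun k => ((\row_j a j) *m invmx A) 0 k).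
rewrite (mx_comb _ fA) mulmxKV //; by apply: eq_bigr => j _; rewrite mxE.
Qed.

End Spans.
End LinearAlgebra.

Section DualFrame.
Variables (R : realType) (n : nat).
Notation K := (C R).
Notation V := 'rV[K]_n.
Implicit Types (U : set V).

Lemma hol_local U (f : V -> K) :
  (forall x, U x -> exists2 U', U' x & hol U' f) -> hol U f.
Proof. by move=> H; apply/holP => x /H [U' U'x /holP]; exact. Qed.

Lemma hol_det p U (M : V -> 'M[K]_p) : open U -> (forall i j, hol U (fun z => M z i j)) ->
  hol U (fun z => \det (M z)).
Proof.
move=> oU hM; rewrite /determinant; apply: hol_sum => // s _.
apply: holM => //; first exact: hol_cst.
by apply: hol_prod => // i _; exact: hM.
Qed.

Lemma hol_adj p U (M : V -> 'M[K]_p) i j : open U -> (forall i j, hol U (fun z => M z i j)) ->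
  hol U (fun z => (\adj (M z)) i j).
Proof.
move=> oU hM; apply: (hol_ext oU (f := fun z => (-1) ^+ (j + i) * \det (row' j (col' i (M z))))).
  by move=> z _; rewrite !mxE.
apply: holM => //; first exact: hol_cst.
apply: hol_det => // k l.
by apply: (hol_ext oU (f := fun z => M z (lift j k) (lift i l))) => // z _; rewrite !mxE.
Qed.

(** Independence is an open condition, and coefficients along independent
   holomorphic vectors are holomorphic, by Cramer's rule. *)
Lemma dual_frame (I : Type) r (G : 'I_r -> V -> I -> K) U x : open U -> U x ->
  (forall b i, hol U (fun y => G b y i)) ->
  (forall a : 'I_r -> K, (forall i, \sum_b a b * G b x i = 0) -> forall b, a b = 0) ->
  exists U', [/\ open U', U' x, U' `<=` U,
    (forall y (a : 'I_r -> K), U' y -> (forall i, \sum_b a b * G b y i = 0) -> forall b, a b = 0) &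
    forall U'' (s : V -> I -> K) (a : 'I_r -> V -> K), open U'' -> U'' `<=` U' ->
      (forall i, hol U'' (fun y => s y i)) ->
      (forall y i, U'' y -> s y i = \sum_b a b y * G b y i) -> forall b, hol U'' (a b)].
Proof.
move=> oU Ux hG /unit_minor [idx]; rewrite unitmxE unitfE.
pose M y := \matrix_(b < r, j < r) G b y (idx j).
have hM b j : hol U (fun y => M y b j).
  by apply: (hol_ext oU (f := fun y => G b y (idx j))) => // y _; rewrite mxE.
rewrite -/(M x) => dx; have hdet := hol_det oU hM.
have [U' [oU' U'x U'U dU']] := continuous_neq0 oU hdet Ux dx.
have coef y (a : 'I_r -> K) c : U' y ->
    \sum_j (\sum_b a b * G b y (idx j)) * (\adj (M y)) j c = \det (M y) * a c.
  move=> U'y; have := congr1 (fun N : 'M[K]_r => (\row_b a b *m N) 0 c) (mul_mx_adj (M y)).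
  rewrite mul_mx_scalar mulmxA !mxE => <-.
  apply: eq_bigr => j _; congr (_ * _); rewrite mxE.
  by apply: eq_bigr => b _; rewrite !mxE.
exists U'; split => //.
  move=> y a U'y a0 c; have := coef y a c U'y; rewrite big1 => [/esym/eqP|j _].
    by rewrite mulf_eq0 (negPf (dU' y U'y)) => /eqP.
  by rewrite a0 mul0r.
move=> U'' s a oU'' sub hs sE c; have subU : U'' `<=` U by move=> y /sub /U'U.
apply: (hol_ext oU'' (f := fun y => (\det (M y))^-1 * \sum_j s y (idx j) * (\adj (M y)) j c)).
  move=> y U''y; apply: (canLR (mulKf _)); first by apply: dU'; exact: sub.
  rewrite -(coef y (fun b => a b y)); last exact: sub.
  by apply: eq_bigr => j _; rewrite sE.
have hM' b j : hol U'' (fun y => M y b j) by exact: hol_sub subU _.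
apply: holM => //.
  apply: holV => //; last exact: hol_det.
  by move=> y /sub /dU'.
apply: hol_sum => // j _; apply: holM => //; exact: hol_adj.
Qed.

End DualFrame.

(** * The equations of the bundles of formal abelian relations *)
Section LocalWeb.
Variables (R : realType) (n d : nat).
Notation K := (C R).
Notation V := 'rV[K]_n.
Notation jetT := (jetT R n d).
Variables (B : set V) (v : 'I_d -> V -> K).
Hypotheses (oB : open B) (hv : forall i, hol B (v i)).
Implicit Types (x y : V) (U : set V) (w : seq 'I_n) (J : jetT) (t : V -> 'M[K]_(d, n)).

(** The fiber at y of the bundle A of tuples of conormal forms with zero sum. *)
Definition inA y (m : 'M[K]_(d, n)) :=
  (forall i l q, pd q (v i) y * m i l = pd l (v i) y * m i q) /\
  forall l, \sum_i m i l = 0.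

(** Local sections of A. *)
Definition locA U t :=
  (forall i l, hol U (fun y => t y i l)) /\ forall y, U y -> inA y (t y).

Definition comp J i l : mindex n -> K := fun L => J L i l.

(** The equations of the fiber of R_h at y: support, proportionality of each form
   to the differential of its first integral (as the derivatives of the vanishing of
   their wedge product), zero sum, and closedness. *)
Definition eqR (h : nat) y J :=
  [/\ forall L, (h < mdeg L)%N -> J L = 0,
      forall w i l q, (size w <= h)%N ->
        leib w (pd q (v i)) (comp J i l) y = leib w (pd l (v i)) (comp J i q) y,
      forall L l, (mdeg L <= h)%N -> \sum_i J L i l = 0
    & forall L i l m, (mdeg L < h)%N -> J (mincr L l) i m = J (mincr L m) i l].

Lemma wderiv0 w y : wderiv w (fun=> 0 : K) y = 0.
Proof.
elim: w y => [|l w IH] y //=.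
have -> : wderiv w (fun=> 0 : K) = fun=> 0 by apply/funext => z; exact: IH.
by rewrite p_cst.
Qed.

Lemma leib0 w g y : leib w g (fun=> 0 : K) y = 0.
Proof. by elim: w g => [|l w IH] g /=; rewrite ?mulr0 // !IH addr0. Qed.

Lemma pderiv_dform U t i l m L y : open U -> U y ->
  (forall i l, hol U (fun y => t y i l)) ->
  pderiv L (dform t i l m) y =
  pderiv (mincr L l) (fun z => t z i m) y - pderiv (mincr L m) (fun z => t z i l) y.
Proof.
move=> oU Uy ht.
have hl := hol_pd l oU (ht i m); have hm := hol_pd m oU (ht i l).
rewrite -!(pderiv_partial oU) // /dform -!pdE !pderiv_wordof.
exact: (wderivB oU _ hl hm Uy).
Qed.

(** The equations are the derivatives at y of the identities that define sections of A and
   closed forms. *)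
Lemma jet_eqR h U t y : open U -> U `<=` B -> U y -> locA U t ->
  (forall L, (mdeg L < h)%N -> forall i l m, pderiv L (dform t i l m) y = 0) ->
  eqR h y (jet h t y).
Proof.
move=> oU UB Uy [ht tA] dt0.
have hvU i : hol U (v i) by exact: hol_sub UB (hv i).
have jetE L i l : (mdeg L <= h)%N -> jet h t y L i l = pderiv L (fun z => t z i l) y.
  by move=> Lh; rewrite /jet Lh mxE.
split.
- by move=> L hL; rewrite /jet leqNgt hL.
- move=> w i l q wh.
  have H l' q' : leib w (pd q' (v i)) (comp (jet h t y) i l') y =
      wderiv w (fun z => pd q' (v i) z * t z i l') y.
    rewrite -(leib_wderiv oU w (hol_pd q' oU (hvU i)) (ht i l') Uy).
    by apply: leib_ext => L Lw; rewrite /comp jetE // (leq_trans Lw).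
  rewrite !H; apply: (wderiv_ext oU) => // z Uz.
  by have [+ _] := tA z Uz; exact.
- move=> L l Lh; under eq_bigr => i _ do rewrite jetE //.
  under eq_bigr => i _ do rewrite pderiv_wordof.
  rewrite -(@wderiv_sum _ _ _ oU (wordof L) _ _ _ _ y (fun i _ => ht i l) Uy) -[RHS](wderiv0 (wordof L) y).
  by apply: (wderiv_ext oU) => // z Uz; have [_] := tA z Uz; exact.
- move=> L i l m Lh; rewrite !jetE ?mdeg_mincr //; apply/eqP; rewrite -subr_eq0.
  by rewrite -(pderiv_dform i l m L oU Uy ht) dt0.
Qed.

(** Differentiating a section of R_h and subtracting the shift of a lift to
   R_(h+1) stays in R_h: the covariant derivative takes values in R_h. *)
Lemma deriv_eqR h U (J : V -> jetT) (J' : jetT) y m : open U -> U `<=` B -> U y ->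
  (forall L i l, hol U (fun z => J z L i l)) -> (forall z, U z -> eqR h z (J z)) ->
  eqR h.+1 y J' -> (forall L, (mdeg L <= h)%N -> J' L = J y L) ->
  eqR h y (fun L => (\matrix_(i, l) pd m (fun z => J z L i l) y) - Defs.shift h m J' L).
Proof.
move=> oU UB Uy hJ JR [J'0 J'w J't J'c] J'J.
have hvU i : hol U (v i) by exact: hol_sub UB (hv i).
have pd0 (f : V -> K) : (forall z, U z -> f z = 0) -> pd m f y = 0.
  by move=> f0; rewrite -(p_cst m (0 : K) y); exact: pd_ext Uy.
split.
- move=> L hL; rewrite /Defs.shift leqNgt hL subr0; apply/matrixP => i l; rewrite !mxE.
  by apply: pd0 => z Uz; have [-> //] := JR z Uz; rewrite mxE.
- move=> w i l q wh.
  have H l' q' : leib w (pd q' (v i)) (comp (fun L => (\matrix_(i, l) pd m (fun z => J z L i l) y)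
       - Defs.shift h m J' L) i l') y =
     pd m (fun z => leib w (pd q' (v i)) (comp (J z) i l') z) y
     - leib (m :: w) (pd q' (v i)) (comp J' i l') y.
    rewrite (partial_leib oU w m (hol_pd q' oU (hvU i)) (fun L => hJ L i l') Uy) /=.
    have -> : leib w (pd m (pd q' (v i))) (comp (J y) i l') y =
        leib w (pd m (pd q' (v i))) (comp J' i l') y.
      by apply: leib_ext => L Lw; rewrite /comp J'J // (leq_trans Lw).
    rewrite opprD addrACA subrr add0r -leibB.
    by apply: leib_ext => L Lw; rewrite /comp /Defs.shift (leq_trans Lw wh) !mxE.
  rewrite !H; congr (_ - _); last exact: J'w.
  by apply: (pd_ext _ oU _ Uy) => z Uz; have [_ + _ _] := JR z Uz; exact.
- move=> L l Lh; under eq_bigr => i _ do rewrite !mxE /Defs.shift Lh.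
  rewrite sumrB J't ?mdeg_mincr // subr0 -(p_sum _ _ oU (fun i _ => hJ L i l) Uy).
  by apply: pd0 => z Uz; have [_ _ + _] := JR z Uz; exact.
- move=> L i l k Lh; rewrite !mxE /Defs.shift !mdeg_mincr Lh mincrC J'c ?mdeg_mincr //.
  rewrite [mincr (mincr L m) k]mincrC; congr (_ - _).
  by apply: (pd_ext _ oU _ Uy) => z Uz; have [_ _ _] := JR z Uz; exact.
Qed.

Definition independent_powers (j : nat) y := forall a : 'I_d -> K,
  (forall w, size w = j -> \sum_i a i * \prod_(l <- w) pd l (v i) y = 0) ->
  forall i, a i = 0.

(** Injectivity of the truncation of R_(h+1). Let J be in R_(h+1) with zero truncation.
   Its i-th form is gam_L du_i for each L of degree h + 1, and by closedness gam_L is in turn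
   a multiple of the monomials of degree h + 1 in the components of du_i. So the i-th
   symbol is a_i times the power of degree h + 2 of du_i. These powers have zero sum, and
   they are independent. *)
Lemma symbol_inj h y J : (forall i, exists q, pd q (v i) y != 0) ->
  independent_powers h.+2 y -> eqR h.+1 y J ->
  (forall L, (mdeg L <= h)%N -> J L = 0) -> J = fun=> 0.
Proof.
move=> gnz ind [J0 Jw Jt Jc] Jlow.
pose addw w (L : mindex n) := foldr (fun l L' => mincr L' l) L w.
have addwS w L l : addw w (mincr L l) = mincr (addw w L) l.
  by elim: w => //= k w ->; rewrite mincrC.
have mdeg_addw w L : mdeg (addw w L) = (mdeg L + size w)%N.
  by elim: w => [|l w IH] /=; rewrite ?addn0 // mdeg_mincr IH addnS.
have top w i l q : size w = h.+1 ->
    pd q (v i) y * J (windex w) i l = pd l (v i) y * J (windex w) i q.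
  move=> wh; have := Jw w i l q; rewrite wh leqnn => /(_ isT).
  by rewrite !leib_top // => L; rewrite wh ltnS => Lh; rewrite /comp Jlow // mxE.
have /choice [a aP] : forall i, exists a : K, forall w l, size w = h.+1 ->
    J (windex w) i l = a * \prod_(k <- l :: w) pd k (v i) y.
  move=> i; have [q q0] := gnz i; pose G l := pd l (v i) y.
  pose gam L := J L i q / G q.
  have JE L l : mdeg L = h.+1 -> J L i l = gam L * G l.
    move=> Lh; rewrite /gam mulrAC; apply: (mulIf q0); rewrite divfK //.
    by rewrite mulrC -(wordofK L) top ?size_wordof // mulrC.
  have gc L l m : mdeg L = h -> gam (mincr L l) * G m = gam (mincr L m) * G l.
    by move=> Lh; rewrite -!JE ?mdeg_mincr ?Lh // Jc // Lh.
  (* Closedness moves indices one by one onto q, at the cost of a factor G q. *)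
  have spread w L : (mdeg L + size w)%N = h.+1 ->
      gam (addw w L) * G q ^+ size w = gam (addw (nseq (size w) q) L) * \prod_(k <- w) G k.
    elim: w L => [|l w IH] L /=; first by rewrite big_nil expr0.
    move=> Lw; rewrite exprS mulrA gc; last first.
      by rewrite mdeg_addw; apply/eqP; rewrite -eqSS -Lw addnS.
    rewrite -addwS mulrAC IH ?mdeg_mincr ?addSnnS // big_cons -mulrA [_ * G l]mulrC.
    by congr (gam _ * _); rewrite -/(addw _ _) addwS.
  exists (gam (addw (nseq h.+1 q) [ffun=> 0%N]) / G q ^+ h.+1) => w l wh.
  have zero : mdeg ([ffun=> 0%N] : mindex n) = 0%N.
    by rewrite /mdeg big1 // => k _; rewrite ffunE.
  have wE : windex w = addw w [ffun=> 0%N].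
    elim: w {wh} => [|k w IH]; first by apply/ffunP => k; rewrite !ffunE.
    by rewrite windex_cons IH.
  rewrite JE ?mdeg_windex // big_cons wE [G l * _]mulrC mulrA; congr (_ * _).
  have q0' : G q ^+ h.+1 != 0 by rewrite expf_neq0.
  apply: (mulIf q0'); rewrite [RHS]mulrAC divfK // -wh; apply: spread.
  by rewrite zero wh.
have a0 i : a i = 0.
  apply: ind => -[|l w] // [wh].
  under eq_bigr => j _ do rewrite -aP //.
  by rewrite Jt // mdeg_windex wh.
apply/funext => L; have [Lh|] := leqP (mdeg L) h; first exact: Jlow.
rewrite leq_eqVlt => /orP[/eqP Lh|Lh]; last exact: J0.
apply/matrixP => i l; rewrite -(wordofK L) aP ?size_wordof //.
by rewrite a0 mul0r mxE.
Qed.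

(** * Realization of jets by sections of A *)
(** A partial sum of the Taylor series is a polynomial with a prescribed jet. *)
Lemma tsum_jet (J : mindex n -> K) x N w : (size w < N)%N ->
  wderiv w (tsum J x N) x = J (windex w).
Proof.
elim: w J N => [|l w IH] J [|N] //= wN.
  rewrite /tsum big_ord_recl /= big1 ?addr0 => [|k _].
    by congr J; apply/ffunP => k; rewrite !ffunE.
  by rewrite big1 ?mulr0 // => l _; rewrite subrr mul0r.
rewrite -(wderiv_partial (@open_rV R n) _ _ (hol_tsum J x N.+1)) //.
rewrite (wderiv_ext (@open_rV R n) w (fun y _ => pd_tsum l J x N y) (I : [set: V] x)).
by rewrite IH // windex_cons.
Qed.

Definition flat h (f : V -> K) y := forall w, (size w <= h)%N -> wderiv w f y = 0.

Section Flat.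
Variables (U : set V) (y : V) (h : nat).
Hypotheses (oU : open U) (Uy : U y).

Lemma flat_ext f g : (forall z, U z -> f z = g z) -> flat h f y -> flat h g y.
Proof. by move=> fg ff w wh; rewrite -(wderiv_ext oU w fg Uy) ff. Qed.

Lemma flatM g f : hol U g -> hol U f -> flat h f y -> flat h (fun z => g z * f z) y.
Proof.
move=> hg hf ff w wh; rewrite -(leib_wderiv oU w hg hf Uy) -(leib0 w g y).
apply: leib_ext => L Lw; rewrite pderiv_wordof ff // size_wordof.
exact: leq_trans Lw wh.
Qed.

Lemma flat_sum (I : Type) (r : seq I) (F : I -> V -> K) : (forall i, hol U (F i)) ->
  (forall i, flat h (F i) y) -> flat h (fun z => \sum_(i <- r) F i z) y.
Proof.
move=> hF fF w wh; rewrite (wderiv_sum oU w _ (fun i _ => hF i)) //.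
by rewrite big1 // => i _; exact: fF.
Qed.

End Flat.

(** Every solution of the equations is the jet of a local section of A: take the
   polynomial tuple of forms t0 with that jet, and project it onto A. The projection
   first replaces each form by a multiple c_i of the differential of its first integral,
   read on a component q_i where this differential is not zero, and then subtracts from
   n forms in general position the coefficients D_i that represent the remaining sum T.
   The changes are combinations of quantities that vanish to order h at y, because the
   jet of t0 solves the equations. *)
Lemma realize h y J : B y -> (forall i, exists q, pd q (v i) y != 0) ->
  (exists f : 'I_n -> 'I_d, (\matrix_(k, l) pd l (v (f k)) y) \in unitmx) ->
  eqR h y J -> exists U t, [/\ open U, U y, U `<=` B, locA U t & jet h t y = J].
Proof.
move=> By /choice [q q0] [f fu] [Jh Jw Jt Jc].
pose N z := \matrix_(k < n, l < n) pd l (v (f k)) z.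
have hN z k l : N z k l = pd l (v (f k)) z by rewrite mxE.
have hNB k l : hol B (fun z => N z k l).
  by apply: (hol_ext oB (f := pd l (v (f k)))) => [z _|]; [rewrite hN|exact: hol_pd].
pose phi z := (\prod_i pd (q i) (v i) z) * \det (N z).
have hphi : hol B phi.
  apply: holM => //; last exact: hol_det.
  by apply: hol_prod => // i _; exact: hol_pd.
have phi0 : phi y != 0.
  apply: mulf_neq0; first by apply/prodf_neq0 => i _; exact: q0.
  by have := fu; rewrite unitmxE unitfE.
have [U [oU Uy UB phiU]] := continuous_neq0 oB hphi By phi0.
have qU z i : U z -> pd (q i) (v i) z != 0.
  move=> /phiU; rewrite mulf_eq0 negb_or => /andP[/prodf_neq0 H _]; exact: H.
have NU z : U z -> \det (N z) != 0.
  by move=> /phiU; rewrite mulf_eq0 negb_or => /andP[].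
have hv' i l : hol U (pd l (v i)) by apply: hol_sub UB _; exact: hol_pd.
pose t0 z i l := tsum (comp J i l) y h.+1 z.
have ht0 i l : hol U (fun z => t0 z i l) by apply: hol_sub (hol_tsum _ _ _).
pose c i z := t0 z i (q i) * (pd (q i) (v i) z)^-1.
have hqV i : hol U (fun z => (pd (q i) (v i) z)^-1).
  by apply: holV => // z; exact: qU.
have hc i : hol U (c i) by apply: holM.
pose T l z := \sum_i c i z * pd l (v i) z.
have hT l : hol U (T l) by apply: hol_sum => // i _; exact: holM.
have hNU k l : hol U (fun z => N z k l) by exact: hol_sub UB (hNB k l).
pose iN z l k := (\det (N z))^-1 * (\adj (N z)) l k.
have hiN l k : hol U (fun z => iN z l k).
  by apply: holM => //; [apply: holV => //; exact: hol_det|exact: hol_adj].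
pose b k z := \sum_l T l z * iN z l k.
have hb k : hol U (b k) by apply: hol_sum => // l _; exact: holM.
have bE z l : U z -> \sum_k b k z * N z k l = T l z.
  move=> Uz; rewrite /b; under eq_bigr => k _ do rewrite mulr_suml.
  rewrite exchange_big /=.
  have E l' : \sum_k T l' z * iN z l' k * N z k l = T l' z * (l' == l)%:R.
    under eq_bigr => k _ do rewrite -mulrA.
    rewrite -mulr_sumr; congr (_ * _).
    have := congr1 (fun M : 'M[K]_n => (\det (N z))^-1 * M l' l) (mul_adj_mx (N z)).
    rewrite !mxE mulr_sumr => H; rewrite /iN; under eq_bigr => k _ do rewrite -mulrA.
    by rewrite H mulrnAr mulVf // NU.
  under eq_bigr => l' _ do rewrite E.
  rewrite (bigD1 l) //= eqxx mulr1 big1 ?addr0 // => l' /negPf ->; exact: mulr0.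
pose D i z := \sum_k (f k == i)%:R * b k z.
have hD i : hol U (D i).
  by apply: hol_sum => // k _; apply: holM => //; exact: hol_cst.
pose t z := \matrix_(i < d, l < n) ((c i z - D i z) * pd l (v i) z).
have tE z i l : t z i l = (c i z - D i z) * pd l (v i) z by rewrite mxE.
have ht i l : hol U (fun z => t z i l).
  apply: (hol_ext oU (f := fun z => (c i z - D i z) * pd l (v i) z)) => [z _|]; first by rewrite tE.
  by apply: holM => //; exact: holB.
exists U, t; split => //.
  split => // z Uz; split=> [i l q'|l]; first by rewrite !tE; ring.
  under eq_bigr => i _ do rewrite tE mulrBl.
  rewrite sumrB /D; apply/eqP; rewrite subr_eq0; apply/eqP.
  under [RHS]eq_bigr => i _ do rewrite mulr_suml.
  rewrite exchange_big /= -/(T l z) -(bE z l Uz); apply: eq_bigr => k _.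
  rewrite (bigD1 (f k)) //= eqxx mul1r big1 ?addr0 ?hN // => i.
  by rewrite eq_sym => /negPf ->; rewrite !mul0r.
(* the projection does not change the jet *)
have jt0 w i l : (size w <= h)%N -> wderiv w (fun z => t0 z i l) y = J (windex w) i l.
  by move=> wh; rewrite /t0 tsum_jet.
have flat_wedge i l q' : flat h (fun z => pd q' (v i) z * t0 z i l - pd l (v i) z * t0 z i q') y.
  move=> w wh.
  have h1 : hol U (fun z => pd q' (v i) z * t0 z i l) by exact: holM.
  have h2 : hol U (fun z => pd l (v i) z * t0 z i q') by exact: holM.
  rewrite (wderivB oU w h1 h2 Uy) -!(leib_wderiv oU) //.
  have jc i' l' : leib w (pd l' (v i)) (fun L => pderiv L (fun z => t0 z i i') y) y =
      leib w (pd l' (v i)) (comp J i i') y.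
    apply: leib_ext => L Lw; rewrite pderiv_wordof jt0 ?wordofK // size_wordof.
    exact: leq_trans Lw wh.
  by rewrite !jc Jw // subrr.
have flat_p i l : flat h (fun z => c i z * pd l (v i) z - t0 z i l) y.
  apply: (@flat_ext U y h oU Uy (fun z => (pd (q i) (v i) z)^-1 *
      (pd l (v i) z * t0 z i (q i) - pd (q i) (v i) z * t0 z i l))).
    by move=> z Uz; rewrite /c; field; exact: qU.
  have hw : hol U (fun z => pd l (v i) z * t0 z i (q i) - pd (q i) (v i) z * t0 z i l).
    by apply: holB => //; exact: holM.
  exact: (flatM oU Uy (hqV i) hw (flat_wedge i (q i) l)).
have flat_t0 l : flat h (fun z => \sum_i t0 z i l) y.
  move=> w wh; rewrite (wderiv_sum oU w _ (fun i _ => ht0 i l)) //.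
  by under eq_bigr => i _ do rewrite jt0 //; rewrite Jt // mdeg_windex.
have flatD (f1 f2 : V -> K) : hol U f1 -> hol U f2 -> flat h f1 y -> flat h f2 y ->
    flat h (fun z => f1 z + f2 z) y.
  by move=> h1 h2 f1h f2h w wh; rewrite (wderivD oU _ h1 h2) // f1h // f2h // addr0.
have hp i l : hol U (fun z => c i z * pd l (v i) z - t0 z i l) by apply: holB => //; exact: holM.
have flat_T l : flat h (T l) y.
  apply: (@flat_ext U y h oU Uy (fun z => \sum_i (c i z * pd l (v i) z - t0 z i l) + \sum_i t0 z i l)).
    by move=> z _; rewrite sumrB subrK.
  apply: flatD => //; [by apply: hol_sum|by apply: hol_sum|].
  exact: (@flat_sum U).
have flat_b k : flat h (b k) y.
  apply: (@flat_sum U) => // l; first exact: holM.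
  apply: (@flat_ext U y h oU Uy (fun z => iN z l k * T l z)) => [z _|]; first by rewrite mulrC.
  exact: (@flatM U).
have flat_D i : flat h (D i) y.
  apply: (@flat_sum U) => // k; first by apply: holM => //; exact: hol_cst.
  by apply: (@flatM U) => //; exact: hol_cst.
have jt w i l : (size w <= h)%N -> wderiv w (fun z => t z i l) y = J (windex w) i l.
  move=> wh; rewrite -jt0 //.
  have e z : U z -> t z i l = t0 z i l + ((c i z * pd l (v i) z - t0 z i l) +
       (- pd l (v i) z) * D i z) by move=> _; rewrite tE; ring.
  have hNp : hol U (fun z => - pd l (v i) z) by exact: holN.
  have hDp : hol U (fun z => - pd l (v i) z * D i z) by exact: holM.
  rewrite (wderiv_ext oU w e Uy) (wderivD oU _ (ht0 i l)) //; last exact: holD.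
  rewrite (wderivD oU _ (hp i l)) // flat_p // add0r.
  by rewrite (@flatM U y h oU Uy _ _ hNp (hD i)) // addr0.
apply/funext => L; rewrite /jet; case: leqP => [Lh|hL]; last by rewrite Jh.
by apply/matrixP => i l; rewrite mxE pderiv_wordof jt ?size_wordof // wordofK.
Qed.

(** * Lifts to jets of all orders *)
Lemma jcomb m (a : 'I_m -> K) (J : 'I_m -> jetT) L i l :
  (\sum_k a k *: J k) L i l = \sum_k a k * J k L i l.
Proof.
elim/big_ind2: _ => [|f x g y <- <-|k _]; first by rewrite mxE.
  by rewrite !mxE.
by rewrite !mxE.
Qed.

Lemma jetP (J J' : jetT) : (forall L i l, J L i l = J' L i l) -> J = J'.
Proof. by move=> H; apply/funext => L; apply/matrixP => i l. Qed.

Lemma eqR_comb k y m (a : 'I_m -> K) (J : 'I_m -> jetT) :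
  (forall b, eqR k y (J b)) -> eqR k y (\sum_b a b *: J b).
Proof.
move=> JR; split.
- move=> L kL; apply/matrixP => i l; rewrite jcomb mxE big1 // => b _.
  by have [-> //] := JR b; rewrite mxE mulr0.
- move=> w i l q wk.
  have H l' q' : leib w (pd q' (v i)) (comp (\sum_b a b *: J b) i l') y =
      \sum_b a b * leib w (pd q' (v i)) (comp (J b) i l') y.
    by rewrite -leib_lin; apply: leib_ext => L _; rewrite /comp jcomb.
  by rewrite !H; apply: eq_bigr => b _; have [_ -> ] := JR b.
- move=> L l Lk; under eq_bigr => i _ do rewrite jcomb.
  rewrite exchange_big big1 //= => b _; rewrite -mulr_sumr.
  by have [_ _ -> //] := JR b; rewrite mulr0.
- move=> L i l q Lk; rewrite !jcomb; apply: eq_bigr => b _.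
  by have [_ _ _ ->] := JR b.
Qed.

Lemma eqRB k y J J' : eqR k y J -> eqR k y J' -> eqR k y (J - J').
Proof.
move=> JR JR'; have := @eqR_comb k y 2 (fun b => (-1) ^+ b) (fun b => if b == ord0 then J else J').
rewrite !big_ord_recl big_ord0 /= expr0 scale1r expr1 scaleN1r addr0; apply.
by move=> b; case: ifP.
Qed.

Lemma eqR_trunc k k' y J : (k <= k')%N -> eqR k' y J -> eqR k y (trunc k J).
Proof.
move=> kk [J0 Jw Jt Jc]; split.
- by move=> L kL; rewrite /trunc leqNgt kL.
- move=> w i l q wk.
  have H l' q' : leib w (pd q' (v i)) (comp (trunc k J) i l') y =
      leib w (pd q' (v i)) (comp J i l') y.
    by apply: leib_ext => L Lw; rewrite /comp /trunc (leq_trans Lw).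
  by rewrite !H Jw // (leq_trans wk).
- by move=> L l Lk; rewrite /trunc Lk Jt // (leq_trans Lk).
- move=> L i l q Lk; rewrite /trunc !mdeg_mincr Lk Jc //; exact: leq_trans kk.
Qed.

Lemma truncB k J J' : trunc k (J - J') = trunc k J - trunc k J'.
Proof. by apply/funext => L; rewrite /trunc !fctE; case: leqP => // _; rewrite subrr. Qed.

Lemma trunc_comb k m (a : 'I_m -> K) (J : 'I_m -> jetT) :
  trunc k (\sum_b a b *: J b) = \sum_b a b *: trunc k (J b).
Proof.
apply: jetP => L i l; rewrite jcomb /trunc; case: leqP => kL; first by rewrite jcomb.
by rewrite mxE big1 // => b _; rewrite mulr0.
Qed.

Lemma trunc_trunc k k' J : (k <= k')%N -> trunc k (trunc k' J) = trunc k J.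
Proof.
by move=> kk; apply/funext => L; rewrite /trunc; case: leqP => // Lk; rewrite (leq_trans Lk).
Qed.

Lemma trunc_id k y J : eqR k y J -> trunc k J = J.
Proof. by move=> [J0 _ _ _]; apply/funext => L; rewrite /trunc; case: leqP => // /J0. Qed.

(** All truncations from degree h on are injective, at the points of B. *)
Definition injR h := forall y k J, B y -> (h <= k)%N -> eqR k.+1 y J ->
  (forall L, (mdeg L <= k)%N -> J L = 0) -> J = fun=> 0.

Definition frame k r U (f : 'I_r -> V -> jetT) :=
  (forall b L i l, hol U (fun y => f b y L i l)) /\
  forall y, U y -> basis_mod (eqR k y) [set 0] (f ^~ y).

Section Lifts.
Variables (h r : nat).
Hypothesis inj : injR h.
Hypothesis frames : forall k y, (h <= k)%N -> B y ->
  exists U f, [/\ open U, U y, U `<=` B & @frame k r U f].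

Lemma inj_trunc k y J : B y -> (h <= k)%N -> eqR k y J -> trunc h J = 0 -> J = 0.
Proof.
move=> By; elim: k J => [|k IH] J.
  by rewrite leqn0 => /eqP h0; rewrite h0 => /trunc_id ->.
rewrite leq_eqVlt => /orP[/eqP <- /trunc_id -> //|hk JR J0].
have Jk : trunc k J = 0.
  by apply: IH => //; [exact: eqR_trunc JR|rewrite trunc_trunc].
apply: (inj By _ JR) => // L Lk.
by have := congr1 (fun J : jetT => J L) Jk; rewrite /trunc Lk.
Qed.

Lemma trunc_inj k y J J' : B y -> (h <= k)%N -> eqR k y J -> eqR k y J' ->
  trunc h J = trunc h J' -> J = J'.
Proof.
move=> By hk JR JR' JJ'; apply/eqP; rewrite -subr_eq0; apply/eqP.
by apply: (inj_trunc By hk (eqRB JR JR')); rewrite truncB JJ' subrr.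
Qed.

(** Formal solutions: jets of infinite order all whose truncations solve the
   equations. *)
Definition formal y J := forall k, (h <= k)%N -> eqR k y (trunc k J).

Lemma formal_uniq y J J' : B y -> formal y J -> formal y J' -> trunc h J = trunc h J' -> J = J'.
Proof.
move=> By JR JR' JJ'; apply/funext => L; have kL := leq_maxl (mdeg L) h.
have hk := leq_maxr (mdeg L) h; set k := maxn _ _ in kL hk.
have := @trunc_inj k y _ _ By hk (JR k hk) (JR' k hk); rewrite !trunc_trunc // => /(_ JJ').
by move=> /(congr1 (fun J : jetT => J L)); rewrite /trunc kL.
Qed.

Lemma formal_comb y m (a : 'I_m -> K) (J : 'I_m -> jetT) :
  (forall b, formal y (J b)) -> formal y (\sum_b a b *: J b).
Proof. by move=> JR k hk; rewrite trunc_comb; apply: eqR_comb => b; exact: JR. Qed.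

Lemma trunc_basis k (e f : 'I_r -> jetT) y : B y -> (h <= k)%N ->
  basis_mod (eqR h y) [set 0] e -> basis_mod (eqR k y) [set 0] f ->
  basis_mod (eqR h y) [set 0] (fun b => trunc h (f b)).
Proof.
move=> By hk /basis_mod0P[eR ei es] /basis_mod0P [fR fi fs]; apply/basis_mod0P.
have tR b : eqR h y (trunc h (f b)) by exact: eqR_trunc hk (fR b).
have ti : indep (fun b => trunc h (f b)).
  move=> a; rewrite -trunc_comb => a0; apply: fi.
  exact: inj_trunc By hk (eqR_comb a fR) a0.
by split=> //; exact: indep_spans es tR ti.
Qed.

Lemma trunc_frame k (f : 'I_r -> jetT) y : B y -> (h <= k)%N ->
  basis_mod (eqR k y) [set 0] f -> basis_mod (eqR h y) [set 0] (fun b => trunc h (f b)).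
Proof.
move=> By hk; have [U [e [oU Uy UB [_ /(_ y Uy) eb]]]] := frames (leqnn h) By.
exact: trunc_basis eb.
Qed.

(** The truncation of a basis of R_k is independent in R_h, which has the same rank, so it
   is a basis. *)
Lemma lift_ex k y J : B y -> (h <= k)%N -> eqR h y J ->
  exists J', eqR k y J' /\ trunc h J' = J.
Proof.
move=> By hk JR; have [U [f [oU Uy UB [_ /(_ y Uy) fb]]]] := frames hk By.
have /basis_mod0P[fR fi fs] := fb.
have /basis_mod0P[_ _ /(_ J JR) [a ->]] := trunc_frame By hk fb.
exists (\sum_b a b *: f b y); split; first exact: eqR_comb.
exact: trunc_comb.
Qed.

(** The lifts to the R_k are unique, hence compatible, and they define a jet of infinite
   order. *)
Lemma formal_lift y J : B y -> eqR h y J -> exists J', formal y J' /\ trunc h J' = J.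
Proof.
move=> By JR.
have /choice [E EP] : forall k, exists J', (h <= k)%N -> eqR k y J' /\ trunc h J' = J.
  move=> k; have [hk|kh] := leqP h k; last by exists 0.
  by have [J' HJ'] := lift_ex By hk JR; exists J'.
have EE k k' : (h <= k)%N -> (k <= k')%N -> trunc k (E k') = E k.
  move=> hk kk'; have hk' := leq_trans hk kk'.
  have [ER Eh] := EP k hk; have [ER' Eh'] := EP k' hk'.
  apply: (trunc_inj By hk _ ER); first exact: eqR_trunc kk' ER'.
  by rewrite trunc_trunc // Eh Eh'.
pose J' L := E (h + mdeg L)%N L.
have JE k : (h <= k)%N -> trunc k J' = E k.
  move=> hk; have [ER _] := EP k hk; rewrite -(trunc_id ER).
  apply/funext => L; rewrite /trunc /J'; case: leqP => // Lk.
  have h1 : (mdeg L <= h + mdeg L)%N by exact: leq_addl.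
  have /(congr1 (fun J : jetT => J L)) := EE _ (k + mdeg L)%N hk (leq_addr _ _).
  rewrite /trunc Lk => <-.
  have hl : (h + mdeg L <= k + mdeg L)%N by rewrite leq_add2r.
  have /(congr1 (fun J : jetT => J L)) := EE _ _ (leq_addr (mdeg L) h) hl.
  by rewrite /trunc h1 => <-.
exists J'; split=> [k hk|]; first by rewrite JE //; have [] := EP k hk.
by rewrite JE //; have [ER] := EP h (leqnn h); rewrite (trunc_id ER).
Qed.

(** * The connection and the growth of the lifts *)
Section Connection.
Variables (U : set V) (e : 'I_r -> V -> jetT) (E : 'I_r -> V -> jetT).
Hypotheses (oU : open U) (UB : U `<=` B) (fe : frame h U e).
Hypothesis fullE : forall a y, U y -> formal y (E a y).
Hypothesis truncE : forall a y, U y -> trunc h (E a y) = e a y.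

Let jentry (J : jetT) (p : mindex n * 'I_d * 'I_n) : K := J p.1.1 p.1.2 p.2.

Lemma indep_entry (f : 'I_r -> jetT) : indep f -> forall a : 'I_r -> K,
  (forall p, \sum_b a b * jentry (f b) p = 0) -> forall b, a b = 0.
Proof.
move=> fi a a0; apply: fi; apply: jetP => L i l; rewrite jcomb mxE.
exact: (a0 (L, i, l)).
Qed.

Lemma coef_hol (g : 'I_r -> V -> jetT) (s : V -> jetT) (a : 'I_r -> V -> K) U0 x :
  open U0 -> U0 x -> (forall b L i l, hol U0 (fun y => g b y L i l)) ->
  indep (g ^~ x) -> (forall L i l, hol U0 (fun y => s y L i l)) ->
  (forall y, U0 y -> s y = \sum_b a b y *: g b y) ->
  exists U', [/\ open U', U' x, U' `<=` U0 & forall b, hol U' (a b)].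
Proof.
move=> oU0 U0x hg gi hs sE.
have [U' [oU' U'x U'U _ H]] := @dual_frame R n _ r (fun b y => jentry (g b y)) U0 x oU0 U0x
  (fun b p => hg b _ _ _) (indep_entry gi).
exists U'; split => // b; apply: (H U' (fun y => jentry (s y)) a oU' (fun _ H => H)).
  by move=> p; apply: hol_sub U'U _; exact: hs.
by move=> y p U'y; rewrite /jentry sE ?jcomb //; exact: U'U.
Qed.

(** In a local frame of R_k, the coefficients of the lift are those of its truncation in
   the truncated frame, which are holomorphic. *)
Lemma hol_lift a L i l : hol U (fun y => E a y L i l).
Proof.
apply: hol_local => x Ux; have Bx := UB Ux.
have hk : (h <= h + mdeg L)%N by exact: leq_addr.
have Lk : (mdeg L <= h + mdeg L)%N by exact: leq_addl.
set k := (h + mdeg L)%N in hk Lk.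
have [U1 [f [oU1 U1x U1B [hf fb]]]] := frames hk Bx.
pose U2 := U1 `&` U.
have oU2 : open U2 by exact: openI.
have /choice [c cP] : forall y, exists c : 'I_r -> K, U2 y -> trunc k (E a y) = \sum_b c b *: f b y.
  move=> y; have [[U1y Uy]|nU] := pselect (U2 y); last by exists (fun=> 0).
  have /basis_mod0P[_ _ /(_ _ (fullE a Uy hk)) [c cE]] := fb y U1y.
  by exists c.
have hf2 b L' i' l' : hol U2 (fun y => f b y L' i' l').
  by apply: hol_sub (hf b L' i' l') => y [].
have htf b L' i' l' : hol U2 (fun y => trunc h (f b y) L' i' l').
  rewrite /trunc; case: leqP => // _.
  by apply: (hol_ext oU2 (f := fun=> 0)) => [y _|]; [rewrite mxE|exact: hol_cst].
have he2 L' i' l' : hol U2 (fun y => e a y L' i' l').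
  by apply: hol_sub (fe.1 a L' i' l') => y [].
have eE y : U2 y -> e a y = \sum_b c y b *: trunc h (f b y).
  move=> U2y; rewrite -(truncE a U2y.2) -trunc_comb -cP //.
  by rewrite trunc_trunc.
have /basis_mod0P[_ ti _] := trunc_frame Bx hk (fb x U1x).
have [U' [oU' U'x U'U hc]] := @coef_hol (fun b y => trunc h (f b y)) (e a) (fun b y => c y b)
   U2 x oU2 (conj U1x Ux) htf ti he2 eE.
exists U' => //; apply: (hol_ext oU' (f := fun y => \sum_b c y b * f b y L i l)).
  move=> y U'y; have := congr1 (fun J : jetT => J L i l) (cP y (U'U y U'y)).
  by rewrite jcomb /trunc Lk => ->.
apply: (hol_sum _ oU') => b _; apply: (holM oU' (hc b)).
exact: hol_sub U'U (hf2 b L i l).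
Qed.

Lemma hol_trunc k (s : V -> jetT) U0 : open U0 -> (forall L i l, hol U0 (fun y => s y L i l)) ->
  forall L i l, hol U0 (fun y => trunc k (s y) L i l).
Proof.
move=> oU0 hs L i l; rewrite /trunc; case: leqP => // _.
by apply: (hol_ext oU0 (f := fun=> 0)) => [y _|]; [rewrite mxE|exact: hol_cst].
Qed.

(** The difference between the derivative of a lift and its shift; it is a
   formal solution, hence a combination of the lifts of the frame. *)
Definition defect l a y : jetT :=
  fun L => (\matrix_(i, j) pd l (fun z => E a z L i j) y) - E a y (mincr L l).

Lemma defect_formal l a y : U y -> formal y (defect l a y).
Proof.
move=> Uy k hk.
have hk1 : (h <= k.+1)%N by exact: leqW.
have H := deriv_eqR l oU UB Uy (hol_trunc k oU (hol_lift a)) (fun z Uz => fullE a Uz hk)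
  (fullE a Uy hk1).
have tt L : (mdeg L <= k)%N -> trunc k.+1 (E a y) L = trunc k (E a y) L.
  by move=> Lk; rewrite /trunc Lk leqW.
have {}H := H tt; move: H; congr eqR.
apply: jetP => L i j; rewrite /trunc /defect /Defs.shift; case: leqP => Lk.
  by rewrite mdeg_mincr ltnS Lk.
rewrite subr0 !mxE -[RHS](p_cst l (0 : K) y); exact: (pd_ext l oU _ Uy).
Qed.

(** The connection form in the frame: it expresses the entries of degree k + 1 of the
   lifts by the derivatives of those of degree k. *)
Lemma connection : exists Gam : 'I_n -> 'I_r -> 'I_r -> V -> K,
  (forall l a b, hol U (Gam l a b)) /\
  forall l a y L i j, U y -> E a y (mincr L l) i j =
     pd l (fun z => E a z L i j) y - \sum_b Gam l a b y * E b y L i j.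
Proof.
have /choice [Gam GP] : forall p : 'I_n * 'I_r * V, exists c : 'I_r -> K,
    U p.2 -> defect p.1.1 p.1.2 p.2 = \sum_b c b *: E b p.2.
  move=> [[l a] y] /=; have [Uy|nU] := pselect (U y); last by exists (fun=> 0).
  have dR := defect_formal l a Uy.
  have /basis_mod0P[_ _ es] := fe.2 y Uy.
  have [c cE] := es _ (dR h (leqnn h)); exists c => _.
  apply: (formal_uniq (UB Uy) dR (formal_comb c (fun b => fullE b Uy))).
  by rewrite cE trunc_comb; apply: eq_bigr => b _; rewrite truncE.
exists (fun l a b y => Gam (l, a, y) b); split => [l a b|l a y L i j Uy].
  apply: hol_local => x Ux.
  have hdef L i j : hol U (fun y => trunc h (defect l a y) L i j).
    apply: hol_trunc => {L i j} // L i j.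
    apply: (hol_ext oU (f := fun y => pd l (fun z => E a z L i j) y - E a y (mincr L l) i j)).
      by move=> y _; rewrite !mxE.
    apply: (holB oU (hol_pd l oU (hol_lift a L i j)) (hol_lift a _ i j)).
  have dE y : U y -> trunc h (defect l a y) = \sum_b Gam (l, a, y) b *: e b y.
    move=> Uy; have := GP (l, a, y) Uy; rewrite /= => ->.
    by rewrite trunc_comb; apply: eq_bigr => c _; rewrite truncE.
  have /basis_mod0P[_ ei _] := fe.2 x Ux.
  have [U' [oU' U'x U'U hc]] := @coef_hol e (fun y => trunc h (defect l a y))
    (fun b y => Gam (l, a, y) b) U x oU Ux fe.1 ei hdef dE.
  by exists U'.
have /(congr1 (fun J : jetT => J L i j)) := GP (l, a, y) Uy.
by rewrite jcomb /defect !mxE => <-; rewrite opprB addrC subrK.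
Qed.

(** The entry of degree N is obtained by N derivations, so the Cauchy estimates with balls
   shrinking by rho / (N + 1) bound it by a constant times (c (N + 1))^N, that is, by a constant
   times D^N N!. *)
Lemma lift_growth x : U x -> exists C D : K, [/\ 0 <= C, 0 < D &
  forall a L i j, `|E a x L i j| <= C * D ^+ mdeg L * (mdeg L)`!%:R].
Proof.
move=> Ux; have [Gam [hG GE]] := connection.
pose I : finType := ('I_n * 'I_r * 'I_r + 'I_r * 'I_d * 'I_n)%type.
pose mi0 : mindex n := [ffun=> 0%N].
pose f (p : I) : V -> K := match p with
  | inl q => Gam q.1.1 q.1.2 q.2 | inr q => fun y => E q.1.1 y mi0 q.1.2 q.2 end.
have hf p : hol U (f p) by case: p => p; [exact: hG|exact: hol_lift].
have [d1 d10 d1P] := (open_normP _).1 oU x Ux.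
have [d2 d20 d2P] : exists2 d2 : K, 0 < d2 & forall y, `|y - x| < d2 -> forall p, `|f p y - f p x| < 1.
  apply: norm_near_fin => p.
  exact: (cont_normP _ _).1 (hol_continuous (hf p) Ux) 1 ltr01.
have [rho rho0 rP] := lt_minP d10 d20.
pose A := \sum_p `|f p x| + 1.
have A0 : 0 < A by rewrite ltr_wpDl // sumr_ge0.
have fA p y : `|y - x| < rho -> `|f p y| <= A.
  move=> /rP [_ /d2P /(_ p)] H; rewrite -[f p y](subrK (f p x)) /A addrC.
  apply: le_trans (ler_normD _ _) _; rewrite lerD ?(ltW H) //.
  by rewrite (bigD1 p) //= lerDl sumr_ge0.
have [c c0 cP] := @expn_fact R.
pose D := (2%:R / rho + r%:R * A) * c.
have D1 : 0 < 2%:R / rho + r%:R * A.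
  by rewrite ltr_wpDr ?mulr_ge0 ?divr_gt0 // ltW.
have D0 : 0 < D by rewrite mulr_gt0.
exists A, D; split=> // [|a L i j]; first exact: ltW.
pose N := mdeg L.
have nag := @nagumo R n U x rho r (fun w a y => E a y (windex w) i j) Gam A A oU (ltW A0) (ltW A0).
have := nag _ _ _ _ _ (rho / N.+1%:R) (wordof L) a x.
rewrite wordofK size_wordof subrr normr0 add0r -/N => {}nag.
have N0 : (0 : K) < N.+1%:R by rewrite ltr0Sn.
apply: le_trans (nag _ _ _ _ _ _ _) _.
- by move=> y /rP [/d1P].
- by move=> w b; exact: hol_lift.
- by move=> l w b y /rP [/d1P Uy _]; rewrite windex_cons GE.
- by move=> l b b' y yr; exact: (fA (inl (l, b, b'))).
- move=> b y yr; have := fA (inr (b, i, j)) y yr; rewrite /f /=.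
  by have -> : windex [::] = mi0 by apply/ffunP => k; rewrite !ffunE.
- by rewrite divr_gt0.
- by rewrite mulrCA gtr_pMr // ltr_pdivrMr // mul1r ltr_nat.
rewrite -mulrA ler_wpM2l ?(ltW A0) // /D exprMn -mulrA.
have H : 2%:R / (rho / N.+1%:R) + r%:R * A <= (2%:R / rho + r%:R * A) * N.+1%:R.
  have -> : 2%:R / (rho / N.+1%:R) = 2%:R / rho * N.+1%:R by rewrite invf_div mulrA mulrAC.
  by rewrite (mulrDl (2%:R / rho)) lerD2l ler_peMr ?ler1n // mulr_ge0 // ltW.
apply: le_trans (_ : ((2%:R / rho + r%:R * A) * N.+1%:R) ^+ N <= _).
  apply: lerXn2r => //; rewrite nnegrE; last by rewrite mulr_ge0 // ltW.
  apply: addr_ge0; last by rewrite mulr_ge0 // ltW.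
  by rewrite divr_ge0 // divr_ge0 // ltW.
by rewrite exprMn ler_wpM2l ?cP // exprn_ge0 // ltW.
Qed.

End Connection.

(** * Convergence of formal solutions *)
Lemma formalP y J : formal y J ->
  [/\ forall w i l q, leib w (pd q (v i)) (comp J i l) y = leib w (pd l (v i)) (comp J i q) y,
      forall L l, \sum_i J L i l = 0
    & forall L i l m, J (mincr L l) i m = J (mincr L m) i l].
Proof.
move=> JR; have hk N := leq_maxr N h; have Nk N := leq_maxl N h; split.
- move=> w i l q; have [_ Jw _ _] := JR _ (hk (size w)).
  have H l' q' : leib w (pd q' (v i)) (comp (trunc (maxn (size w) h) J) i l') y =
      leib w (pd q' (v i)) (comp J i l') y.
    by apply: leib_ext => L Lw; rewrite /comp /trunc (leq_trans Lw (Nk _)).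
  by have := Jw w i l q (Nk _); rewrite !H.
- move=> L l; have [_ _ Jt _] := JR _ (hk (mdeg L)).
  by have := Jt L l (Nk _); rewrite /trunc Nk.
- move=> L i l m; have [_ _ _ Jc] := JR _ (hk (mdeg L).+1).
  by have := Jc L i l m (Nk _); rewrite /trunc !mdeg_mincr Nk.
Qed.

(** The Taylor series with coefficients a formal solution converges, by the growth of
   the lifts. All derivatives at x of its wedge products with the differentials of the first
   integrals, of its sum and of its exterior derivatives vanish, so it is a closed section
   of A by the identity theorem. *)
Theorem realize_closed x J : B x -> eqR h x J -> exists U t,
  [/\ open U, U x, U `<=` B, locA U t /\ (forall y i l m, U y -> dform t i l m y = 0)
    & jet h t x = J].
Proof.
move=> Bx JR; have [U0 [e [oU0 U0x U0B fe]]] := frames (leqnn h) Bx.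
have /choice [E EP] : forall p : 'I_r * V, exists J', U0 p.2 -> formal p.2 J' /\ trunc h J' = e p.1 p.2.
  move=> [a y] /=; have [U0y|nU] := pselect (U0 y); last by exists 0.
  have /basis_mod0P[eR _ _] := fe.2 y U0y.
  by have [J' ?] := formal_lift (U0B y U0y) (eR a); exists J'.
have fullE a y (U0y : U0 y) : formal y (E (a, y)) := (EP (a, y) U0y).1.
have truncE a y (U0y : U0 y) : trunc h (E (a, y)) = e a y := (EP (a, y) U0y).2.
have [C [D [C0 D0 EG]]] := @lift_growth U0 e (fun a y => E (a, y)) oU0 U0B fe fullE truncE x U0x.
have /basis_mod0P[_ _ /(_ J JR) [al JE]] := fe.2 x U0x.
pose Jf := \sum_a al a *: E (a, x).
have fJ : formal x Jf by apply: formal_comb => a; exact: fullE.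
have tJ : trunc h Jf = J by rewrite JE trunc_comb; apply: eq_bigr => a _; rewrite truncE.
have gJ i j : growth ((\sum_a `|al a|) * C) D (comp Jf i j).
  split=> //; first by rewrite mulr_ge0 // sumr_ge0.
  move=> L; rewrite /comp jcomb -!mulrA mulr_suml; apply: le_trans (ler_norm_sum _ _ _) _.
  apply: ler_sum => a _; rewrite normrM ler_wpM2l // mulrA; exact: EG.
have [Jw Jt Jc] := formalP fJ.
pose t y := \matrix_(i < d, l < n) tay (comp Jf i l) x y.
have tE i l : (fun y => t y i l) = tay (comp Jf i l) x by apply/funext => y; rewrite mxE.
pose U1 := [set y : V | `|y - x| < (2%:R * (n%:R * (8%:R * D) + 1))^-1].
have oU1 : open U1 by exact: open_ballP.
have U1x : U1 x.
  rewrite /U1 /= subrr normr0 invr_gt0 mulr_gt0 // ltr_wpDl // mulr_ge0 // mulr_ge0 //; exact: ltW.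
have ht1 i l : hol U1 (fun y => t y i l) by rewrite tE; have [] := tay_hol x (gJ i l).
have wt w i l : wderiv w (fun y => t y i l) x = Jf (windex w) i l by rewrite tE (tay_jet x w (gJ i l)).
pose U2 := U1 `&` B.
have oU2 : open U2 by exact: openI.
have U2x : U2 x by [].
have ht i l : hol U2 (fun y => t y i l) by apply: hol_sub (ht1 i l) => y [].
have hvp i l : hol U2 (pd l (v i)) by apply: hol_sub (hol_pd l oB (hv i)) => y [].
have hpt i l m : hol U2 (pd l (fun y => t y i m)) by apply: hol_pd.
pose I : finType := ('I_d * 'I_n * 'I_n + 'I_d * 'I_n * 'I_n + 'I_n)%type.
pose f (p : I) : V -> K := match p with
  | inl (inl q) => fun y => pd q.2 (v q.1.1) y * t y q.1.1 q.1.2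
                            - pd q.1.2 (v q.1.1) y * t y q.1.1 q.2
  | inl (inr q) => fun y => pd q.1.2 (fun y => t y q.1.1 q.2) y - pd q.2 (fun y => t y q.1.1 q.1.2) y
  | inr l => fun y => \sum_i t y i l end.
have hf p : hol U2 (f p).
  case: p => [[q|q]|l] /=.
  - by apply: (holB oU2); apply: (holM oU2).
  - exact: (holB oU2 (hpt _ _ _) (hpt _ _ _)).
  - exact: (hol_sum _ oU2).
have f0 p w : wderiv w (f p) x = 0.
  case: p => [[[[i l] q]|[[i l] m]]|l] /=.
  - have hM l' q' : hol U2 (fun y => pd q' (v i) y * t y i l') by apply: (holM oU2).
    rewrite (wderivB oU2 w (hM l q) (hM q l) U2x).
    rewrite -(leib_wderiv oU2 w (hvp i q) (ht i l) U2x) -(leib_wderiv oU2 w (hvp i l) (ht i q) U2x).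
    have H l' q' : leib w (pd q' (v i)) (fun L => pderiv L (fun y => t y i l') x) x =
        leib w (pd q' (v i)) (comp Jf i l') x.
      by apply: leib_ext => L _; rewrite pderiv_wordof wt wordofK.
    by rewrite !H Jw subrr.
  - rewrite (wderivB oU2 w (hpt i l m) (hpt i m l) U2x).
    rewrite !(wderiv_partial oU2 _ _ (ht i _) U2x).
    rewrite -[pd l _ x]/(wderiv (l :: w) _ x) -[pd m _ x]/(wderiv (m :: w) _ x).
    by rewrite !wt !windex_cons Jc subrr.
  - rewrite (wderiv_sum oU2 w _ (fun i _ => ht i l)) //.
    by under eq_bigr => i _ do rewrite wt; exact: Jt.
have [rho rho0 rP] : exists2 rho : K, 0 < rho &
    forall y, `|y - x| < rho -> forall p, U2 y /\ f p y = 0.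
  by apply: norm_near_fin => p; exact: identity_theorem oU2 (hf p) U2x (f0 p).
pose U := [set y : V | `|y - x| < rho] `&` U2.
have oU : open U by apply: openI => //; exact: open_ballP.
have UP y p : U y -> f p y = 0 by move=> [/rP /(_ p) []].
exists U, t; split => //.
- by split=> //=; rewrite subrr normr0.
- by move=> y [_ []].
- split; last first.
    move=> y i l m Uy; rewrite /dform -!pdE; exact: (UP y (inl (inr (i, l, m)))).
  split=> [i l|y Uy]; first by apply: hol_sub (ht i l) => y [].
  split=> [i l q|l]; last exact: (UP y (inr l)).
  by apply/eqP; rewrite -subr_eq0; apply/eqP; exact: (UP y (inl (inl (i, l, q)))).
- rewrite -tJ; apply: jetP => L i l; rewrite /jet /trunc; case: leqP => // _.
  by rewrite mxE pderiv_wordof wt wordofK.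
Qed.

(** * Parallel sections and curvature *)
Definition closed_on U t := forall y i l m, U y -> dform t i l m y = 0.

Lemma closed_eqR U t k y : open U -> U `<=` B -> U y -> locA U t -> closed_on U t ->
  eqR k y (jet k t y).
Proof.
move=> oU UB Uy tA t0; apply: (jet_eqR oU UB Uy tA) => L _ i l m.
rewrite pderiv_wordof -[RHS](wderiv0 (wordof L) y).
by apply: (wderiv_ext oU) => // z Uz; exact: t0.
Qed.

Lemma trunc_jet k k' t y : (k <= k')%N -> trunc k (jet k' t y) = jet k t y.
Proof.
by move=> kk; apply/funext => L; rewrite /trunc /jet; case: leqP => // Lk; rewrite (leq_trans Lk).
Qed.

(** The jets of t at x belong to the R_k and have zero truncation in R_h, so all of them
   vanish, and the identity theorem applies. *)
Lemma closed_zero U t x : open U -> U `<=` B -> U x -> locA U t -> closed_on U t ->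
  jet h t x = 0 -> exists2 rho : K, 0 < rho & forall y, `|y - x| < rho -> U y /\ t y = 0.
Proof.
move=> oU UB Ux tA t0 jt0; have Bx := UB x Ux; have [ht _] := tA.
have j0 k : (h <= k)%N -> jet k t x = 0.
  move=> hk; apply: (inj_trunc Bx hk); first exact: (closed_eqR k oU UB Ux tA t0).
  by rewrite trunc_jet.
have w0 i l w : wderiv w (fun y => t y i l) x = 0.
  rewrite -(pderiv_windex oU w (ht i l) Ux).
  have := congr1 (fun J : jetT => J (windex w) i l) (j0 (maxn h (size w)) (leq_maxl _ _)).
  by rewrite /jet mdeg_windex leq_maxr !mxE.
pose f (p : 'I_d * 'I_n) y := t y p.1 p.2.
have [rho rho0 rP] : exists2 rho : K, 0 < rho & forall y, `|y - x| < rho -> forall p, U y /\ f p y = 0.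
  by apply: norm_near_fin => p; exact: identity_theorem oU (ht _ _) Ux (w0 _ _).
have [rho' rho'0 rP'] := (open_normP _).1 oU x Ux.
have [rr rr0 rrP] := lt_minP rho0 rho'0.
exists rr => // y /rrP [/rP yr /rP' Uy]; split=> //.
by apply/matrixP => i l; rewrite mxE; have [] := yr (i, l).
Qed.

Section Nabla.
Variables (lft : V -> jetT -> jetT) (U : set V).
Hypotheses (oU : open U) (UB : U `<=` B).
Hypothesis lftP : forall y J, U y -> eqR h y J -> eqR h.+1 y (lft y J) /\ trunc h (lft y J) = J.

(** The covariant derivative in the direction l, for a section lft of the truncation. *)
Definition lnabla l (sg : V -> jetT) : V -> jetT := fun y =>
  (fun L => \matrix_(i, k) partial l (fun z => sg z L i k) y) - Defs.shift h l (lft y (sg y)).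

(** Jets of closed sections are parallel, so the connection differentiates the
   coefficients. *)
Lemma lnabla_comb m (a : 'I_m -> V -> K) (s : 'I_m -> V -> 'M[K]_(d, n)) sg l y :
  (forall k, hol U (a k)) -> (forall k, locA U (s k)) -> (forall k, closed_on U (s k)) ->
  (forall z, U z -> sg z = \sum_k a k z *: jet h (s k) z) -> U y ->
  lnabla l sg y = \sum_k pd l (a k) y *: jet h (s k) y.
Proof.
move=> ha sA s0 sgE Uy; rewrite /lnabla -pdE.
have By := UB Uy.
have jR q k : eqR q y (jet q (s k) y) by exact: closed_eqR oU UB Uy (sA k) (s0 k).
have sgR : eqR h y (sg y) by rewrite sgE //; apply: eqR_comb => k; exact: jR.
have lE : lft y (sg y) = \sum_k a k y *: jet h.+1 (s k) y.
  have [lR lt] := lftP Uy sgR.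
  apply: (trunc_inj By (leqnSn h) lR); first by apply: eqR_comb => k; exact: jR.
  rewrite lt sgE // trunc_comb; apply: eq_bigr => k _; by rewrite trunc_jet.
have hs k L i j : hol U (pderiv L (fun z => s k z i j)).
  by apply: (hol_pderiv oU); have [] := sA k.
apply: jetP => L i j; rewrite !mxE jcomb lE /Defs.shift.
have [Lh|hL] := leqP (mdeg L) h; last first.
  rewrite mxE subr0 big1 => [|k _]; last by rewrite /jet leqNgt hL mxE mulr0.
  rewrite -[RHS](p_cst l (0 : K) y); apply: (pd_ext l oU _ Uy) => z Uz.
  by rewrite sgE // jcomb big1 // => k _; rewrite /jet leqNgt hL mxE mulr0.
rewrite jcomb.
have e z : U z -> sg z L i j = \sum_k a k z * pderiv L (fun z => s k z i j) z.
  by move=> Uz; rewrite sgE // jcomb; apply: eq_bigr => k _; rewrite /jet Lh mxE.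
rewrite (pd_ext l oU e Uy) (p_sum _ _ oU (fun k _ => holM oU (ha k) (hs k L i j)) Uy) -sumrB.
apply: eq_bigr => k _.
rewrite pM; [|exact: (hol_diff (ha k) Uy)|exact: (hol_diff (hs k L i j) Uy)].
rewrite /jet mdeg_mincr Lh ltnS Lh !mxE (pderiv_mincr oU); [|by have [] := sA k|by []].
by rewrite addrK.
Qed.

Lemma closed_lnabla s l y : locA U s -> closed_on U s -> U y -> lnabla l (jet h s) y = 0.
Proof.
move=> sA s0 Uy.
rewrite (@lnabla_comb 1 (fun _ _ => 1) (fun=> s)) //.
- by rewrite big_ord1 p_cst scale0r.
- by move=> _; exact: hol_cst.
- by move=> z _; rewrite big_ord1 scale1r.
Qed.

(** In degree 0, parallelism identifies the first derivatives of s with the entries of degree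
   1 of the lift of its jet, which solve the equations of closed forms. *)
Lemma lnabla_closed s y : locA U s -> (forall z, U z -> eqR h z (jet h s z)) -> U y ->
  (forall l, lnabla l (jet h s) y = 0) -> forall i l m, dform s i l m y = 0.
Proof.
move=> [hs _] sR Uy n0 i l m; have [[_ _ _ Jc] lt] := lftP Uy (sR y Uy).
pose mi0 : mindex n := [ffun=> 0%N].
have m0 : mdeg mi0 = 0%N by rewrite /mdeg big1 // => k _; rewrite ffunE.
have H l' m' : lft y (jet h s y) (mincr mi0 l') i m' = partial l' (fun z => s z i m') y.
  have := congr1 (fun J : jetT => J mi0 i m') (n0 l').
  rewrite /lnabla !mxE /Defs.shift m0 /= => /eqP; rewrite subr_eq0 => /eqP <-.
  rewrite -pdE; apply: (pd_ext l' oU _ Uy) => z Uz; rewrite /jet m0 /= mxE pderiv_wordof.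
  by have /size0nil -> : size (wordof mi0) = 0%N by rewrite size_wordof.
by rewrite /dform -!H Jc ?m0 // subrr.
Qed.

End Nabla.

(** Closed sections realizing a frame at x have jets that are independent near x, so these
   form a frame near x. *)
Lemma closed_frame x : B x -> exists U s, [/\ open U, U x, U `<=` B,
  (forall a : 'I_r, locA U (s a) /\ closed_on U (s a)) &
  (forall y, U y -> basis_mod (eqR h y) [set 0] (fun a => jet h (s a) y)) /\
  forall U' (sg : V -> jetT) (c : 'I_r -> V -> K), open U' -> U' `<=` U ->
   (forall L i l, hol U' (fun y => sg y L i l)) ->
   (forall y, U' y -> sg y = \sum_b c b y *: jet h (s b) y) -> forall b, hol U' (c b)].
Proof.
move=> Bx; have [U0 [e [oU0 U0x U0B [_ /(_ x U0x) /basis_mod0P[eR ei es]]]]] := frames (leqnn h) Bx.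
have /choice [p pP] : forall a : 'I_r, exists p : set V * (V -> 'M[K]_(d, n)),
  [/\ open p.1, p.1 x, p.1 `<=` B, locA p.1 p.2 /\ closed_on p.1 p.2 & jet h p.2 x = e a x].
  by move=> a; have [U [t H]] := realize_closed Bx (eR a); exists (U, t).
pose s a := (p a).2.
have [rho rho0 rP] : exists2 rho : K, 0 < rho & forall y, `|y - x| < rho -> forall a, (p a).1 y.
  by apply: norm_near_fin => a; have [oU Ux _ _ _] := pP a; exact: (open_normP _).1 oU x Ux.
pose U1 := [set y : V | `|y - x| < rho] `&` U0.
have oU1 : open U1 by apply: openI => //; exact: open_ballP.
have U1x : U1 x by split=> //=; rewrite subrr normr0.
have sU1 a : locA U1 (s a) /\ closed_on U1 (s a).
  have [oU Ux _ [[hs sA] s0] _] := pP a; split=> [|y i l m [/rP yr _]]; last exact: s0 (yr a).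
  split=> [i l|y [/rP yr _]]; last exact: sA (yr a).
  by apply: hol_sub (hs i l) => y [/rP].
have hj b L i l : hol U1 (fun y => jet h (s b) y L i l).
  rewrite /jet; case: leqP => Lh.
    apply: (hol_ext oU1 (f := pderiv L (fun y => s b y i l))) => [y _|]; first by rewrite mxE.
    by apply: (hol_pderiv oU1); have [[]] := sU1 b.
  by apply: (hol_ext oU1 (f := fun=> 0)) => [y _|]; [rewrite mxE|exact: hol_cst].
have ji : indep (fun b => jet h (s b) x).
  move=> a H; apply: ei; rewrite -[RHS]H; apply: eq_bigr => b _.
  by have [_ _ _ _ <-] := pP b.
pose jentry (J : jetT) (p : mindex n * 'I_d * 'I_n) : K := J p.1.1 p.1.2 p.2.
have [U [oU Ux UU1 Ui Uc]] := @dual_frame R n _ r (fun b y => jentry (jet h (s b) y)) U1 x oU1 U1x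
  (fun b p => hj b _ _ _) (indep_entry ji).
have UB : U `<=` B by move=> y /UU1 [_ /U0B].
have sU a : locA U (s a) /\ closed_on U (s a).
  have [[hs sA] s0] := sU1 a; split=> [|y i l m /UU1]; last exact: s0.
  by split=> [i l|y /UU1]; [exact: hol_sub UU1 (hs i l)|exact: sA].
exists U, s; split => //; split.
  move=> y Uy; have [U2 [e2 [oU2 U2y _ [_ /(_ y U2y) /basis_mod0P[_ _ es2]]]]] := frames (leqnn h) (UB y Uy).
  have jR a : eqR h y (jet h (s a) y).
    have [sA s0] := sU a; exact: closed_eqR oU UB Uy sA s0.
  have jiy : indep (fun a => jet h (s a) y).
    move=> a a0; apply: (Ui y a Uy) => q.
    transitivity ((\sum_k a k *: jet h (s k) y) q.1.1 q.1.2 q.2); first by rewrite jcomb.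
    by rewrite a0 mxE.
  by apply/basis_mod0P; split => //; exact: indep_spans es2 jR jiy.
move=> U' sg c oU' UU' hsg sgE; apply: (Uc U' (fun y => jentry (sg y)) c oU' UU').
  by move=> q; exact: hsg.
by move=> y q U'y; rewrite /jentry sgE // jcomb.
Qed.

(** In a frame of jets of closed sections the curvature is the commutator of
   the partial derivatives of the coefficients. *)
Lemma flat_curvature lft U (sg : V -> jetT) l m x : open U -> U `<=` B ->
  (forall y J, U y -> eqR h y J -> eqR h.+1 y (lft y J) /\ trunc h (lft y J) = J) ->
  (forall L i k, hol U (fun y => sg y L i k)) -> (forall y, U y -> eqR h y (sg y)) -> U x ->
  lnabla lft l (lnabla lft m sg) x = lnabla lft m (lnabla lft l sg) x.
Proof.
move=> oU UB lftP hsg sgR Ux.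
have [U1 [s [oU1 U1x U1B sA [sb sc]]]] := closed_frame (UB x Ux).
pose U2 := U1 `&` U; have oU2 : open U2 by exact: openI.
have /choice [c cP] : forall y, exists c : 'I_r -> K, U2 y -> sg y = \sum_b c b *: jet h (s b) y.
  move=> y; have [[U1y Uy]|nU] := pselect (U2 y); last by exists (fun=> 0).
  by have /basis_mod0P[_ _ /(_ _ (sgR y Uy)) [c cE]] := sb y U1y; exists c.
have hc b : hol U2 (fun y => c y b).
  apply: (sc U2 sg (fun b y => c y b)) => // [y []|L i k] //.
  by apply: hol_sub (hsg L i k) => y [].
have U2x : U2 x by [].
have U2B : U2 `<=` B by move=> y [_ /UB].
have lP y J (U2y : U2 y) := lftP y J U2y.2.
have sA2 b : locA U2 (s b).
  have [[hs sA'] _] := sA b; split=> [i k|y [/sA']] //; by apply: hol_sub (hs i k) => y [].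
have s02 b : closed_on U2 (s b) by have [_ s0] := sA b; move=> y i k q [/s0 + _]; exact.
have H k y : U2 y -> lnabla lft k sg y = \sum_b pd k (fun y => c y b) y *: jet h (s b) y.
  by move=> U2y; exact: lnabla_comb oU2 U2B lP _ (fun b y => c y b) s sg k y hc sA2 s02 cP U2y.
have hpc k b : hol U2 (pd k (fun y => c y b)) by exact: hol_pd.
have HH k k' : lnabla lft k (lnabla lft k' sg) x =
    \sum_b pd k (pd k' (fun y => c y b)) x *: jet h (s b) x.
  exact: lnabla_comb oU2 U2B lP _ (fun b => pd k' (fun y => c y b)) s _ k x (hpc k') sA2 s02 (H k') U2x.
rewrite !HH; apply: eq_bigr => b _; congr (_ *: _).
exact: pd_comm oU2 (hc b) U2x.
Qed.

End Lifts.

Lemma powers_injR h : (forall y, B y -> forall i, exists q, pd q (v i) y != 0) ->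
  (forall y j, B y -> (h.+2 <= j)%N -> independent_powers j y) -> injR h.
Proof.
move=> gnz ind y k J By hk JR J0; apply: (symbol_inj (gnz y By) _ JR J0).
by apply: ind; rewrite ?ltnS.
Qed.

End LocalWeb.

(** * Changes of charts *)
Section Geometry.
Variables (R : realType) (n : nat) (M : complexManifold R n).
Notation K := (C R).
Notation V := 'rV[K]_n.
Local Notation jacobian := Defs.jacobian.
Implicit Types (c : chart R n M) (p q : M) (Om : set M) (x y : V).

Definition img c Om : set V := c @` (Om `&` cdom c).

Lemma imgP c Om y : img c Om y -> [/\ Om (cinv c y), cdom c (cinv c y) & c (cinv c y) = y].
Proof. by move=> [p [Op cp] <-]; rewrite chart_cancel. Qed.

Lemma img_mem c Om p : Om p -> cdom c p -> img c Om (c p).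
Proof. by move=> Op cp; exists p. Qed.

Lemma img_open c Om : open Om -> open (img c Om).
Proof.
move=> oOm; rewrite openE => y yi; have [Oy cy ye] := imgP yi.
have yc : (c @` cdom c) y by exists (cinv c y).
have h1 : nbhs y (c @` cdom c) by apply: open_nbhs_nbhs; split => //; exact: chart_open_image.
have h2 : nbhs y (cinv c @^-1` Om).
  by apply: (chart_inv_continuous yc); apply: open_nbhs_nbhs.
apply: filterS (filterI h1 h2) => z [[q cq <-]]; rewrite /preimage /= chart_cancel // => Oq.
exact: img_mem.
Qed.

Lemma preimg_open c (U : set V) : open U -> open (cdom c `&` c @^-1` U).
Proof.
move=> oU; rewrite openE => p [cp Up].
have h1 : nbhs p (cdom c) by apply: open_nbhs_nbhs; split => //; exact: chart_open.
have h2 : nbhs p (c @^-1` U) by apply: (chart_continuous cp); exact: open_nbhs_nbhs.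
exact: filterI h1 h2.
Qed.

Lemma img_sub c Om Om' : Om `<=` Om' -> img c Om `<=` img c Om'.
Proof. by move=> OO _ [p [Op cp] <-]; apply: img_mem => //; exact: OO. Qed.

Lemma img_preimg c (U : set V) : U `<=` c @` cdom c -> img c (cdom c `&` c @^-1` U) = U.
Proof.
move=> Uc; apply/seteqP; split=> [_ [p [[_ Up] _] <-] //|y Uy].
by have [p cp py] := Uc y Uy; exists p => //; split => //; split => //; rewrite /preimage /= py.
Qed.

Lemma hol_transition c1 c2 k : atlas c1 -> atlas c2 ->
  hol (img c1 (cdom c2)) (fun x => c2 (cinv c1 x) 0 k).
Proof.
move=> a1 a2; rewrite holE /img [cdom c2 `&` _]setIC; exact: (atlas_compatible a1 a2).
Qed.

(** The chain rule for a change of charts. *)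
Lemma change_chart c1 c2 Om (f : V -> K) : atlas c1 -> atlas c2 -> open Om ->
  hol (img c2 Om) f ->
  hol (img c1 (Om `&` cdom c2)) (fun x => f (c2 (cinv c1 x))) /\
  forall x l, img c1 (Om `&` cdom c2) x ->
    pd l (fun x => f (c2 (cinv c1 x))) x =
    \sum_k pd k f (c2 (cinv c1 x)) * pd l (fun x => c2 (cinv c1 x) 0 k) x.
Proof.
move=> a1 a2 oOm hf; have oU : open (img c1 (Om `&` cdom c2)).
  by apply: img_open; apply: openI => //; exact: chart_open.
have sub : img c1 (Om `&` cdom c2) `<=` img c1 (cdom c2) by apply: img_sub => p [].
have UV (y : V) : img c1 (Om `&` cdom c2) y -> img c2 Om (c2 (cinv c1 y)).
  by move=> /imgP[[Oy cy] _ _]; exact: img_mem.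
have [h1 h2] := hol_comp oU UV (fun k => hol_sub sub (hol_transition k a1 a2)) hf.
by split => // x l; exact: h2.
Qed.

Lemma jacobianE c1 c2 p k l :
  jacobian c1 c2 p k l = pd l (fun x => c2 (cinv c1 x) 0 k) (c1 p).
Proof. by rewrite mxE pdE. Qed.

Lemma dcoordE c u p l : dcoord c u p 0 l = pd l (fun x => u (cinv c x)) (c p).
Proof. by rewrite mxE pdE. Qed.

Lemma jacobian_id c p : cdom c p -> jacobian c c p = 1%:M.
Proof.
move=> cp; apply/matrixP => k l; rewrite jacobianE [RHS]mxE eq_sym -(p_coord l k (c p)).
have e x : (c @` cdom c) x -> c (cinv c x) 0 k = x 0 k.
  by move=> [q cq <-]; rewrite chart_cancel.
by apply: (pd_ext l (@chart_open_image R n M c) e); exists p.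
Qed.

Lemma jacobian_comp c1 c2 c3 p : atlas c1 -> atlas c2 -> atlas c3 ->
  cdom c1 p -> cdom c2 p -> cdom c3 p ->
  jacobian c1 c3 p = jacobian c2 c3 p *m jacobian c1 c2 p.
Proof.
move=> a1 a2 a3 p1 p2 p3; apply/matrixP => k l; rewrite jacobianE mxE.
have [_ ch] := change_chart a1 a2 (chart_open c3) (hol_transition k a2 a3).
have U1 : img c1 (cdom c3 `&` cdom c2) (c1 p) by exact: img_mem.
have oU1 : open (img c1 (cdom c3 `&` cdom c2)).
  by apply: img_open; apply: openI; exact: chart_open.
have e x : img c1 (cdom c3 `&` cdom c2) x -> c3 (cinv c1 x) 0 k = c3 (cinv c2 (c2 (cinv c1 x))) 0 k.
  by move=> /imgP[[_ x2] _ _]; rewrite chart_cancel.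
rewrite (pd_ext l oU1 e U1) (ch _ l U1) chart_cancel //.
by apply: eq_bigr => j _; congr (_ * _); exact: (esym (jacobianE _ _ _ _ _)).
Qed.

Lemma dcoord_comp c1 c2 Om u p : atlas c1 -> atlas c2 -> open Om -> holomorphicM Om u ->
  Om p -> cdom c1 p -> cdom c2 p -> dcoord c1 u p = dcoord c2 u p *m jacobian c1 c2 p.
Proof.
move=> a1 a2 oOm hu Op p1 p2; apply/rowP => l; rewrite dcoordE mxE.
have hu2 : hol (img c2 Om) (fun x => u (cinv c2 x)) by rewrite holE; exact: hu.
have [_ ch] := change_chart a1 a2 oOm hu2.
have U1 : img c1 (Om `&` cdom c2) (c1 p) by exact: img_mem.
have oU1 : open (img c1 (Om `&` cdom c2)).
  by apply: img_open; apply: openI => //; exact: chart_open.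
have e x : img c1 (Om `&` cdom c2) x -> u (cinv c1 x) = u (cinv c2 (c2 (cinv c1 x))).
  by move=> /imgP[[_ x2] _ _]; rewrite chart_cancel.
rewrite (pd_ext l oU1 e U1) (ch _ l U1) chart_cancel //.
apply: eq_bigr => j _; congr (_ * _); last exact: (esym (jacobianE _ _ _ _ _)).
exact: (esym (dcoordE _ _ _ _)).
Qed.

Lemma proportional (g w : V) (v : 'cV[K]_n) : (forall l q : 'I_n, g 0 q * w 0 l = g 0 l * w 0 q) ->
  (exists q : 'I_n, g 0 q != 0) -> g *m v = 0 -> w *m v = 0.
Proof.
move=> gw [q g0] gv; have -> : w = (w 0 q / g 0 q) *: g.
  by apply/rowP => l; rewrite mxE mulrAC [w 0 q * _]mulrC -gw mulrAC mulfV // mul1r.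
by rewrite -scalemxAl gv scaler0.
Qed.

(** Test on the vectors g_q e_l - g_l e_q, which lie in the kernel of g. *)
Lemma kernel_wedge (g w : V) : (forall v : 'cV[K]_n, g *m v = 0 -> w *m v = 0) ->
  forall l q : 'I_n, g 0 q * w 0 l = g 0 l * w 0 q.
Proof.
move=> H l q; pose v : 'cV[K]_n := g 0 q *: delta_mx l 0 - g 0 l *: delta_mx q 0.
have vE (u : V) : (u *m v) 0 0 = g 0 q * u 0 l - g 0 l * u 0 q.
  rewrite /v mulmxBr -!scalemxAr -!colE !mxE //.
have gv : g *m v = 0 by apply/matrixP => i j; rewrite !ord1 vE mxE mulrC subrr.
by have := vE w; rewrite (H v gv) mxE => /esym/eqP; rewrite subr_eq0 => /eqP.
Qed.

End Geometry.

(** * Extension of forms from one chart to the others *)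
Section Extension.
Variables (R : realType) (n d : nat) (M : complexManifold R n) (W : web M d).
Notation K := (C R).
Notation V := 'rV[K]_n.
Local Notation jacobian := Defs.jacobian.
Implicit Types (p q : M) (Om : set M) (x y : V).

(** A tuple of forms given in one chart, transported to all the others. *)
Definition ext (c : chart R n M) (t : V -> 'M[K]_(d, n)) : forms M d :=
  fun c' x => t (c (cinv c' x)) *m jacobian c' c (cinv c' x).

Lemma conormal_trans (F : foliation M) c c' p w : atlas c -> atlas c' ->
  cdom c p -> cdom c' p -> conormal F c p w -> conormal F c' p (w *m jacobian c' c p).
Proof.
move=> a a' cp cp' wF v [U [u [Fu Up uv]]]; rewrite -mulmxA; apply: wF.
exists U, u; split => //; rewrite mulmxA -(dcoord_comp a' a _ _ Up) //.
  by have [] := fol_holomorphic Fu.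
by have [] := fol_holomorphic Fu.
Qed.

Variables (c : chart R n M) (U : set V) (t : V -> 'M[K]_(d, n)).
Hypotheses (ac : atlas c) (oU : open U) (Uc : U `<=` c @` cdom c).
Hypothesis ht : forall i l, hol U (fun x => t x i l).

Let Om := cdom c `&` c @^-1` U.

Lemma ext_id x : U x -> ext c t c x = t x.
Proof.
by move=> /Uc [p cp <-]; rewrite /ext chart_cancel // jacobian_id // mulmx1.
Qed.

Let phi c' k : V -> K := fun x => c (cinv c' x) 0 k.

Lemma ext_entry c' x i l : img c' Om x ->
  ext c t c' x i l = \sum_k t (c (cinv c' x)) i k * pd l (phi c' k) x.
Proof.
move=> /imgP[_ _ xE]; rewrite mxE; apply: eq_bigr => k _; congr (_ * _).
by apply: etrans (jacobianE _ _ _ _ _) _; rewrite xE.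
Qed.

Lemma open_dom : open Om. Proof. exact: preimg_open. Qed.

Lemma open_img c' : open (img c' Om). Proof. exact: img_open open_dom. Qed.

Lemma hol_phi c' k : atlas c' -> hol (img c' Om) (phi c' k).
Proof.
by move=> ac'; apply: hol_sub (hol_transition k ac' ac); apply: img_sub => p [].
Qed.

Lemma pullback c' (f : V -> K) : atlas c' -> hol U f ->
  hol (img c' Om) (fun x => f (c (cinv c' x))) /\
  forall x l, img c' Om x -> pd l (fun x => f (c (cinv c' x))) x =
    \sum_k pd k f (c (cinv c' x)) * pd l (phi c' k) x.
Proof.
move=> ac' hf; have hf' : hol (img c Om) f by rewrite img_preimg.
have := change_chart ac' ac open_dom hf'.
by have -> : Om `&` cdom c = Om by apply/seteqP; split=> p [] // [].
Qed.

Lemma hol_ext_forms c' i l : atlas c' -> hol (img c' Om) (fun x => ext c t c' x i l).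
Proof.
move=> ac'; have oI : open (img c' Om) by exact: open_img.
apply: (hol_ext oI (f := fun x => \sum_k t (c (cinv c' x)) i k * pd l (phi c' k) x)).
  by move=> x xO; rewrite ext_entry.
apply: (hol_sum _ oI) => k _; apply: (holM oI).
  by have [] := pullback ac' (ht i k).
exact: hol_pd oI (hol_phi k ac').
Qed.

(** The pullback of a closed form is closed: the second derivatives of the change of charts
   cancel, and the rest is contracted with the exterior derivative. *)
Lemma ext_closed c' x i l m : atlas c' -> img c' Om x ->
  (forall y i l m, U y -> dform t i l m y = 0) -> dform (ext c t c') i l m x = 0.
Proof.
move=> ac' xO t0; have oI : open (img c' Om) by exact: open_img.
have H l' m' : partial l' (fun y => ext c t c' y i m') x =
    \sum_k \sum_j pd j (fun y => t y i k) (c (cinv c' x)) * pd l' (phi c' j) x * pd m' (phi c' k) x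
    + \sum_k t (c (cinv c' x)) i k * pd l' (pd m' (phi c' k)) x.
  rewrite -pdE (pd_ext l' oI (fun y yO => ext_entry i m' yO) xO).
  have hp k : hol (img c' Om) (pd m' (phi c' k)) by exact: hol_pd oI (hol_phi k ac').
  have hq k : hol (img c' Om) (fun y => t (c (cinv c' y)) i k) by have [] := pullback ac' (ht i k).
  rewrite (p_sum _ _ oI (fun k _ => holM oI (hq k) (hp k)) xO) -big_split.
  apply: eq_bigr => k _.
  rewrite pM; [|exact: (hol_diff (hq k) xO)|exact: (hol_diff (hp k) xO)].
  congr (_ + _); have [_ ->] := pullback ac' (ht i k) => //.
  by rewrite mulr_suml.
rewrite /dform !H opprD addrACA.
have -> : \sum_k t (c (cinv c' x)) i k * pd l (pd m (phi c' k)) x =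
    \sum_k t (c (cinv c' x)) i k * pd m (pd l (phi c' k)) x.
  apply: eq_bigr => k _; congr (_ * _); exact: pd_comm oI (hol_phi k ac') xO.
rewrite subrr addr0 [X in _ - X]exchange_big -sumrB big1 // => k _.
rewrite -sumrB big1 // => j _.
have Uy : U (c (cinv c' x)) by have [[]] := imgP xO.
have /eqP := t0 _ i j k Uy; rewrite /dform -pdE subr_eq0 => /eqP ->.
by rewrite mulrAC subrr.
Qed.

Lemma ext_sectionA :
  (forall p, Om p -> forall i, conormal (W i) c p (row i (t (c p)))) ->
  (forall p, Om p -> \sum_i row i (t (c p)) = 0) -> sectionA W Om (ext c t).
Proof.
move=> tW tS; split.
- by move=> c' ac' i l; rewrite -holE; exact: hol_ext_forms.
- move=> c1 c2 p a1 a2 [cp Up] p1 p2; rewrite /ext (chart_cancel p1) (chart_cancel p2).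
  apply: etrans (congr1 (mulmx (t (c p))) (jacobian_comp a1 a2 ac p1 p2 cp)) _.
  exact: mulmxA.
- move=> c' p ac' Op cp' i; rewrite /ext (chart_cancel cp') row_mul.
  apply: conormal_trans => //; [by case: Op|exact: tW].
- move=> c' p ac' Op cp'; rewrite /ext (chart_cancel cp').
  under eq_bigr => i _ do rewrite row_mul.
  by rewrite -mulmx_suml tS // mul0mx.
Qed.

End Extension.

(** * Local models at the points of the manifold *)
Section LocalModel.
Variables (R : realType) (n d : nat) (M : complexManifold R n) (W : web M d).
Notation K := (C R).
Notation V := 'rV[K]_n.
Implicit Types (p q : M) (Om : set M) (x y : V).

Lemma prod_wordof (L : mindex n) (F : 'I_n -> K) :
  \prod_(l <- wordof L) F l = \prod_l F l ^+ L l.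
Proof.
rewrite /wordof big_flatten /= big_map big_enum /=; apply: eq_bigr => l _.
by rewrite big_nseq iter_mulr_1.
Qed.

(** Maximal rank of the matrix of an ordinary web means independent columns as soon as it
   has at least d rows. *)
Lemma ordinary_powers c p (U : 'I_d -> set M) u j : ordinary W -> atlas c -> cdom c p ->
  (forall i, first_integral (W i) (U i) (u i) /\ U i p) -> (0 < j)%N -> (d <= cnum n j)%N ->
  independent_powers (fun i x => u i (cinv c x)) j (c p).
Proof.
move=> oW ac cp Uu j0 dj a aw i.
have := oW j j0 c p ac cp U u Uu; rewrite (minn_idPl dj) => rk.
have rf : row_free (Pmatrix j c u p)^T by rewrite /row_free mxrank_tr rk.
suff /rowP /(_ i) : (\row_i a i) = 0 :> 'M[K]_(1, d) by rewrite !mxE.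
apply/eqP; rewrite -(mulmx_free_eq0 _ rf); apply/eqP/rowP => k.
pose L : mindex n := [ffun l => val (val (enum_val k : hindex n j) l)].
have Lj : size (wordof L) = j.
  rewrite size_wordof /mdeg; have /eqP kj := valP (enum_val k : hindex n j); rewrite -[RHS]kj.
  by apply: eq_bigr => l _; rewrite ffunE.
rewrite !mxE -[RHS](aw (wordof L) Lj); apply: eq_bigr => i' _.
rewrite !mxE prod_wordof; congr (_ * _); apply: eq_bigr => l _.
by rewrite ffunE dcoordE.
Qed.

(** Choose first integrals at p: they serve at all the points near p, and by compatibility
   they compute the conormal lines whatever the other first integrals there. *)
Lemma local_model c p : ordinary W -> atlas c -> cdom c p -> exists B v,
  [/\ open B, B (c p), B `<=` c @` cdom c & forall i : 'I_d, hol B (v i)] /\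
  [/\ forall y, B y -> forall i, exists l, pd l (v i) y != 0,
      forall y, B y -> exists f : 'I_n -> 'I_d, (\matrix_(k, l) pd l (v (f k)) y) \in unitmx,
      forall y j, B y -> (0 < j)%N -> (d <= cnum n j)%N -> independent_powers v j y
    & forall y i w, B y -> conormal (W i) c (cinv c y) w <->
        forall l m : 'I_n, pd m (v i) y * w 0 l = pd l (v i) y * w 0 m].
Proof.
move=> oW ac cp.
have /choice [Uu UuP] : forall i : 'I_d, exists Uu : set M * (M -> K),
    first_integral (W i) Uu.1 Uu.2 /\ Uu.1 p.
  by move=> i; have [U [u ?]] := fol_cover (W i) p; exists (U, u).
pose Om0 := [set q | forall i, (Uu i).1 q].
have oUi i : open (Uu i).1 by have [/fol_holomorphic []] := UuP i.
have oOm0 : open Om0.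
  by rewrite openE => q Oq; apply: filter_forall => i; apply: open_nbhs_nbhs.
pose v i x := (Uu i).2 (cinv c x).
have Om0p : Om0 p by move=> i; have [] := UuP i.
have dv i q l : cdom c q -> dcoord c (Uu i).2 q 0 l = pd l (v i) (c q).
  by move=> cq; rewrite dcoordE.
have gnz q : Om0 q -> cdom c q -> forall i, exists l, pd l (v i) (c q) != 0.
  move=> Oq cq i; have [Fu _] := UuP i; apply: contrapT => H.
  move/eqP: (fol_regular Fu ac cq (Oq i)); apply; apply/rowP => l; rewrite dv // [RHS]mxE.
  by apply: contrapT => /eqP H'; apply: H; exists l.
exists (img c Om0), v; split; split.
- exact: img_open.
- exact: img_mem.
- by move=> y [q [_ cq] <-]; exists q.
- move=> i; have [Fu _] := UuP i; have [_ hu] := fol_holomorphic Fu.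
  have h1 : hol (img c (Uu i).1) (v i) by rewrite holE; exact: hu.
  by apply: hol_sub h1; apply: img_sub => q; exact.
- by move=> _ [q [Oq cq] <-]; exact: gnz.
- move=> _ [q [Oq cq] <-]; have [f [_ fP]] := web_weak_general_position W q.
  exists f; rewrite -unitmx_tr -row_free_unit; apply: inj_row_free => w wN.
  apply: (can_inj (@trmxK _ _ _)); rewrite trmx0; apply: (fP c ac cq) => k.
  exists (Uu (f k)).1, (Uu (f k)).2; split; [by have [] := UuP (f k)|exact: Oq|].
  apply/matrixP => i j; rewrite !ord1 [RHS]mxE.
  have := congr1 (fun N : 'M[K]_(1, n) => N 0 k) wN; rewrite !mxE => H; rewrite -[RHS]H.
  by apply: eq_bigr => l _; rewrite dv // !mxE mulrC.
- move=> _ j [q [Oq cq] <-] j0 dj.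
  apply: (@ordinary_powers c q (fun i => (Uu i).1) (fun i => (Uu i).2)) => // i.
  by split=> //; have [] := UuP i.
- move=> _ i w [q [Oq cq] <-]; rewrite chart_cancel //; have [Fu _] := UuP i.
  have gE l : dcoord c (Uu i).2 q 0 l = pd l (v i) (c q) by exact: dv.
  split=> [wF l l'|H z [U' [u' [Fu' U'q u'z]]]].
    rewrite -!gE; apply: kernel_wedge => z uz; apply: wF.
    by exists (Uu i).1, (Uu i).2; split.
  apply: (@proportional _ _ (dcoord c (Uu i).2 q)).
  + by move=> l l'; rewrite !gE.
  + by have [l lP] := gnz q Oq cq i; exists l; rewrite gE.
  + by have [H1 _] := fol_compatible Fu' Fu ac cq U'q (Oq i) z; exact: H1 u'z.
Qed.

Section Model.
Variables (c : chart R n M) (B : set V) (v : 'I_d -> V -> K).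
Hypotheses (ac : atlas c) (oB : open B) (Bc : B `<=` c @` cdom c) (hv : forall i, hol B (v i)).
Hypothesis gnz : forall y, B y -> forall i, exists l, pd l (v i) y != 0.
Hypothesis gp : forall y, B y ->
  exists f : 'I_n -> 'I_d, (\matrix_(k, l) pd l (v (f k)) y) \in unitmx.
Hypothesis conormalP : forall y i w, B y -> conormal (W i) c (cinv c y) w <->
  forall l m : 'I_n, pd m (v i) y * w 0 l = pd l (v i) y * w 0 m.

Lemma section_locA Om s : sectionA W Om s -> locA v (B `&` img c Om) (s c).
Proof.
move=> [sh st sW sS]; split=> [i l|y [By yO]].
  have h1 : hol (img c Om) (fun y => s c y i l) by rewrite holE; exact: sh.
  by apply: hol_sub h1 => y [].
have [Oy cy yE] := imgP yO; split=> [i l q|l].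
  have := sW c (cinv c y) ac Oy cy i; rewrite yE => /(conormalP i _ By) /(_ l q).
  by rewrite !mxE.
have := congr1 (fun w : V => w 0 l) (sS c (cinv c y) ac Oy cy); rewrite yE summxE mxE => H.
by rewrite -[RHS]H; apply: eq_bigr => i _; rewrite mxE.
Qed.

Lemma locA_section U t : open U -> U `<=` B -> locA v U t ->
  sectionA W (cdom c `&` c @^-1` U) (ext c t).
Proof.
move=> oU UB [ht tA]; have Uc : U `<=` c @` cdom c by move=> y /UB /Bc.
apply: (ext_sectionA ac oU Uc ht) => p [cp Up]; have [tw ts] := tA _ Up.
  move=> i; rewrite -{1}(chart_cancel cp); apply/(conormalP i _ (UB _ Up)) => l q.
  by rewrite !mxE.
apply/rowP => l; rewrite summxE mxE -[RHS](ts l).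
by apply: eq_bigr => i _; rewrite mxE.
Qed.

Lemma jet_ext h U (t : V -> 'M[K]_(d, n)) y : open U -> U `<=` B -> U y -> jet h (ext c t c) y = jet h t y.
Proof.
move=> oU UB Uy; have Uc : U `<=` c @` cdom c by move=> z /UB /Bc.
apply/funext => L; rewrite /jet; case: leqP => // _; apply/matrixP => i l; rewrite !mxE.
by apply: (pderiv_ext oU _ _ Uy) => z Uz; rewrite (ext_id t Uc).
Qed.

Lemma Rfiber_eqR h y : B y -> Rfiber W h c y = eqR v h y.
Proof.
move=> By; apply/seteqP; split=> [J [Om [s [oOm Oy sA -> s0]]]|J JR].
  have [q cq qy] := Bc By; have yO : img c Om y.
    by rewrite -qy; apply: img_mem => //; move: Oy; rewrite -qy chart_cancel.
  have oU : open (B `&` img c Om) by apply: openI => //; exact: img_open.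
  apply: (jet_eqR hv oU _ _ (section_locA sA)) => //; by move=> z [].
have [U [t [oU Uy UB tA tJ]]] := realize oB hv By (gnz By) (gp By) JR.
have Uc : U `<=` c @` cdom c by move=> z /UB /Bc.
exists (cdom c `&` c @^-1` U), (ext c t); split.
- exact: preimg_open.
- by have [q cq qy] := Uc _ Uy; rewrite -qy chart_cancel //; split => //; rewrite /preimage /= qy.
- exact: locA_section.
- by rewrite (jet_ext h t oU UB Uy).
- move=> L Lh i l m.
  have et z i' l' : U z -> ext c t c z i' l' = t z i' l' by move=> Uz; rewrite (ext_id t Uc).
  have e z : U z -> dform (ext c t c) i l m z = dform t i l m z.
    move=> Uz; rewrite /dform -!pdE; congr (_ - _).
      exact: (pd_ext l oU (fun z => et z i m) Uz).
    exact: (pd_ext m oU (fun z => et z i l) Uz).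
  rewrite (pderiv_ext oU L e Uy) (pderiv_dform i l m L oU Uy); last by have [] := tA.
  have [_ _ _ Jc] := JR; have := Jc L i l m Lh; rewrite -tJ /jet !mdeg_mincr Lh !mxE => ->.
  by rewrite subrr.
Qed.

End Model.
End LocalModel.

(** * Germs of abelian relations *)
Section Germs.
Variables (R : realType) (n d : nat) (M : complexManifold R n) (W : web M d).
Notation K := (C R).
Notation V := 'rV[K]_n.
Implicit Types (c : chart R n M) (p q : M) (Om : set M) (x y : V) (s : forms M d).

Lemma sectionA_hol Om s c i l : sectionA W Om s -> atlas c -> hol (img c Om) (fun x => s c x i l).
Proof. by move=> [sh _ _ _] ac; rewrite holE; exact: sh. Qed.

Lemma sectionA_lin Om Om' a s s' : open Om -> open Om' -> sectionA W Om s -> sectionA W Om' s' ->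
  sectionA W (Om `&` Om') (a *: s + s').
Proof.
move=> oO oO' sA sA'; have [sh st sW sS] := sA; have [sh' st' sW' sS'] := sA'; split.
- move=> c ac i l; rewrite -holE -/(img c _); have oI : open (img c (Om `&` Om')).
    by apply: img_open; exact: openI.
  apply: (hol_ext oI (f := fun x => a * s c x i l + s' c x i l)).
    by move=> x _; rewrite !mxE.
  apply: (holD oI).
    apply: (holM oI (@hol_cst _ _ _ a)); apply: hol_sub (sectionA_hol i l sA ac).
    by apply: img_sub => q [].
  by apply: hol_sub (sectionA_hol i l sA' ac); apply: img_sub => q [].
- move=> c c' p ac ac' [Op O'p] cp cp'.
  rewrite -[LHS]/(a *: s c (c p) + s' c (c p)) (st c c' p) // (st' c c' p) //.
  by rewrite -[(_ + _) c' _]/(a *: s c' (c' p) + s' c' (c' p)) mulmxDl scalemxAl.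
- move=> c p ac [Op O'p] cp i v vT.
  rewrite -[(_ + _) c _]/(a *: s c (c p) + s' c (c p)).
  have -> : row i (a *: s c (c p) + s' c (c p)) = a *: row i (s c (c p)) + row i (s' c (c p)).
    by apply/rowP => l; rewrite !mxE.
  by rewrite mulmxDl -scalemxAl (sW c p ac Op cp i v vT) (sW' c p ac O'p cp i v vT) scaler0 addr0.
- move=> c p ac [Op O'p] cp; rewrite -[(_ + _) c _]/(a *: s c (c p) + s' c (c p)).
  transitivity (a *: (\sum_i row i (s c (c p))) + \sum_i row i (s' c (c p))).
    by rewrite scaler_sumr -big_split; apply: eq_bigr => i _; apply/rowP => l; rewrite !mxE.
  by rewrite sS // sS' // scaler0 addr0.
Qed.

Lemma relation_lin p a s s' : abelian_relations_near W p s -> abelian_relations_near W p s' ->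
  abelian_relations_near W p (a *: s + s').
Proof.
move=> [Om [oO Op [sA s0]]] [Om' [oO' O'p [sA' s0']]].
exists (Om `&` Om'); split => //; [exact: openI|split; first exact: sectionA_lin].
move=> c q ac [Oq O'q] cq i l m.
have H i' l' m' : pd m' (fun y => (a *: s + s') c y i' l') (c q) =
    a * pd m' (fun y => s c y i' l') (c q) + pd m' (fun y => s' c y i' l') (c q).
  have oI : open (img c (Om `&` Om')) by apply: img_open; exact: openI.
  have xI : img c (Om `&` Om') (c q) by exact: img_mem.
  have hs : hol (img c (Om `&` Om')) (fun y => s c y i' l').
    by apply: hol_sub (sectionA_hol i' l' sA ac); apply: img_sub => z [].
  have hs' : hol (img c (Om `&` Om')) (fun y => s' c y i' l').
    by apply: hol_sub (sectionA_hol i' l' sA' ac); apply: img_sub => z [].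
  have e y : img c (Om `&` Om') y -> (a *: s + s') c y i' l' = a * s c y i' l' + s' c y i' l'.
    by move=> _; rewrite !mxE.
  rewrite (pd_ext m' oI e xI) pD; first by rewrite (p_scale a m' hs xI).
    exact: (hol_diff (holM oI (@hol_cst _ _ _ a) hs) xI).
  exact: (hol_diff hs' xI).
have e1 := s0 c q ac Oq cq i l m; have e2 := s0' c q ac O'q cq i l m.
move: e1 e2; rewrite /dform -!pdE !H => e1 e2.
by rewrite opprD addrACA e2 addr0 -mulrBr e1 mulr0.
Qed.

Lemma relation0 p : abelian_relations_near W p 0.
Proof.
exists setT; split => //; first exact: openT; split.
  split.
  - move=> c ac i l; rewrite -holE.
    have -> : (fun x => (0 : forms M d) c x i l) = fun=> 0 by apply/funext => x; rewrite mxE.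
    exact: hol_cst.
  - by move=> c c' q _ _ _ _ _; rewrite -[(0 : forms M d) c' _]/(0 : 'M[K]_(d, n)) mul0mx.
  - move=> c q _ _ _ i v _; rewrite -[(0 : forms M d) c _]/(0 : 'M[K]_(d, n)) row0 mul0mx //.
  - move=> c q _ _ _; rewrite -[(0 : forms M d) c _]/(0 : 'M[K]_(d, n)).
    by rewrite big1 // => i _; exact: row0.
move=> c q _ _ _ i l m; rewrite /dform -!pdE.
have H i' l' : (fun y => (0 : forms M d) c y i' l') = fun=> 0 by apply/funext => y; rewrite mxE.
by rewrite !H !p_cst subrr.
Qed.

Lemma jet_lin h U (t t' : V -> 'M[K]_(d, n)) a x : open U -> U x ->
  (forall i l, hol U (fun y => t y i l)) -> (forall i l, hol U (fun y => t' y i l)) ->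
  jet h (a *: t + t') x = a *: jet h t x + jet h t' x.
Proof.
move=> oU Ux ht ht'; apply: jetP => L i l; rewrite !mxE /jet; case: leqP => _; last first.
  by rewrite !mxE mulr0 addr0.
rewrite !mxE !pderiv_wordof.
have e y : U y -> (a *: t + t') y i l = a * t y i l + t' y i l by rewrite !mxE.
rewrite (wderiv_ext oU (wordof L) e Ux) (wderivD oU _ (holM oU (@hol_cst _ _ _ a) (ht i l)) (ht' i l) Ux).
by rewrite (wderiv_scale oU _ _ (ht i l) Ux).
Qed.

Lemma relation_jet_lin h c p a s s' : atlas c -> cdom c p ->
  abelian_relations_near W p s -> abelian_relations_near W p s' ->
  jet h ((a *: s + s') c) (c p) = a *: jet h (s c) (c p) + jet h (s' c) (c p).
Proof.
move=> ac cp [Om [oO Op [sA s0]]] [Om' [oO' O'p [sA' s0']]].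
have oI : open (img c (Om `&` Om')) by apply: img_open; exact: openI.
apply: (jet_lin h a oI) => [|i l|i l]; first exact: img_mem.
  by apply: hol_sub (sectionA_hol i l sA ac); apply: img_sub => z [].
by apply: hol_sub (sectionA_hol i l sA' ac); apply: img_sub => z [].
Qed.

Lemma jet0 h (t : V -> 'M[K]_(d, n)) U x : open U -> U x -> (forall y, U y -> t y = 0) ->
  jet h t x = 0.
Proof.
move=> oU Ux t0; apply: jetP => L i l; rewrite mxE /jet; case: leqP => _; rewrite ?mxE //.
rewrite pderiv_wordof -[RHS](wderiv0 (wordof L) x); apply: (wderiv_ext oU) => // y Uy.
by rewrite t0 // mxE.
Qed.

Lemma relation_sum h c p r (a : 'I_r -> K) (e : 'I_r -> forms M d) : atlas c -> cdom c p ->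
  (forall k, abelian_relations_near W p (e k)) ->
  abelian_relations_near W p (\sum_k a k *: e k) /\
  jet h ((\sum_k a k *: e k) c) (c p) = \sum_k a k *: jet h (e k c) (c p).
Proof.
move=> ac cp eR; elim/big_rec2: _ => [|k s J _ [IH <-]].
  split; first exact: relation0.
  apply: (@jet0 _ _ setT) => //; exact: openT.
split; first exact: (relation_lin (a k) (eR k) IH).
by rewrite (relation_jet_lin h (a k) ac cp (eR k) IH).
Qed.

End Germs.

(** * Ranks, parallel jets and curvature on the manifold *)
Section Models.
Variables (R : realType) (n d h0 : nat) (M : complexManifold R n) (W : web M d) (rho : nat -> nat).
Notation K := (C R).
Notation V := 'rV[K]_n.
Local Notation jetT := (Defs.jetT R n d).
Implicit Types (c : chart R n M) (p q : M) (Om : set M) (x y : V) (s : forms M d).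
Hypothesis h0_def : (cnum n h0.-1 < d <= cnum n h0)%N.
Hypothesis W_ordinary : ordinary W.
Hypothesis R_bundles : forall h, (h0 - 2 <= h)%N -> R_bundle W h (rho h).

Lemma cnum_leq j : (h0 <= j)%N -> (d <= cnum n j)%N.
Proof.
move=> hj; have /andP[_ dh] := h0_def; apply: leq_trans dh _.
have E k : cnum n k = 'C(n.-1 + k, n.-1) by rewrite /cnum -bin_sub ?leq_addl // addnK.
by rewrite !E leq_bin2l // leq_add2l.
Qed.

(** Near a point of a chart, the fibers of R_h are given by equations with
   holomorphic coefficients, in terms of local first integrals. *)
Definition model c (B : set V) (v : 'I_d -> V -> K) :=
  [/\ open B, B `<=` c @` cdom c & forall i, hol B (v i)] /\
  [/\ forall h y, B y -> Rfiber W h c y = eqR v h y,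
      forall Om s, sectionA W Om s -> locA v (B `&` img c Om) (s c),
      forall U t, open U -> U `<=` B -> locA v U t -> sectionA W (cdom c `&` c @^-1` U) (ext c t),
      forall h, (h0 - 2 <= h)%N -> injR B v h
    & forall h y, (h0 - 2 <= h)%N -> B y ->
        exists U (e : 'I_(rho h) -> V -> jetT), [/\ open U, U y, U `<=` B & frame v h U e]].

Lemma model_ex c p : atlas c -> cdom c p -> exists B v, B (c p) /\ model c B v.
Proof.
move=> ac cp; have [B [v [[oB Bp Bc hv] [gnz gp ind cP]]]] := local_model W_ordinary ac cp.
have RE h y (By : B y) := Rfiber_eqR ac oB Bc hv gnz gp cP h By.
exists B, v; split; [exact: Bp|split; [by split|split; first exact: RE]].
- by move=> Om s; exact: section_locA.
- by move=> U t; exact: locA_section.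
- move=> h hh; apply: powers_injR => // y j By hj; apply: ind => //.
    exact: leq_ltn_trans hj.
  by apply: cnum_leq; apply: leq_trans hj; rewrite -[h.+2]addn2 addnC -leq_subLR.
- move=> h y hh By; have [q cq qy] := Bc y By.
  have [U [oU Uq Uc [e [he eb]]]] := R_bundles hh ac cq.
  exists (U `&` B), e; split.
  + exact: openI.
  + by split=> //; rewrite -qy.
  + by move=> z [].
  + split=> [b L i l|z [Uz Bz]]; last by rewrite -RE //; exact: eb.
    have h1 : hol U (fun z => e b z L i l) by rewrite holE; exact: he.
    by apply: hol_sub h1 => z [].
Qed.

Section InModel.
Variables (c : chart R n M) (B : set V) (v : 'I_d -> V -> K).
Hypotheses (ac : atlas c) (mB : model c B v).

Let oB : open B. Proof. by have [[]] := mB. Qed.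
Let hv i : hol B (v i). Proof. by have [[]] := mB. Qed.
Let Bc : B `<=` c @` cdom c. Proof. by have [[]] := mB. Qed.
Let RE h y : B y -> Rfiber W h c y = eqR v h y. Proof. by have [_ [H _ _ _ _]] := mB; exact: H. Qed.
Let sL Om s : sectionA W Om s -> locA v (B `&` img c Om) (s c).
Proof. by have [_ [_ H _ _ _]] := mB; exact: H. Qed.
Let inj h : (h0 - 2 <= h)%N -> injR B v h. Proof. by have [_ [_ _ _ H _]] := mB; exact: H. Qed.

Lemma model_basis h y : (h0 - 2 <= h)%N -> B y ->
  exists e : 'I_(rho h) -> jetT, basis_mod (eqR v h y) [set 0] e.
Proof.
move=> hh By; have [_ [_ _ _ _ /(_ h y hh By) [U [e [oU Uy UB [_ eb]]]]]] := mB.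
by exists (e ^~ y); exact: eb.
Qed.

Lemma rank_anti h y : (h0 - 2 <= h)%N -> B y -> (rho h.+1 <= rho h)%N.
Proof.
move=> hh By; have [e /basis_mod0P[_ _ es]] := model_basis hh By.
have [f /basis_mod0P[fR fi _]] := model_basis (leqW hh) By.
apply: (indep_card es (f := fun b => trunc h (f b))) => [b|a].
  exact: eqR_trunc (leqnSn h) (fR b).
rewrite -trunc_comb => a0; apply: fi.
exact: (inj_trunc (inj hh) By (leqnSn h) (eqR_comb a fR) a0).
Qed.

Lemma trunc_surj h y J : (h0 - 2 <= h)%N -> rho h = rho h.+1 -> B y -> eqR v h y J ->
  exists J', eqR v h.+1 y J' /\ trunc h J' = J.
Proof.
move=> hh rr By JR; have [e eb] := model_basis hh By; have := model_basis (leqW hh) By.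
rewrite -rr => -[f fb].
have /basis_mod0P[_ _ /(_ J JR) [a ->]] := trunc_basis (inj hh) By (leqnSn h) eb fb.
have /basis_mod0P[fR _ _] := fb.
by exists (\sum_b a b *: f b); split; [exact: eqR_comb|exact: trunc_comb].
Qed.

Lemma trunc_bij h y : (h0 - 2 <= h)%N -> rho h = rho h.+1 -> B y ->
  set_bij (Rfiber W h.+1 c y) (Rfiber W h c y) (@trunc R n d h).
Proof.
move=> hh rr By; rewrite !RE //; split.
- by move=> J JR; exact: eqR_trunc (leqnSn h) JR.
- move=> J J'; rewrite !inE => JR J'R.
  exact: (trunc_inj (inj hh) By (leqnSn h) JR J'R).
- by move=> J /(trunc_surj hh rr By) [J' [J'R <-]]; exists J'.
Qed.

Lemma vliftP h y J : (h0 - 2 <= h)%N -> rho h = rho h.+1 -> B y -> eqR v h y J ->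
  eqR v h.+1 y (vlift W h c y J) /\ trunc h (vlift W h c y J) = J.
Proof.
move=> hh rr By JR; have [J' [J'R J'J]] := trunc_surj hh rr By JR.
have : [set J' | Rfiber W h.+1 c y J' /\ trunc h J' = J] (vlift W h c y J).
  by apply: xgetPex; exists J'; rewrite /= RE.
by rewrite /= RE.
Qed.

Lemma closed_locA Om s : open Om -> abelian_relation W Om s ->
  [/\ open (B `&` img c Om), B `&` img c Om `<=` B, locA v (B `&` img c Om) (s c)
    & closed_on (B `&` img c Om) (s c)].
Proof.
move=> oO [sA s0]; split.
- by apply: openI => //; exact: img_open.
- by move=> y [].
- exact: sL.
- by move=> y i l m [_ [q [Oq cq] <-]]; exact: s0.
Qed.

Lemma relation_parallel h Om s p : (h0 - 2 <= h)%N -> rho h = rho h.+1 -> open Om ->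
  Om p -> cdom c p -> B (c p) -> abelian_relation W Om s ->
  Rfiber W h c (c p) (jet h (s c) (c p)) /\ forall l, nabla W h c l (jet h (s c)) (c p) = 0.
Proof.
move=> hh rr oO Op cp Bp sR; have [oU UB sL' s0] := closed_locA oO sR.
have Up : (B `&` img c Om) (c p) by split => //; exact: img_mem.
split; first by rewrite RE //; exact: (closed_eqR hv h oU UB Up sL' s0).
move=> l; apply: (closed_lnabla hv (inj hh) oU UB _ l sL' s0 Up).
by move=> y J /UB By; exact: vliftP.
Qed.

Lemma parallel_closed h Om s p : (h0 - 2 <= h)%N -> rho h = rho h.+1 -> open Om ->
  Om p -> cdom c p -> B (c p) -> sectionA W Om s -> section_of_R W h Om s ->
  parallel_jet W h Om s -> forall i l m, dform (s c) i l m (c p) = 0.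
Proof.
move=> hh rr oO Op cp Bp sA sR sP.
have oU : open (B `&` img c Om) by apply: openI => //; exact: img_open.
have Up : (B `&` img c Om) (c p) by split => //; exact: img_mem.
apply: (lnabla_closed oU _ (sL sA) _ Up (sP c p ac Op cp)).
  by move=> y J [By _]; exact: vliftP.
by move=> y [By [q [Oq cq] qy]]; rewrite -RE // -qy; exact: sR.
Qed.

(** The germ vanishes near p in the chart c, hence in all the charts by the transition
   rule. *)
Lemma relation_jet_inj h p s : (h0 - 2 <= h)%N -> cdom c p -> B (c p) ->
  abelian_relations_near W p s -> jet h (s c) (c p) = 0 -> zero_germ p s.
Proof.
move=> hh cp Bp [Om [oO Op sR]] j0; have [oU UB sL' s0] := closed_locA oO sR.
have Up : (B `&` img c Om) (c p) by split => //; exact: img_mem.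
have [r r0 rP] := closed_zero hv (inj hh) oU UB Up sL' s0 j0.
exists (cdom c `&` c @^-1` [set y : V | `|y - c p| < r]); split.
- by apply: preimg_open; exact: open_ballP.
- by split=> //; rewrite /preimage /= subrr normr0.
- move=> c' q ac' [cq /rP [[_ /imgP[Oq _ _]] sq]] c'q.
  have [[_ st _ _] _] := sR; rewrite (st c' c q ac' ac) ?sq ?mul0mx //.
  by move: Oq; rewrite chart_cancel.
Qed.

Lemma relation_Rfiber h p s : cdom c p -> B (c p) -> abelian_relations_near W p s ->
  eqR v h (c p) (jet h (s c) (c p)).
Proof.
move=> cp Bp [Om [oO Op sR]]; have [oU UB sL' s0] := closed_locA oO sR.
have Up : (B `&` img c Om) (c p) by split => //; exact: img_mem.
exact: (closed_eqR hv h oU UB Up sL' s0).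
Qed.

Section Stable.
Variable h1 : nat.
Hypotheses (hh1 : (h0 - 2 <= h1)%N) (stable : forall k, (h1 <= k)%N -> rho k = rho h1).

Lemma stable_frames k y : (h1 <= k)%N -> B y ->
  exists U (f : 'I_(rho h1) -> V -> jetT), [/\ open U, U y, U `<=` B & frame v k U f].
Proof.
move=> hk By; have [_ [_ _ _ _ H]] := mB.
by have := H k y (leq_trans hh1 hk) By; rewrite stable.
Qed.

(** The closed section with jet J near the point, transported to all charts. *)
Lemma relation_ex p J : cdom c p -> B (c p) -> eqR v h1 (c p) J ->
  exists s, abelian_relations_near W p s /\ jet h1 (s c) (c p) = J.
Proof.
move=> cp Bp JR.
have [U [t [oU Up UB [tL t0] <-]]] := realize_closed oB hv (inj hh1) stable_frames Bp JR.
have Uc : U `<=` c @` cdom c by move=> y /UB /Bc.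
exists (ext c t); split; last exact: (jet_ext Bc h1 t oU UB Up).
exists (cdom c `&` c @^-1` U); split; [exact: preimg_open|by []|].
split; first by have [_ [_ _ H _ _]] := mB; exact: H.
move=> c' q ac' Oq c'q i l m.
have [ht _] := tL.
exact: (ext_closed ac oU Uc ht i l m ac' (img_mem Oq c'q) t0).
Qed.

(** Realize a basis of the fiber of R_h1 by germs of abelian relations; a germ and the
   combination of them with the same jet are equal. *)
Lemma rank_stable p : cdom c p -> B (c p) -> rank_at W p (rho h1).
Proof.
move=> cp Bp; have [J /basis_mod0P[JR Ji Js]] := model_basis hh1 Bp.
have /choice [e eP] : forall k, exists s, abelian_relations_near W p s /\ jet h1 (s c) (c p) = J k.
  by move=> k; exact: relation_ex.
have eR k : abelian_relations_near W p (e k) by have [] := eP k.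
have ej a : jet h1 ((\sum_k a k *: e k) c) (c p) = \sum_k a k *: J k.
  have [_ ->] := relation_sum h1 a ac cp eR; by apply: eq_bigr => k _; have [_ ->] := eP k.
exists e; split => // [a [Om [oO Op z]]|s sR].
  apply: Ji; rewrite -ej; apply: (@jet0 _ _ _ _ _ (img c Om)).
  - exact: img_open.
  - exact: img_mem.
  - by move=> _ [q [Oq cq] <-]; exact: z.
have [a sE] := Js _ (relation_Rfiber h1 cp Bp sR); exists a.
have [aR aj] := relation_sum h1 a ac cp eR.
have -> : s - \sum_k a k *: e k = (-1) *: (\sum_k a k *: e k) + s by rewrite scaleN1r addrC.
apply: (relation_jet_inj hh1 cp Bp); first exact: relation_lin.
by rewrite (relation_jet_lin h1 (-1) ac cp aR sR) ej sE scaleN1r addNr.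
Qed.

Lemma curvature_stable (U : set V) (sg : V -> jetT) l m x : open U -> U `<=` c @` cdom c ->
  holomorphic_jets U sg -> (forall y, U y -> Rfiber W h1 c y (sg y)) -> U x -> B x ->
  curvature W h1 c l m sg x = 0.
Proof.
move=> oU Uc hsg sgR Ux Bx.
have oU' : open (B `&` U) by exact: openI.
have U'B : B `&` U `<=` B by move=> y [].
apply/eqP; rewrite subr_eq0; apply/eqP.
apply: (flat_curvature oB hv (inj hh1) stable_frames l m oU' U'B).
- by move=> y J [By _]; apply: vliftP => //; rewrite stable.
- by move=> L i k; apply: (@hol_sub _ _ U) => [y []|] //; rewrite holE; exact: hsg.
- by move=> y [By Uy]; rewrite -RE //; exact: sgR.
- by [].
Qed.

End Stable.
End InModel.
End Models.

Local Close Scope ring_scope.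

(** * Abelian relations and the tautological connection *)
Theorem mainTheorem3 (R : realType) (n d h0 : nat) (M : complexManifold R n)
    (W : web M d) (rho : nat -> nat)
    (n_ge2 : 2 <= n) (d_gtn : n < d)
    (h0_def : cnum n h0.-1 < d <= cnum n h0)
    (W_ordinary : ordinary W)
    (R_bundles : forall h, h0 - 2 <= h -> R_bundle W h (rho h)) :
  exists rhoW : nat, web_rank W rhoW /\
    (forall h, h0 - 2 <= h -> rho h = rho h.+1 ->
      (* pi_(h+1) is an isomorphism *)
      (forall c p, atlas c -> cdom c p ->
        set_bij (Rfiber W h.+1 c (c p)) (Rfiber W h c (c p)) (@trunc R n d h)) /\
      (* (i) *)
      (forall (Om : set M) (s : forms M d), open Om -> sectionA W Om s ->
        (abelian_relation W Om s <->
         section_of_R W h Om s /\ parallel_jet W h Om s)) /\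
      (* (ii) *)
      rhoW <= rho h) /\
    (* (iii) *)
    (exists h1, h0 - 2 <= h1 /\
      ((rho h1 = 0 /\ rhoW = 0) \/
       (rho h1 = rho h1.+1 /\ rho h1 <> 0 /\ curvature_vanishes W h1 /\
        rhoW = rho h1))).
Proof.
have mx c p (ac : atlas c) (cp : cdom c p) := model_ex h0_def W_ordinary R_bundles ac cp.
have anti h (hh : h0 - 2 <= h) : rho h.+1 <= rho h.
  have [c ac cp] := atlas_cover (base_point M); have [B [v [Bp mB]]] := mx c _ ac cp.
  exact: rank_anti mB h (c (base_point M)) hh Bp.
(* the ranks rho h decrease, so they are constant from their minimum on *)
have exr : exists r, `[< exists2 h, h0 - 2 <= h & rho h = r >].
  by exists (rho (h0 - 2)); apply/asboolP; exists (h0 - 2).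
have [r /asboolP [h1 hh1 <-] rmin] := ex_minnP exr.
have le_rho h (hh : h0 - 2 <= h) : rho h1 <= rho h.
  by apply: rmin; apply/asboolP; exists h.
have stable k : h1 <= k -> rho k = rho h1.
  move=> hk; apply/eqP; rewrite eqn_leq le_rho ?(leq_trans hh1) // andbT.
  elim: k hk => [|k IH]; first by rewrite leqn0 => /eqP ->.
  rewrite leq_eqVlt => /orP[/eqP -> //|hk]; apply: leq_trans (IH hk).
  exact: anti (leq_trans hh1 hk).
have rank p : rank_at W p (rho h1).
  have [c ac cp] := atlas_cover p; have [B [v [Bp mB]]] := mx c _ ac cp.
  exact: (rank_stable ac mB hh1 stable cp Bp).
exists (rho h1); split; first split.
- by move=> p; exists (rho h1).
- by exists (base_point M).
split; last first.
  exists h1; split=> //; have [r0|/eqP r0] := eqVneq (rho h1) 0; [by left|right].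
  split; first by rewrite stable.
  split=> //; split=> // c ac U sg oU Uc hsg sgR l m x Ux.
  have [p cp px] := Uc x Ux; have [B [v [Bp mB]]] := mx c p ac cp.
  rewrite px in Bp.
  exact: (curvature_stable mB hh1 stable l m oU Uc hsg sgR Ux Bp).
move=> h hh rr; split; [|split; last exact: le_rho].
  move=> c p ac cp; have [B [v [Bp mB]]] := mx c p ac cp.
  exact: (trunc_bij mB hh rr Bp).
move=> Om s oO sA; split=> [sR|[sR sP]].
  split=> c p ac Op cp; have [B [v [Bp mB]]] := mx c p ac cp;
    by have [H1 H2] := relation_parallel ac mB hh rr oO Op cp Bp sR.
split=> // c p ac Op cp; have [B [v [Bp mB]]] := mx c p ac cp.
exact: (parallel_closed ac mB hh rr oO Op cp Bp sA sR sP).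
Qed.
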